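(* Let $\lambda<0$ satisfy $D(\lambda):=\det(\mathbf{A}^<(\lambda))=0$, and suppose the components $\{\phi_p(\lambda)\}_{p=1}^P$ of a nullvector $\boldsymbol\phi(\lambda)$ of $\mathbf{A}^<(\lambda)$ are normalized to satisfy $$\sum_{p=1}^P\phi_p(\lambda)=\lambda.$$ Then the function $$\Phi(x;\lambda)=-\frac{i}{\epsilon}e^{ih(x;\lambda)/\epsilon}\int_{-\infty}^xe^{-ih(z;\lambda)/\epsilon}\sum_{p=1}^P\frac{\phi_p(\lambda)}{z-z_p}\,dz$$ satisfies $$\frac1{2\pi i}\int_{-\infty}^\infty u_0(x)\Phi(x;\lambda)\,dx=\lambda,$$ $\Phi(\cdot;\lambda)\in\mathbb{H}^+(\mathbb{R})$, and therefore $\Phi(x;\lambda)$ is an eigenfunction, with eigenvalue $\lambda$, of the spectral problem: $w^+=\Phi$ satisfies $i\epsilon\frac{dw^+}{dx}+\lambda w^+=-\mathcal{C}^+[u_0w^+]$ on $\mathbb{R}$.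
   Context: A star denotes complex conjugation. Let $\epsilon>0$, $P\ge 1$, let $c_1,\dots,c_P$ be nonzero complex numbers with $\sum_{p=1}^P(c_p+c_p^* )=0$, and let $z_1,\dots,z_P\in\mathbb{C}$ satisfy $\mathrm{Im}\{z_p\}>0$ and $\mathrm{Re}\{z_1\}<\dots<\mathrm{Re}\{z_P\}$. The potential is $u_0(x)=\sum_{p=1}^P\big(\frac{c_p}{x-z_p}+\frac{c_p^*}{x-z_p^*}\big)$. Define $$f(x):=\sum_{p=1}^P\Big[c_p\big(\mathrm{Log}(i(x-z_p))+\tfrac{\pi i}{2}\big)+c_p^*\big(\mathrm{Log}(-i(x-z_p^* ))-\tfrac{\pi i}{2}\big)\Big],\qquad h(x;\lambda):=\lambda x+f(x),$$ with $\mathrm{Log}$ the principal branch, so $f'=u_0$. The domain of analyticity of $f$ is $G:=\mathbb{C}\setminus\bigcup_{p}\big(\{z_p+it:t\ge 0\}\cup\{z_p^*-it:t\ge0\}\big)$. Subdomains: $G_0:=\{\mathrm{Re}\{x\}<\mathrm{Re}\{z_1\}\}$, $G_P:=\{\mathrm{Re}\{x\}>\mathrm{Re}\{z_P\}\}$, and for $1\le m\le P-1$, $G_m$ is the set of points with $|x|>R$ ($R$ large and fixed) in the upper half-plane lying between the upward cuts from $z_m$ and $z_{m+1}$. $\mathbb{H}^+(\mathbb{R})\subset L^2(\mathbb{R})$ is the Hardy space of boundary values of functions analytic in the upper half-plane, and $\mathcal{C}^+[\varphi](x):=\lim_{\delta\downarrow0}\frac1{2\pi i}\int_{-\infty}^\infty\frac{\varphi(y)}{y-(x+i\delta)}dy$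 is the orthogonal projection of $L^2(\mathbb{R})$ onto $\mathbb{H}^+(\mathbb{R})$. An eigenfunction for an eigenvalue $\lambda<0$ is a nontrivial $w^+\in\mathbb{H}^+(\mathbb{R})$ satisfying $i\epsilon\frac{dw^+}{dx}+\lambda w^+=-\mathcal{C}^+[u_0w^+]$. The integral in $\Phi$ is a convergent improper integral over a path in $G$ from $-\infty$ to $x$ (equivalently, since $\lambda<0$, starting from $i\infty$ in $G_0$). The matrix $\mathbf{A}^<(\lambda)\in\mathbb{C}^{P\times P}$ has components $A^<_{mp}(\lambda):=\int_{C_m^<}\frac{e^{-ih(z;\lambda)/\epsilon}}{z-z_p}\,dz$, $\lambda<0$, where $C_m^<:=U_m^<$ unless $ic_m/\epsilon$ is a strictly negative integer, in which case $C_m^<:=\ell_0(z_m)$. $U_m^<$ runs in $G$ from $i\infty$ in $G_0$ to $i\infty$ in $G_m$; $\ell_0(z_m)$ originates at $i\infty$ in $G_0$, runs in $G$, and terminates at $z_m$. *)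

(* Defs.v *)
From HB Require Import structures.
From mathcomp Require Import all_boot all_order all_algebra.
From mathcomp Require Import complex.
From mathcomp Require Import all_classical all_reals all_analysis.
Set Implicit Arguments.
Unset Strict Implicit.
Unset Printing Implicit Defensive.
Import Order.TTheory GRing.Theory Num.Theory.
Import numFieldNormedType.Exports.
Import ComplexField.

Local Open Scope classical_set_scope.
Local Open Scope ring_scope.
Local Open Scope complex_scope.

Section ComplexFunctions.
Variable R : realType.
Implicit Types (z : R[i]) (w : R -> R[i]).

Definition ReC z : R := complex.Re z.
Definition ImC z : R := complex.Im z.

Definition absC z : R := Normc.normc z.

Definition expC z : R[i] :=
  (expR (ReC z))%:C * (cos (ImC z) +i* sin (ImC z)).

(* Principal argument, with values in ]-pi, pi] for z != 0. *)
Definition ArgC z : R :=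
  if 0 <= ImC z then acos (ReC z / absC z) else - acos (ReC z / absC z).

Definition LogC z : R[i] := ln (absC z) +i* ArgC z.

Definition integralC (D : set R) w : R[i] :=
  Rintegral lebesgue_measure D (ReC \o w)
    +i* Rintegral lebesgue_measure D (ImC \o w).

Definition derivableC w (x : R) : Prop :=
  derivable (ReC \o w) x 1 /\ derivable (ImC \o w) x 1.

Definition deriveC w (x : R) : R[i] :=
  derive1 (ReC \o w) x +i* derive1 (ImC \o w) x.

End ComplexFunctions.

Arguments ReC {R} z.
Arguments ImC {R} z.

Section Contours.
Variable R : realType.
Implicit Types (D : set R[i]) (gam : R -> R[i]) (g : R[i] -> R[i]).

(* A contour is parametrized by the whole real line, so that each of its two
   ends is a limit; an end at a finite point is approached as the parameter
   tends to infinity.  The velocity may vanish, hence corners are allowed. *)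
Definition contour_in D gam : Prop :=
  [/\ forall t, gam t \in D,
      forall t, derivableC gam t,
      continuous (derive1 (ReC \o gam)) &
      continuous (derive1 (ImC \o gam))].

Definition starts_at_iinfty_in D gam : Prop :=
  ImC (gam t) @[t --> -oo] --> +oo /\ \forall t \near -oo, gam t \in D.

Definition ends_at_iinfty_in D gam : Prop :=
  ImC (gam t) @[t --> +oo] --> +oo /\ \forall t \near +oo, gam t \in D.

(* Here -oo is the left end of the real axis. *)
Definition starts_at_minfty gam : Prop :=
  ReC (gam t) @[t --> -oo] --> -oo /\
  exists M : R, \forall t \near -oo, `|ImC (gam t)| <= M.

(* R[i] itself carries no canonical topology: its norm topology, and its normed
   space structure over itself, are those of R[i]^o. *)
Definition ends_at gam (z0 : R[i]) : Prop := (gam t : R[i]^o) @[t --> +oo] --> (z0 : R[i]^o).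

(* The improper integral of g(z) dz along gam. *)
Definition contour_integral gam g : R[i] :=
  let k t := g (gam t) * deriveC gam t in
  lim ((integralC `[a, 0] k : R[i]^o) @[a --> -oo]) +
  lim ((integralC `[0, b] k : R[i]^o) @[b --> +oo]).

End Contours.

Section HardySpace.
Variable R : realType.
Implicit Types (w phi : R -> R[i]).

Definition analytic_upper (F : R[i] -> R[i]) : Prop :=
  forall z : R[i], 0 < ImC z -> derivable (F : R[i]^o -> R[i]^o) z 1.

Definition L2 w : Prop :=
  ReC \o w \in Lfun (@lebesgue_measure R) 2%:E /\
  ImC \o w \in Lfun (@lebesgue_measure R) 2%:E.

(* The vertical boundary values of the analytic functions that are bounded in
   L^2 uniformly over the horizontal lines of the upper half-plane. *)
Definition Hardy_plus w : Prop :=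
  L2 w /\
  exists F : R[i] -> R[i],
    [/\ analytic_upper F,
        exists M : R, forall y : R, 0 < y ->
          (\int[lebesgue_measure]_(x in setT)
             (absC (F (x +i* y)) ^+ 2)%:E <= M%:E)%E &
        {ae lebesgue_measure, forall x : R,
          (F (x +i* y) : R[i]^o) @[y --> 0^'+] --> (w x : R[i]^o)}].

Definition cauchy_upper phi (x delta : R) : R[i] :=
  (2 * pi *i)^-1 *
  integralC setT (fun y : R => phi y / (y%:C - (x +i* delta))).

Definition Cplus phi (x : R) : R[i] :=
  lim ((cauchy_upper phi x delta : R[i]^o) @[delta --> 0^'+]).

Definition eigenfunction (eps : R) (u : R -> R[i]) (lambda : R) w : Prop :=
  [/\ Hardy_plus w,
      ~ {ae lebesgue_measure, forall x : R, w x = 0},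
      forall x : R, derivableC w x,
      forall x : R, cvg ((cauchy_upper (fun y => u y * w y) x delta : R[i]^o)
                           @[delta --> 0^'+]) &
      forall x : R, 'i * eps%:C * deriveC w x + lambda%:C * w x =
                    - Cplus (fun y => u y * w y) x].

End HardySpace.

Section RationalPotential.
Variables (R : realType) (P : nat) (eps : R) (c z : 'I_P -> R[i]).
Implicit Types (x : R[i]) (m p q : 'I_P) (lambda : R).

Definition u0 x : R[i] :=
  \sum_p (c p / (x - z p) + (c p)^* / (x - (z p)^*)).

Definition f x : R[i] :=
  \sum_p (c p * (LogC ('i * (x - z p)) + (pi / 2)%:C * 'i) +
          (c p)^* * (LogC (- 'i * (x - (z p)^*)) - (pi / 2)%:C * 'i)).

Definition h lambda x : R[i] := lambda%:C * x + f x.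

Definition G : set R[i] :=
  [set x | forall p (t : R), 0 <= t ->
     x != z p + 'i * t%:C /\ x != (z p)^* - 'i * t%:C].

(* The subdomains of index 0 <= k <= P; the pole of (1-based) index p in the
   usual numbering is z of the ordinal p.-1, so that k poles lie to the left
   of [Gsub rad k] and P - k to the right. *)
Definition Gsub (rad : R) (k : nat) : set R[i] :=
  [set x | [/\ forall p, (p < k)%N -> ReC (z p) < ReC x,
               forall p, (k <= p)%N -> ReC x < ReC (z p) &
               (0 < k < P)%N -> rad < absC x /\ 0 < ImC x]].

(* The exponential e^(-ih/eps) extends analytically to z m, vanishing there,
   exactly in this case. *)
Definition exceptional m : Prop :=
  exists n : nat, 'i * c m / eps%:C = - (n.+1%:R).

Definition Ucontour (rad : R) m (gam : R -> R[i]) : Prop :=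
  [/\ contour_in G gam, starts_at_iinfty_in (Gsub rad 0) gam &
      ends_at_iinfty_in (Gsub rad m.+1) gam].

Definition ell0_contour (rad : R) m (gam : R -> R[i]) : Prop :=
  [/\ contour_in G gam, starts_at_iinfty_in (Gsub rad 0) gam &
      ends_at gam (z m)].

Definition Ccontour (rad : R) m (gam : R -> R[i]) : Prop :=
  (exceptional m -> ell0_contour rad m gam) /\
  (~ exceptional m -> Ucontour rad m gam).

Definition Amatrix (C : 'I_P -> R -> R[i]) lambda : 'M[R[i]]_P :=
  \matrix_(m, p) contour_integral (C m)
    (fun s => expC (- 'i * h lambda s / eps%:C) / (s - z p)).

Definition Phi_contour (rad : R) (x : R) (gam : R -> R[i]) : Prop :=
  [/\ contour_in G gam,
      starts_at_minfty gam \/ starts_at_iinfty_in (Gsub rad 0) gam &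
      ends_at gam x%:C].

(* [L x] is the path of integration ending at the real point x. *)
Definition Phi (L : R -> R -> R[i]) lambda (phi : 'cV[R[i]]_P) (x : R) : R[i] :=
  - ('i / eps%:C) * expC ('i * h lambda x%:C / eps%:C) *
  contour_integral (L x)
    (fun s => expC (- 'i * h lambda s / eps%:C) *
              \sum_p (phi p 0 / (s - z p))).

End RationalPotential.

(* Main.v *)
(**
Write [E = exp(-ih/eps)] and [S = sum_p phi_p/(z - z_p)].  Then [Phi] is
[-(i/eps) E^-1] times the primitive of [E S] that vanishes at [i oo] in [G_0],
so [i eps Phi' + (lambda + u0) Phi = S].  Turning the cuts that issue from the
[z_p] downwards gives a second solution, which is [O(1/|z|)] in the upper
half-plane.  On each column between consecutive cuts the two primitives differ,
up to a factor, by a constant; [A phi = 0] says that these constants agree, so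
that the two solutions coincide off the lines [Re z = Re z_p], and it makes them
[O(|z - z_m|^(-1/2))] at the poles.

By Cauchy's theorem for this pair, the Cauchy integral [F] of [Phi] over the real
line equals [Phi] above the axis, and the integral of [Phi(y)/(y - conj z_p)] vanishes.
Since [F] is analytic at [z_m], the equation times [z - z_m] gives in the limit
[c_m F(z_m) = phi_m].  Partial fractions then evaluate the integral of [u0 Phi]
and the projection [C^+[u0 Phi] = u0 Phi - S].
*)
Require Import Defs.
From HB Require Import structures.
From mathcomp Require Import all_boot all_order all_algebra.
From mathcomp Require Import complex.
From mathcomp Require Import all_classical all_reals all_analysis.
From mathcomp Require Import measurable_realfun.
From mathcomp Require Import ring lra.
Set Implicit Arguments.
Unset Strict Implicit.
Unset Printing Implicit Defensive.
Import Order.TTheory GRing.Theory Num.Theory.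
Import numFieldNormedType.Exports.
Local Open Scope classical_set_scope.
Local Open Scope ring_scope.
Local Open Scope complex_scope.

(** * Complex limits and derivatives *)

(** The obstacle is that [G] is cut along the upward rays from the poles, inside the half-plane
    where a Hardy function must be analytic. Contour deformation and residue calculus are avoided:
    every contour integral is a difference of limits of a primitive, and primitives are integrals
    along horizontal and vertical segments. Both cut planes contain the convex columns between the
    poles, where primitives of proportional integrands are related up to a constant. Neighbouring
    columns are compared at the pole between them, where a primitive has a limit as soon as its
    integrand is [O(|z - z_m|^b)] with [b > -1]; the exponent [-1/2] is a uniform choice that also
    absorbs a logarithm.

    The two kinds of contours reflect the factor between the two determinations of [E] in a column.
    Where [E] vanishes at [z_m], this factor in general changes there, and equality of the constants
    on both sides fixes the values of both primitives at [z_m]. In the exceptional case it does not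
    change, equality is automatic, and the row of [A] prescribes the value at [z_m] instead. *)

Section Modulus.
Variable R : realType.
Implicit Types (x y z : R[i]) (r : R).

Lemma normE z : `|z| = (absC z)%:C.
Proof. by case: z => a b; rewrite normc_def. Qed.

Lemma absC_ge0 z : 0 <= absC z.
Proof. by case: z => a b; rewrite /absC /= sqrtr_ge0. Qed.

Lemma absC_re r : absC r%:C = `|r|.
Proof. by rewrite /absC /= expr0n /= addr0 sqrtr_sqr. Qed.

Lemma absCD x y : absC (x + y) <= absC x + absC y.
Proof. exact: le_normcD. Qed.

Lemma absCM x y : absC (x * y) = absC x * absC y.
Proof. exact: Normc.normcM. Qed.

Lemma absCV x : absC x^-1 = (absC x)^-1.
Proof. exact: Normc.normcV. Qed.

Lemma absCN x : absC (- x) = absC x.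
Proof. exact: normcN. Qed.

Lemma absC0 : absC (0 : R[i]) = 0.
Proof. exact: Normc.normc0. Qed.

Lemma absC1 : absC (1 : R[i]) = 1.
Proof. exact: Normc.normc1. Qed.

Lemma absCB x y : absC (x - y) <= absC x + absC y.
Proof. by rewrite -(absCN y) absCD. Qed.

Lemma absCBC x y : absC (x - y) = absC (y - x).
Proof. by rewrite -absCN opprB. Qed.

Lemma absC_tri y x z : absC (x - z) <= absC (x - y) + absC (y - z).
Proof. by rewrite (le_trans _ (absCD _ _)) // addrA subrK. Qed.

Lemma absC_lb x y : absC x - absC y <= absC (x - y).
Proof. by rewrite lerBlDr (le_trans _ (absCD _ _)) // subrK. Qed.

Lemma absC_eq0 x : (absC x == 0) = (x == 0).
Proof.
apply/eqP/eqP => [|->]; last exact: absC0.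
exact: Normc.eq0_normc.
Qed.

Lemma absC_gt0 x : (0 < absC x) = (x != 0).
Proof. by rewrite lt_def absC_ge0 andbT absC_eq0. Qed.

Lemma absCi : absC ('i : R[i]) = 1.
Proof. by rewrite /absC /= expr0n expr1n /= add0r sqrtr1. Qed.

Lemma ReC_le x : `|ReC x| <= absC x.
Proof.
case: x => a b; rewrite /absC /= -[leLHS]sqrtr_sqr ler_sqrt ?lerDl ?sqr_ge0 //.
by rewrite addr_ge0 ?sqr_ge0.
Qed.

Lemma ImC_le x : `|ImC x| <= absC x.
Proof.
case: x => a b; rewrite /absC /= -[leLHS]sqrtr_sqr ler_sqrt ?lerDr ?sqr_ge0 //.
by rewrite addr_ge0 ?sqr_ge0.
Qed.

Lemma complexRI x : x = (ReC x)%:C + 'i * (ImC x)%:C.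
Proof. exact: complexE. Qed.

Lemma absC_le_RI x : absC x <= `|ReC x| + `|ImC x|.
Proof.
by rewrite {1}[x]complexRI (le_trans (absCD _ _)) // absCM absCi mul1r !absC_re.
Qed.

Lemma sqr_absC x : absC x ^+ 2 = ReC x ^+ 2 + ImC x ^+ 2.
Proof. by case: x => a b; rewrite /absC /= sqr_sqrtr // addr_ge0 ?sqr_ge0. Qed.

Lemma absCX x n : absC (x ^+ n) = absC x ^+ n.
Proof.
elim: n => [|n IH]; first by rewrite !expr0 absC1.
by rewrite !exprS absCM IH.
Qed.

Lemma absC_conj x : absC x^*%R = absC x.
Proof. by case: x => a b; rewrite /absC /= sqrrN. Qed.

Lemma absC_sum (I : Type) (s : seq I) (F : I -> R[i]) :
  absC (\sum_(i <- s) F i) <= \sum_(i <- s) absC (F i).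
Proof.
elim/big_ind2: _ => //; first by rewrite absC0.
by move=> a a' b b' h h'; rewrite (le_trans (absCD _ _)) // lerD.
Qed.

Lemma complex_eq x y : ReC x = ReC y -> ImC x = ImC y -> x = y.
Proof. by case: x y => [a b] [c d] /= -> ->. Qed.

Lemma ReCD x y : ReC (x + y) = ReC x + ReC y. Proof. by case: x y => [? ?] []. Qed.
Lemma ImCD x y : ImC (x + y) = ImC x + ImC y. Proof. by case: x y => [? ?] []. Qed.
Lemma ReCN x : ReC (- x) = - ReC x. Proof. by case: x. Qed.
Lemma ImCN x : ImC (- x) = - ImC x. Proof. by case: x. Qed.
Lemma ReCM x y : ReC (x * y) = ReC x * ReC y - ImC x * ImC y.
Proof. by case: x y => [? ?] []. Qed.
Lemma ImCM x y : ImC (x * y) = ReC x * ImC y + ImC x * ReC y.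
Proof. by case: x y => [? ?] []. Qed.
Lemma ReCr r : ReC r%:C = r. Proof. by []. Qed.
Lemma ImCr r : ImC r%:C = 0. Proof. by []. Qed.
Lemma ReCi : ReC ('i : R[i]) = 0. Proof. by []. Qed.
Lemma ImCi : ImC ('i : R[i]) = 1. Proof. by []. Qed.
Lemma ReCJ x : ReC x^*%R = ReC x. Proof. by case: x. Qed.
Lemma ImCJ x : ImC x^*%R = - ImC x. Proof. by case: x. Qed.

Definition CE := (ReCD, ImCD, ReCN, ImCN, ReCM, ImCM, ReCr, ImCr, ReCi, ImCi,
  ReCJ, ImCJ).

Lemma mulii : 'i * 'i = - 1 :> R[i].
Proof. by apply: complex_eq; rewrite ?CE /= ; ring. Qed.

Lemma real_neq0 r : (r%:C != 0 :> R[i]) = (r != 0).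
Proof. by rewrite (inj_eq (@complexI R)). Qed.

Lemma i_neq0 : 'i != 0 :> R[i].
Proof. by rewrite -absC_gt0 absCi. Qed.

End Modulus.

Section Limits.
Variable R : realType.

(* The lock keeps unification from unfolding convergence in [R[i]^o]. *)
Fact clim_key : unit. Proof. exact: tt. Qed.

Definition clim : forall (T : Type) (Fi : set_system T) (F : T -> R[i]) (l : R[i]), Prop :=
  locked_with clim_key (fun T Fi F l =>
    (F x : R[i]^o) @[x --> Fi] --> (l : R[i]^o)).

Lemma climE (T : Type) (Fi : set_system T) (F : T -> R[i]) (l : R[i]) :
  clim Fi F l = ((F x : R[i]^o) @[x --> Fi] --> (l : R[i]^o)).
Proof. by rewrite /clim unlock. Qed.

Section Filtered.
Variables (T : Type) (Fi : set_system T).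
Context {FF : Filter Fi}.
Implicit Types (F H : T -> R[i]) (l k : R[i]).

Lemma climP F l :
  clim Fi F l <-> forall e : R, 0 < e -> \forall x \near Fi, absC (F x - l) < e.
Proof.
rewrite climE; split=> [/cvgrPdist_lt h e e0|h].
  have e0' : (0 : R[i]) < e%:C by rewrite ltcR.
  apply: filterS (h _ e0') => x.
  by rewrite normE ltcR absCBC.
apply/cvgrPdist_lt => e e0.
(* In the order of [R[i]] a positive number has zero imaginary part, so its balls are those of real
   radius. *)
have er : e = (ReC e)%:C by apply: complex_eq; rewrite ?CE //; exact: ger0_Im (ltW e0).
move: e0; rewrite er ltcR => e0.
apply: filterS (h _ e0) => x.
by rewrite normE ltcR absCBC.
Qed.

Lemma clim_cst l : clim Fi (fun=> l) l.
Proof. rewrite !climE; exact: cvg_cst. Qed.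

Lemma climD F H l k : clim Fi F l -> clim Fi H k -> clim Fi (fun x => F x + H x) (l + k).
Proof. rewrite !climE; exact: cvgD. Qed.

Lemma climN F l : clim Fi F l -> clim Fi (fun x => - F x) (- l).
Proof. rewrite !climE; exact: cvgN. Qed.

Lemma climM F H l k : clim Fi F l -> clim Fi H k -> clim Fi (fun x => F x * H x) (l * k).
Proof. rewrite !climE; exact: (@cvgM R[i]). Qed.

Lemma climZ k F l : clim Fi F l -> clim Fi (fun x => k * F x) (k * l).
Proof. exact: (climM (clim_cst k)). Qed.

Lemma clim_sum (I : Type) (r : seq I) (F : I -> T -> R[i]) (l : I -> R[i]) :
  (forall i, clim Fi (F i) (l i)) -> clim Fi (fun x => \sum_(i <- r) F i x) (\sum_(i <- r) l i).
Proof.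
move=> h; elim: r => [|i r IH].
  by under [X in clim _ X]funext do rewrite big_nil; rewrite big_nil; exact: clim_cst.
by under [X in clim _ X]funext do rewrite big_cons; rewrite big_cons; exact: climD.
Qed.

Lemma climV F l : l != 0 -> clim Fi F l -> clim Fi (fun x => (F x)^-1) l^-1.
Proof. by rewrite !climE => l0 h; apply: (@cvgV R[i]). Qed.

Lemma clim_abs F l : clim Fi F l -> (fun x => absC (F x)) x @[x --> Fi] --> absC l.
Proof.
move=> /climP h; apply/cvgrPdist_lt => e e0.
apply: filterS (h _ e0) => x; apply: le_lt_trans.
rewrite ler_norml lerNl opprB; apply/andP; split; first exact: absC_lb.
by rewrite absCBC; exact: absC_lb.
Qed.

Lemma clim_norm0 F l (B : T -> R) : (\forall x \near Fi, absC (F x - l) <= B x) ->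
  B x @[x --> Fi] --> (0 : R) -> clim Fi F l.
Proof.
move=> h /cvgrPdist_lt hB; apply/climP => e e0.
near=> x; have : absC (F x - l) <= B x by near: x.
move=> hx; rewrite (le_lt_trans hx) // (le_lt_trans (ler_norm _)) //.
by rewrite -normrN -[- B x]add0r; near: x; apply: hB.
Unshelve. all: by end_near. Qed.

Lemma climRI F l : clim Fi F l <->
  (ReC (F x) @[x --> Fi] --> ReC l) /\ (ImC (F x) @[x --> Fi] --> ImC l).
Proof.
split=> [/climP h|[/cvgrPdist_lt h1 /cvgrPdist_lt h2]].
  split; apply/cvgrPdist_lt => e e0; apply: filterS (h _ e0) => x.
    by apply: le_lt_trans; rewrite distrC -ReCN -ReCD ReC_le.
  by apply: le_lt_trans; rewrite distrC -ImCN -ImCD ImC_le.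
apply/climP => e e0; have e2 : 0 < e / 2 by rewrite divr_gt0.
near=> x; rewrite (le_lt_trans (absC_le_RI _)) // (splitr e) ltrD //.
  by rewrite ReCD ReCN distrC; near: x; apply: h1.
by rewrite ImCD ImCN distrC; near: x; apply: h2.
Unshelve. all: by end_near. Qed.

Lemma clim_near F H l : (\forall x \near Fi, F x = H x) -> clim Fi F l -> clim Fi H l.
Proof.
move=> h /climP hF; apply/climP => e e0.
by apply: filterS2 h (hF _ e0) => x ->.
Qed.

End Filtered.

Lemma clim_unique (T : Type) (Fi : set_system T) {FF : ProperFilter Fi} (F : T -> R[i]) l k :
  clim Fi F l -> clim Fi F k -> l = k.
Proof. by rewrite !climE => h1 h2; exact: (cvg_unique (norm_hausdorff (V:=R[i]^o)) h1 h2). Qed.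

End Limits.

Section Derivatives.
Variable R : realType.

Section Along.
Variables (T : topologicalType) (j : T -> R[i]).
Implicit Types (F H : T -> R[i]) (s : T) (d e : R[i]).

Definition ctn F s := clim (nbhs s) F (F s).

(* Caratheodory's form of the derivative of F with respect to the function j. *)
Definition der F s d := exists Q : T -> R[i],
  [/\ forall s', F s' = F s + Q s' * (j s' - j s), Q s = d & ctn Q s].

Hypothesis jc : forall s, ctn j s.

Lemma ctn_cst d s : ctn (fun=> d) s. Proof. exact: clim_cst. Qed.
Lemma ctnD F H s : ctn F s -> ctn H s -> ctn (fun x => F x + H x) s.
Proof. exact: climD. Qed.
Lemma ctnM F H s : ctn F s -> ctn H s -> ctn (fun x => F x * H x) s.
Proof. exact: climM. Qed.
Lemma ctnN F s : ctn F s -> ctn (fun x => - F x) s.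
Proof. exact: climN. Qed.
Lemma ctnB F H s : ctn F s -> ctn H s -> ctn (fun x => F x - H x) s.
Proof. by move=> h k; exact: (ctnD h (ctnN k)). Qed.
Lemma ctnV F s : F s != 0 -> ctn F s -> ctn (fun x => (F x)^-1) s.
Proof. exact: climV. Qed.
Lemma ctnZ k F s : ctn F s -> ctn (fun x => k * F x) s.
Proof. exact: climZ. Qed.
Lemma ctn_sum (I : Type) (r : seq I) (F : I -> T -> R[i]) s :
  (forall i, ctn (F i) s) -> ctn (fun x => \sum_(i <- r) F i x) s.
Proof. exact: clim_sum. Qed.

Lemma ctn_near F H s : (\forall x \near s, F x = H x) -> ctn F s -> ctn H s.
Proof.
by move=> h hF; rewrite /ctn -(nbhs_singleton h); apply: clim_near hF.
Qed.

Lemma der_ctn F s d : der F s d -> ctn F s.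
Proof.
move=> [Q [hF _ hQ]].
rewrite (_ : F = fun x => F s + Q x * (j x - j s)); last exact/funext.
exact: (ctnD (ctn_cst (F s) s) (ctnM hQ (ctnB (jc s) (ctn_cst (j s) s)))).
Qed.

Lemma der_eq F s d e : d = e -> der F s d -> der F s e.
Proof. by move=> ->. Qed.

Lemma der_fun F H s d : F =1 H -> der F s d -> der H s d.
Proof. by move=> /funext ->. Qed.

Lemma der_cst d s : der (fun=> d) s 0.
Proof.
exists (fun=> 0); split=> //; last exact: ctn_cst.
by move=> s'; rewrite mul0r addr0.
Qed.

Lemma der_id s : der j s 1.
Proof.
exists (fun=> 1); split=> //; last exact: ctn_cst.
by move=> s'; rewrite mul1r addrC subrK.
Qed.

Lemma derD F H s d e : der F s d -> der H s e -> der (fun x => F x + H x) s (d + e).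
Proof.
move=> [Q [h <- c]] [Q' [h' <- c']]; exists (fun x => Q x + Q' x); split=> //.
  by move=> s'; rewrite h h'; ring.
exact: ctnD.
Qed.

Lemma derM F H s d e : der F s d -> der H s e ->
  der (fun x => F x * H x) s (d * H s + F s * e).
Proof.
move=> hF hH; have cH := der_ctn hH.
move: hF hH => [Q [h <- c]] [Q' [h' <- c']].
exists (fun x => Q x * H x + F s * Q' x); split=> //.
  by move=> s'; rewrite {1}h {1 2}h' {2}h'; ring.
by apply: ctnD; apply: ctnM => //; exact: ctn_cst.
Qed.

Lemma derZ k F s d : der F s d -> der (fun x => k * F x) s (k * d).
Proof.
move=> [Q [h <- c]]; exists (fun x => k * Q x); split=> //.
  by move=> s'; rewrite h; ring.
exact: ctnM (ctn_cst _ _) c.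
Qed.

Lemma derN F s d : der F s d -> der (fun x => - F x) s (- d).
Proof.
move=> [Q [h <- c]]; exists (fun x => - Q x); split=> //; last exact: ctnN.
by move=> s'; rewrite h; ring.
Qed.

Lemma derB F H s d e : der F s d -> der H s e -> der (fun x => F x - H x) s (d - e).
Proof. by move=> h k; exact: (derD h (derN k)). Qed.

Hypothesis jinj : injective j.

(** The factorization in [der] is required at every [s'], not only near [s]. Where [F] and [H]
    differ, the factor is replaced by the difference quotient of [H], and injectivity of [j] keeps
    its denominator from vanishing. *)
Lemma der_near F H s d : (\forall x \near s, F x = H x) -> der F s d -> der H s d.
Proof.
move=> h [Q [hF <- c]].
exists (fun x => if F x == H x then Q x else (H x - H s) / (j x - j s)).
have e := nbhs_singleton h.
split; last 1 first.
- rewrite /ctn e eqxx; apply: clim_near c.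
  by apply: filterS h => x ->; rewrite eqxx.
- move=> s'; case: eqP => [<-|ne]; first by rewrite -e -hF.
  have [js|nz] := eqVneq (j s' - j s) 0.
    by move/eqP: js ne; rewrite subr_eq0 => /eqP /jinj ->; rewrite e.
  by rewrite mulfVK // addrC subrK.
- by rewrite e eqxx.
Qed.

Lemma derV F s d : F s != 0 -> der F s d -> der (fun x => (F x)^-1) s (- d / F s ^+ 2).
Proof.
move=> F0 hF; have cF := der_ctn hF; move: hF => [Q [hF <- c]].
have nF : \forall x \near s, F x != 0.
  have /climP /(_ (absC (F s))) := cF; rewrite absC_gt0 => /(_ F0).
  apply: filterS => x; apply: contraTneq => ->.
  by rewrite sub0r absCN ltxx.
exists (fun x => if F x == 0 then ((F x)^-1 - (F s)^-1) / (j x - j s)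
                 else - Q x / (F x * F s)); split.
- move=> s'; case: eqP => [Fs'|/eqP Fs'].
    have [js|nz] := eqVneq (j s' - j s) 0.
      by move/eqP: js Fs'; rewrite subr_eq0 => /eqP /jinj -> /eqP; rewrite (negPf F0).
    by rewrite mulfVK // addrC subrK.
  have -> : - Q s' / (F s' * F s) * (j s' - j s) = - (Q s' * (j s' - j s)) / (F s' * F s).
    by ring.
  have -> : Q s' * (j s' - j s) = F s' - F s by rewrite (hF s'); ring.
  by field; rewrite Fs' F0.
- by rewrite (negPf F0) expr2.
- rewrite /ctn (negPf F0); apply: (clim_near (F := fun x => - Q x / (F x * F s))).
    by apply: filterS nF => x /negPf ->.
  apply: climM; first exact: climN.
  apply: climV; first by rewrite mulf_neq0.
  by apply: (climM cF); exact: clim_cst.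
Qed.

End Along.
End Derivatives.
Arguments ctn_cst {R T} d s.
Arguments der_cst {R T} j d s.
Arguments der_id {R T} j s.

Section Curves.
Variable R : realType.
Implicit Types (w g : R -> R[i]) (F : R[i] -> R[i]).

(** Complex differentiability and differentiability in a real parameter are both instances of [der],
    with [j] the identity or the embedding of [R], so that the rules of calculus are shared. The
    type [R[i]^o] selects the norm topology. *)
Definition inC (z : R[i]^o) : R[i] := z.
Definition inR (r : R) : R[i] := r%:C.
Definition derC (F : R[i] -> R[i]) (s d : R[i]) := @der R (R[i]^o) inC F s d.
Definition ctC (F : R[i] -> R[i]) (s : R[i]) := @ctn R (R[i]^o) F s.
Definition derR w (t : R) d := @der R R inR w t d.
Definition ctR w (t : R) := @ctn R R w t.

Lemma inC_ctn s : @ctn R (R[i]^o) inC s.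
Proof. by rewrite /ctn climE; exact: cvg_id. Qed.

Lemma inR_ctn s : @ctn R R inR s.
Proof.
apply/climRI; split; first by rewrite /inR /=; exact: cvg_id.
exact: cvg_cst.
Qed.

Lemma inC_inj : injective inC. Proof. by []. Qed.

Lemma ctn_comp (T : topologicalType) F (w : T -> R[i]) t :
  ctC F (w t) -> ctn w t -> ctn (F \o w) t.
Proof. by rewrite /ctC /ctn !climE => hF hw A hA; exact: hw _ (hF _ hA). Qed.

Lemma der_comp (T : topologicalType) (j : T -> R[i]) F (w : T -> R[i]) t d e :
  (forall t, ctn j t) -> derC F (w t) d -> der j w t e -> der j (F \o w) t (d * e).
Proof.
move=> jc [Q [hF <- c]] hw; have cw := der_ctn jc hw.
move: hw => [Q' [hw <- c']].
exists (fun x => Q (w x) * Q' x); split=> // [s'|].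
  have e' : w s' - w t = Q' s' * (j s' - j t) by rewrite (hw s'); ring.
  by rewrite /= hF /inC e'; ring.
by apply: ctnM => //; exact: (ctn_comp c).
Qed.

Lemma ReC_div (x : R[i]) (r : R) : ReC (x / r%:C) = ReC x / r.
Proof. by rewrite -fmorphV !CE mulr0 subr0. Qed.

Lemma ImC_div (x : R[i]) (r : R) : ImC (x / r%:C) = ImC x / r.
Proof. by rewrite -fmorphV !CE mulr0 add0r. Qed.

Lemma derRP w t d : derR w t d <->
  is_derive t 1 (ReC \o w) (ReC d) /\ is_derive t 1 (ImC \o w) (ImC d).
Proof.
split=> [[Q [h <- /climRI [c1 c2]]]|[]].
  split; apply/is_derive1_caratheodory; [exists (@ReC R \o Q)|exists (@ImC R \o Q)]; split=> // x.
    by rewrite /= h /inR -rmorphB !CE; ring.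
  by rewrite /= h /inR -rmorphB !CE; ring.
move=> /is_derive1_caratheodory [g1 [h1 c1 e1]] /is_derive1_caratheodory [g2 [h2 c2 e2]].
exists (fun x => g1 x +i* g2 x); split; last by apply/climRI.
  move=> x; rewrite /inR -rmorphB; apply: complex_eq; rewrite !CE /= mulr0.
    by have /= := h1 x; lra.
  by have /= := h2 x; lra.
by rewrite e1 e2; case: (d).
Qed.

End Curves.

(** * Mean value inequality, fundamental theorem of calculus, integrals with a parameter *)

Section Integration.
Variable R : realType.
Implicit Types (w g : R -> R[i]) (F : R[i] -> R[i]).
Implicit Types (a b t u : R).
Local Notation mu := (@lebesgue_measure R).

Lemma ctR_RI w t : ctR w t <->
  {for t, continuous (ReC \o w)} /\ {for t, continuous (ImC \o w)}.
Proof. exact: climRI. Qed.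

Lemma is_derive_continuous (f : R -> R) (t d : R) :
  is_derive t 1 f d -> {for t, continuous f}.
Proof. by move=> h; apply: differentiable_continuous; exact/derivable1_diffP. Qed.

Lemma derR_ctR w t d : derR w t d -> ctR w t.
Proof. exact: (der_ctn (@inR_ctn R)). Qed.

Lemma derC_ctC F z d : derC F z d -> ctC F z.
Proof. exact: (der_ctn (@inC_ctn R)). Qed.

Lemma within_ct (f : R -> R) a b : (forall t, a <= t <= b -> {for t, continuous f}) ->
  {within `[a, b], continuous f}.
Proof.
move=> h; apply: continuous_in_subspaceT => t; rewrite inE /= in_itv /=; exact: h.
Qed.

Lemma real_monotone (f f' : R -> R) a b : a <= b ->
  (forall t, a <= t <= b -> is_derive t 1 f (f' t)) ->
  (forall t, a <= t <= b -> 0 <= f' t) -> f a <= f b.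
Proof.
move=> ab hd h0.
have [] := @MVT_segment R f f' a b ab.
- move=> t; rewrite in_itv /= => /andP[h1 h2]; apply: hd; by rewrite !ltW.
- by apply: within_ct => t /hd; exact: is_derive_continuous.
move=> c; rewrite in_itv /= => hc e; rewrite -subr_ge0 e mulr_ge0 ?h0 //.
by rewrite subr_ge0.
Qed.

Lemma ReC_phase (v : R[i]) : absC v != 0 -> ReC (v^*%R / (absC v)%:C * v) = absC v.
Proof.
by move=> v0; rewrite mulrAC ReC_div !CE mulNr opprK -!expr2 -sqr_absC expr2 mulfK.
Qed.

(** Complex values have no mean value theorem, so the real function [B - Re (u * w)] is shown to
    increase for every [u] in the unit disc; then [u] is taken to be the conjugate phase of the
    increment of [w], which turns the real part into the modulus. *)
Lemma mean_value w w' (B B' : R -> R) a b : a <= b ->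
  (forall t, a <= t <= b -> derR w t (w' t)) ->
  (forall t, a <= t <= b -> is_derive t 1 B (B' t)) ->
  (forall t, a <= t <= b -> absC (w' t) <= B' t) ->
  absC (w b - w a) <= B b - B a.
Proof.
move=> ab hw hB hle.
have key (u : R[i]) : absC u <= 1 -> ReC (u * (w b - w a)) <= B b - B a.
  move=> hu.
  have H t : a <= t <= b ->
      is_derive t 1 (fun t => B t - ReC (u * w t)) (B' t - ReC (u * w' t)).
    move=> ht; apply: is_deriveB; first exact: hB.
    by have /derRP [] := derZ u (hw _ ht).
  suff : B a - ReC (u * w a) <= B b - ReC (u * w b).
    by rewrite mulrBr ReCD ReCN; lra.
  apply: (real_monotone ab H) => t ht; rewrite subr_ge0 (le_trans (ler_norm _)) //.
  rewrite (le_trans (ReC_le _)) // absCM (le_trans _ (hle _ ht)) //.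
  by rewrite ler_piMl ?absC_ge0.
set v := w b - w a.
have [v0|v0] := eqVneq v 0.
  have := key 0; rewrite absC0 mul0r /v => /(_ ler01).
  by rewrite -/v v0 absC0.
have a0 : absC v != 0 by rewrite absC_eq0.
have := key (v^*%R / (absC v)%:C); rewrite -/v.
rewrite absCM absCV absC_re absC_conj ger0_norm ?absC_ge0 // divff // lexx => /(_ isT).
by rewrite ReC_phase.
Qed.

Lemma mean_value_cst w w' (B : R) a b : a <= b ->
  (forall t, a <= t <= b -> derR w t (w' t)) ->
  (forall t, a <= t <= b -> absC (w' t) <= B) ->
  absC (w b - w a) <= B * (b - a).
Proof.
move=> ab hw hB; rewrite mulrBr.
apply: (@mean_value w w' (fun t => B * t) (fun=> B)) => // t _.
by apply: is_derive_eq; rewrite /GRing.scale /=; ring.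
Qed.

(** Letting [b] tend to infinity in the Cauchy estimate bounds the distance from [w a] to the limit;
    this rate, and not mere convergence, is the source of the decay estimates below. *)
Lemma cauchy_at_pinfty w (B : R -> R) a0 :
  (forall a b, a0 <= a -> a <= b -> absC (w b - w a) <= B a) ->
  B t @[t --> +oo] --> (0 : R) ->
  exists l, clim +oo w l /\ (forall a, a0 <= a -> absC (l - w a) <= B a).
Proof.
move=> hw hB.
have aux (pr : R[i] -> R) : (forall x y, `|pr x - pr y| <= absC (x - y)) ->
    cvg (pr (w t) @[t --> +oo]).
  move=> hpr; apply/cauchy_cvgP/cauchy_exP => e e0.
  have : \forall t \near +oo, `|0 - B t| < e by move/cvgrPdist_lt: hB; apply.
  move=> hn; near +oo_R => t; exists (pr (w t)).
  have ht : `|0 - B t| < e by near: t.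
  have ta : a0 <= t by near: t; apply: nbhs_pinfty_ge; rewrite num_real.
  rewrite /nbhs /=; near=> s; rewrite /ball /= (le_lt_trans (hpr _ _)) //.
  have ts : t <= s by near: s; apply: nbhs_pinfty_ge; rewrite num_real.
  rewrite absCBC (le_lt_trans (hw _ _ ta ts)) //.
  by rewrite (le_lt_trans (ler_norm _)) // -normrN -[- _]add0r.
pose l := lim (ReC (w t) @[t --> +oo]) +i* lim (ImC (w t) @[t --> +oo]).
have hl : clim +oo w l.
  apply/climRI; split; apply: aux => x y.
    by rewrite -ReCN -ReCD ReC_le.
  by rewrite -ImCN -ImCD ImC_le.
exists l; split=> // a ha.
have /clim_abs h : clim +oo (fun t => w t - w a) (l - w a).
  by apply: climD => //; exact: clim_cst.
apply: (cvgr_to_le h).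
near=> t; apply: hw => //.
Unshelve. all: by end_near. Qed.

Lemma real_FTC (f F : R -> R) a b : a <= b ->
  (forall t, a <= t <= b -> is_derive t 1 F (f t)) ->
  (forall t, a <= t <= b -> {for t, continuous f}) ->
  Rintegral mu `[a, b] f = F b - F a.
Proof.
rewrite le_eqVlt => /orP[/eqP <- _ _|ab hd hc].
  by rewrite set_itv1 Rintegral_set1 subrr.
rewrite /Rintegral (@continuous_FTC2 _ f F) //.
- exact: within_ct.
- split.
  + move=> t; rewrite in_itv /= => /andP[h1 h2].
    by have [] : is_derive t 1 F (f t) by apply: hd; rewrite !ltW.
  + apply: cvg_at_right_filter; apply: (@is_derive_continuous F a (f a)).
    by apply: hd; rewrite lexx ltW.
  + apply: cvg_at_left_filter; apply: (@is_derive_continuous F b (f b)).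
    by apply: hd; rewrite lexx ltW.
- move=> t; rewrite in_itv /= => /andP[h1 h2]; rewrite derive1E.
  by have [] : is_derive t 1 F (f t) by apply: hd; rewrite !ltW.
Qed.

Lemma integralC_FTC w w' a b : a <= b ->
  (forall t, a <= t <= b -> derR w t (w' t)) ->
  (forall t, a <= t <= b -> ctR w' t) ->
  integralC `[a, b] w' = w b - w a.
Proof.
move=> ab hd hc; apply: (@complex_eq R); rewrite /= ?CE.
  apply: (@real_FTC _ (ReC \o w)) => // t ht; first by have /derRP [] := hd _ ht.
  by have /ctR_RI [] := hc _ ht.
apply: (@real_FTC _ (ImC \o w)) => // t ht; first by have /derRP [] := hd _ ht.
by have /ctR_RI [] := hc _ ht.
Qed.

Lemma real_under_integral (k k1 : R -> R -> R) (u0 d K : R) : 0 < d ->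
  (forall (u s : R), `|u - u0| <= d -> 0 <= s <= 1 -> is_derive u 1 (k^~ s) (k1 u s)) ->
  (forall (u s : R), `|u - u0| <= d -> 0 <= s <= 1 -> {for s, continuous (k u)}) ->
  (forall (u s : R), `|u - u0| <= d -> 0 <= s <= 1 -> `|k1 u s| <= K) ->
  is_derive u0 1 (fun u => Rintegral mu `[0, 1] (k u)) (Rintegral mu `[0, 1] (k1 u0)).
Proof.
move=> d0 hd hc hK.
have inI u : u \in `]u0 - d, u0 + d[ -> `|u - u0| <= d.
  by rewrite in_itv /= => /andP[h1 h2]; rewrite ler_norml; lra.
have u0I : u0 \in `]u0 - d, u0 + d[ by rewrite in_itv /=; lra.
have inB s : s \in `[(0:R), 1] -> 0 <= s <= 1 by rewrite in_itv.
have K0 : 0 <= K.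
  by apply: le_trans (normr_ge0 _) (hK u0 0 _ _); rewrite ?subrr ?normr0 ?lexx ?ler01 ?ltW.
have I1 u : u \in `]u0 - d, u0 + d[ -> mu.-integrable `[(0:R), 1] (EFin \o k u).
  move=> /inI hu; apply: continuous_compact_integrable; first exact: segment_compact.
  by apply: within_ct => s; exact: hc.
have I2 u s : u \in `]u0 - d, u0 + d[ -> s \in `[(0:R), 1] -> derivable (k^~ s) u 1.
  by move=> /inI hu /inB hs; have [] := hd _ _ hu hs.
have I3 u s : u \in `]u0 - d, u0 + d[ -> s \in `[(0:R), 1] -> partial1of2 k u s = k1 u s.
  by move=> /inI hu /inB hs; rewrite partial1of2E; have [] := hd _ _ hu hs.
have IK : mu.-integrable `[(0:R), 1] (EFin \o (fun=> K)).
  apply: continuous_compact_integrable; first exact: segment_compact.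
  by apply: within_ct => s _; exact: cvg_cst.
have I4 u s : u \in `]u0 - d, u0 + d[ -> s \in `[(0:R), 1] -> `|partial1of2 k u s| <= K.
  by move=> hu hs; rewrite I3 //; apply: hK; [exact: inI|exact: inB].
have mB : measurable (`[(0:R), 1]%classic : set R) by exact: measurable_itv.
have e : Rintegral mu `[0, 1] (k1 u0) = Rintegral mu `[0, 1] (partial1of2 k u0).
  by apply: eq_Rintegral => s; rewrite inE => hs; rewrite -(I3 _ _ u0I hs).
split.
  by apply: (@derivable_under_integral R _ _ mu k _ mB u0 (u0 - d) (u0 + d) _ _ _ (fun=> K)).
rewrite e -derive1E.
by apply: (@differentiation_under_integral R _ _ mu k _ mB u0 (u0 - d) (u0 + d) _ _ _ (fun=> K)).
Qed.

Lemma under_integralC (k k1 : R -> R -> R[i]) (u0 d K : R) : 0 < d ->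
  (forall (u s : R), `|u - u0| <= d -> 0 <= s <= 1 -> derR (k^~ s) u (k1 u s)) ->
  (forall (u s : R), `|u - u0| <= d -> 0 <= s <= 1 -> ctR (k u) s) ->
  (forall (u s : R), `|u - u0| <= d -> 0 <= s <= 1 -> absC (k1 u s) <= K) ->
  derR (fun u => integralC `[0, 1] (k u)) u0 (integralC `[0, 1] (k1 u0)).
Proof.
move=> d0 hd hc hK; apply/derRP; split.
  apply: (@real_under_integral (fun u s => ReC (k u s)) (fun u s => ReC (k1 u s)) u0 d K) => //.
  - by move=> u s hu hs; have /derRP [] := hd _ _ hu hs.
  - by move=> u s hu hs; have /ctR_RI [] := hc _ _ hu hs.
  - by move=> u s hu hs; rewrite (le_trans (ReC_le _)) ?hK.
apply: (@real_under_integral (fun u s => ImC (k u s)) (fun u s => ImC (k1 u s)) u0 d K) => //.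
- by move=> u s hu hs; have /derRP [] := hd _ _ hu hs.
- by move=> u s hu hs; have /ctR_RI [] := hc _ _ hu hs.
- by move=> u s hu hs; rewrite (le_trans (ImC_le _)) ?hK.
Qed.

Lemma compact_rectangle (g : R * R -> R[i]) (a b c d : R) :
  (forall x y, a <= x <= b -> c <= y <= d -> ctn g (x, y)) ->
  exists K, forall x y, a <= x <= b -> c <= y <= d -> absC (g (x, y)) <= K.
Proof.
move=> hg; pose A := `[a, b]%classic `*` `[c, d]%classic.
have cA : compact A by apply: compact_setX; exact: segment_compact.
have [A0|/set0P A0] := eqVneq A set0.
  exists 0 => x y hx hy; have : A (x, y) by split; rewrite /= in_itv.
  by rewrite A0.
have [] := @compact_EVT_max _ R (@absC R \o g) A A0 cA.
  apply: continuous_in_subspaceT => -[x y]; rewrite inE => -[/=].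
  rewrite !in_itv /= => hx hy; exact: (clim_abs (hg _ _ hx hy)).
move=> p _ hp; exists (absC (g p)) => x y hx hy; apply: hp.
by rewrite inE; split; rewrite /= in_itv.
Qed.

End Integration.

(** * Primitives by integration along segments *)

Section Primitives.
Variable R : realType.
Implicit Types (D : set R[i]) (g F : R[i] -> R[i]).

Definition fstC (p : R * R) : R[i] := p.1%:C.
Definition sndC (p : R * R) : R[i] := p.2%:C.

Lemma fstC_ctn p : ctn fstC p.
Proof. by apply/climRI; split; [exact: cvg_fst|exact: cvg_cst]. Qed.

Lemma sndC_ctn p : ctn sndC p.
Proof. by apply/climRI; split; [exact: cvg_snd|exact: cvg_cst]. Qed.

Lemma ctn_pairr (g : R * R -> R[i]) (u s : R) : ctn g (u, s) -> ctR (fun t => g (u, t)) s.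
Proof.
rewrite /ctR /ctn !climE => h A hA.
have c : (fun t : R => (u, t)) t @[t --> s] --> (u, s).
  by apply: (@cvg_pair _ _ _ (nbhs s) (nbhs u) (nbhs s) _ _ _ (fun=> u) id); [exact: cvg_cst|exact: cvg_id].
exact: (c _ (h _ hA)).
Qed.

(** The [u]-derivative of the integrand is itself an [s]-derivative, that of [Q], so that
    differentiating under the integral leaves only boundary terms. This exactness plays the part of
    Cauchy's theorem in the construction of primitives. *)
Lemma der_integralC (k k1 : R * R -> R[i]) (Q : R -> R[i]) (u0 d : R) : 0 < d ->
  (forall u s : R, `|u - u0| <= d -> 0 <= s <= 1 -> derR (fun v => k (v, s)) u (k1 (u, s))) ->
  (forall u s : R, `|u - u0| <= d -> 0 <= s <= 1 -> ctn k (u, s)) ->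
  (forall u s : R, `|u - u0| <= d -> 0 <= s <= 1 -> ctn k1 (u, s)) ->
  (forall s : R, 0 <= s <= 1 -> derR Q s (k1 (u0, s))) ->
  derR (fun u => integralC `[0, 1] (fun s => k (u, s))) u0 (Q 1 - Q 0).
Proof.
move=> d0 hd hk hk1 hQ.
have [K hK] : exists K, forall u s, u0 - d <= u <= u0 + d -> 0 <= s <= 1 -> absC (k1 (u, s)) <= K.
  by apply: compact_rectangle => u s hu hs; apply: hk1 => //; rewrite ler_norml; lra.
have -> : Q 1 - Q 0 = integralC `[0, 1] (fun s => k1 (u0, s)).
  rewrite (@integralC_FTC _ Q) // => s hs; apply: ctn_pairr; apply: hk1 => //.
  by rewrite subrr normr0 ltW.
apply: (@under_integralC _ (fun u s => k (u, s)) (fun u s => k1 (u, s)) u0 d K) => //.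
  by move=> u s hu hs; apply: ctn_pairr; exact: hk.
by move=> u s; rewrite ler_norml => hu hs; apply: hK => //; lra.
Qed.

Lemma nearC (s : R[i]) (A : set R[i]) : (\forall x \near (s : R[i]^o), A x) ->
  exists2 r : R, 0 < r & forall x, absC (x - s) < r -> A x.
Proof.
move=> /nbhs_normP [d /= d0 hd].
have dr : d = (ReC d)%:C by apply: complex_eq; rewrite ?CE //; exact: ger0_Im (ltW d0).
exists (ReC d); first by rewrite -ltcR -dr.
by move=> x hx; apply: hd; rewrite /= normE dr ltcR absCBC.
Qed.

Lemma near_ray (e s : R[i]) (r : R) : 0 < r -> absC e = 1 -> \forall t \near 0^'+, absC (s + e * t%:C - s) < r.
Proof.
move=> r0 e1; near=> t; have t0 : 0 < t by near: t; exact: nbhs_right_gt.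
by rewrite addrAC subrr add0r absCM e1 mul1r absC_re gtr0_norm //; near: t; exact: nbhs_right_lt.
Unshelve. all: by end_near. Qed.

Lemma clim_ray (e : R[i]) F s : absC e = 1 -> ctC F s -> clim 0^'+ (fun t : R => F (s + e * t%:C)) (F s).
Proof.
move=> e1 /climP h; apply/climP => d /h /nearC [r r0 hr].
by apply: filterS (near_ray s r0 e1) => t; exact: hr.
Qed.

Lemma near_neq (a s : R[i]) : s != a -> \forall x \near (s : R[i]^o), x != a.
Proof.
move=> h; have h0 : 0 < absC (s - a) by rewrite absC_gt0 subr_eq0.
have /climP /(_ _ h0) := @inC_ctn R s; apply: filterS => x; rewrite /inC.
by apply: contraTneq => ->; rewrite absCBC ltxx.
Qed.

Lemma derC_bound F (s d : R[i]) :
  (forall e : R, 0 < e -> exists2 r : R, 0 < r & forall s', absC (s' - s) < r ->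
     absC (F s' - F s - d * (s' - s)) <= e * absC (s' - s)) ->
  derC F s d.
Proof.
move=> h; exists (fun x => if x == s then d else (F x - F s) / (x - s)); split.
- move=> x; have [->|ne] := eqVneq x s; first by rewrite subrr mulr0 addr0.
  by rewrite /inC mulfVK ?subr_eq0 // addrC subrK.
- by rewrite eqxx.
- rewrite /ctn eqxx; apply/climP => e e0.
  have e2 : 0 < e / 2 by rewrite divr_gt0.
  have [r r0 hr] := h _ e2.
  have /climP /(_ _ r0) := @inC_ctn R s.
  apply: filterS => x; rewrite /inC => hx.
  have [_|ne] := eqVneq x s; first by rewrite subrr absC0.
  have xs0 : x - s != 0 by rewrite subr_eq0.
  have -> : (F x - F s) / (x - s) - d = (F x - F s - d * (x - s)) / (x - s) by field.
  rewrite absCM absCV ltr_pdivrMr ?absC_gt0 // (le_lt_trans (hr _ hx)) //.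
  by rewrite ltr_pM2r ?absC_gt0 //; lra.
Qed.

Lemma mean_value_unordered (w w' : R -> R[i]) (B a b : R) :
  (forall t, Num.min a b <= t <= Num.max a b -> derR w t (w' t)) ->
  (forall t, Num.min a b <= t <= Num.max a b -> absC (w' t) <= B) ->
  absC (w b - w a) <= B * `|b - a|.
Proof.
have [ab|ba] := lerP a b => hd hB.
  exact: mean_value_cst hd hB.
rewrite absCBC; by apply: mean_value_cst hd hB; exact: ltW.
Qed.

Definition pnt (x y : R) : R[i] := x%:C + 'i * y%:C.

Lemma ReC_pnt x y : ReC (pnt x y) = x. Proof. by rewrite /pnt !CE; ring. Qed.
Lemma ImC_pnt x y : ImC (pnt x y) = y. Proof. by rewrite /pnt !CE; ring. Qed.
Lemma pntK z : pnt (ReC z) (ImC z) = z. Proof. by rewrite /pnt -complexRI. Qed.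
Lemma pntE x y : x +i* y = pnt x y.
Proof. by apply: complex_eq; rewrite ?ReC_pnt ?ImC_pnt. Qed.

Lemma pntB x y x' y' : pnt x y - pnt x' y' = pnt (x - x') (y - y').
Proof. by apply: complex_eq; rewrite /pnt !CE; ring. Qed.

Lemma derR_hor y x : derR (fun x => pnt x y) x 1.
Proof.
have h := derD (der_id (@inR R) x) (der_cst (@inR R) ('i * y%:C) x).
by apply: der_eq h; rewrite addr0.
Qed.

Lemma derR_ver x y : derR (fun y => pnt x y) y 'i.
Proof.
have h := derD (der_cst (@inR R) x%:C y) (derZ 'i (der_id (@inR R) y)).
by apply: der_eq h; rewrite add0r mulr1.
Qed.

Lemma der_comp1 F (w : R -> R[i]) t d e :
  derC F (w t) d -> derR w t e -> derR (fun t => F (w t)) t (d * e).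
Proof. exact: (der_comp (@inR_ctn R)). Qed.

(** The increment of [F] is taken along an L-shaped path, first on the line of height [y0] and then
    vertically; this is why the horizontal derivative is asked for on that line only. *)
Lemma derC_of_partials F g (x0 y0 r0 : R) : 0 < r0 ->
  (forall x, `|x - x0| <= r0 -> derR (fun x => F (pnt x y0)) x (g (pnt x y0))) ->
  (forall x y, `|x - x0| <= r0 -> `|y - y0| <= r0 ->
     derR (fun y => F (pnt x y)) y ('i * g (pnt x y))) ->
  ctC g (pnt x0 y0) -> derC F (pnt x0 y0) (g (pnt x0 y0)).
Proof.
move=> r00 hx hy hc; set s := pnt x0 y0; apply: derC_bound => e e0.
have e4 : 0 < e / 2 by rewrite divr_gt0.
move/climP: hc => /(_ _ e4) /nearC [d d0 hd].
have hg x y : `|x - x0| < d / 2 -> `|y - y0| < d / 2 ->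
    absC (g (pnt x y) - g s) < e / 2.
  move=> h1 h2; apply: hd; rewrite
  (le_lt_trans (absC_le_RI _)) // pntB ReC_pnt ImC_pnt; lra.
exists (Num.min r0 (d / 2)); first by rewrite lt_min r00 divr_gt0.
move=> s'; rewrite lt_min -(pntK s'); set x := ReC s'; set y := ImC s'.
move=> /andP[h1 h2].
have hX : `|x - x0| <= absC (pnt x y - s).
  by have := ReC_le (pnt x y - s); rewrite pntB ReC_pnt.
have hY : `|y - y0| <= absC (pnt x y - s).
  by have := ImC_le (pnt x y - s); rewrite pntB ImC_pnt.
have btw (a b t : R) : Num.min a b <= t <= Num.max a b -> `|t - a| <= `|b - a|.
  case: (lerP a b) => hab /andP[ha hb].
    by rewrite ger0_norm ?subr_ge0 //; lra.
  by rewrite ler0_norm ?subr_le0 //; lra.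
have k1 : absC ((F (pnt x y) - ('i * g s) * y%:C) - (F (pnt x y0) - ('i * g s) * y0%:C)) <= e / 2 * `|y - y0|.
  apply: (@mean_value_unordered (fun t => F (pnt x t) - ('i * g s) * t%:C)
     (fun t => 'i * g (pnt x t) - ('i * g s) * 1)) => t /btw ht.
    apply: derB; first by apply: hy; rewrite ?(le_trans hX) ?(le_trans ht) ?(le_trans hY) ?ltW.
    by apply: derZ; exact: der_id.
  rewrite mulr1 -mulrBr absCM absCi mul1r ltW // hg //; first exact: le_lt_trans hX h2.
  by rewrite (le_lt_trans ht) // (le_lt_trans hY).
have k2 : absC ((F (pnt x y0) - g s * x%:C) - (F (pnt x0 y0) - g s * x0%:C)) <= e / 2 * `|x - x0|.
  apply: (@mean_value_unordered (fun t => F (pnt t y0) - g s * t%:C)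
     (fun t => g (pnt t y0) - g s * 1)) => t /btw ht.
    apply: derB; first by apply: hx; rewrite (le_trans ht) // (le_trans hX) // ltW.
    by apply: derZ; exact: der_id.
  rewrite mulr1 ltW // hg //; first by rewrite (le_lt_trans ht) // (le_lt_trans hX).
  by rewrite subrr normr0 divr_gt0.
have -> : F (pnt x y) - F s - g s * (pnt x y - s) =
   ((F (pnt x y) - ('i * g s) * y%:C) - (F (pnt x y0) - ('i * g s) * y0%:C)) +
   ((F (pnt x y0) - g s * x%:C) - (F (pnt x0 y0) - g s * x0%:C)).
  have -> : pnt x y - s = (x%:C - x0%:C) + 'i * (y%:C - y0%:C) by rewrite /s /pnt; ring.
  ring.
rewrite (le_trans (absCD _ _)) // (le_trans (lerD k1 k2)) //.
have := ler_wpM2l (ltW e4) hX; have := ler_wpM2l (ltW e4) hY; lra.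
Qed.

(** A neighbourhood, of width uniform along the way, of the vertical segment from a point of [D] to
    the level [b] stays in [D]: openness and vertical star-shapedness in the form needed to
    differentiate an integral over that segment. *)
Definition tall D (b : R) := forall x0 y0, D (pnt x0 y0) -> exists2 d : R, 0 < d &
  forall x y, `|x - x0| <= d -> Num.min b y0 - d <= y -> y <= Num.max b y0 + d -> D (pnt x y).

Section Tall.
Variables (D : set R[i]) (b : R) (g g1 : R[i] -> R[i]).
Hypotheses (Dtall : tall D b) (Dline : forall x, D (pnt x b)).
Hypotheses (dg : forall s, D s -> derC g s (g1 s)) (cg1 : forall s, D s -> ctC g1 s).

Let cg s : D s -> ctC g s. Proof. by move=> /dg; exact: derC_ctC. Qed.

(** The segment from [a0 + u a1] with direction [v u] moves affinely with [u]; its point of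
    parameter [s] has velocity [A = a1 + s b1]. Since [d/du (v g) = b1 g + v A g1 = d/ds (A g)],
    only the velocities of the two end points contribute. *)
Lemma der_path_integral (a0 a1 b0 b1 : R[i]) (v : R -> R[i]) (ga : R -> R -> R[i]) (u0 d : R) :
  0 < d -> (forall u, v u = b0 + u%:C * b1) ->
  (forall u s, ga u s = a0 + u%:C * a1 + s%:C * v u) ->
  (forall u s, `|u - u0| <= d -> 0 <= s <= 1 -> D (ga u s)) ->
  derR (fun u => integralC `[0, 1] (fun s => v u * g (ga u s))) u0
    ((a1 + b1) * g (ga u0 1) - a1 * g (ga u0 0)).
Proof.
move=> d0 vE gaE gaD.
pose B p := b0 + fstC p * b1; pose A p := a1 + sndC p * b1; pose gp p := a0 + fstC p * a1 + sndC p * B p.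
have gpE u s : gp (u, s) = ga u s by rewrite gaE vE.
have cB p : ctn B p by apply: ctnD (ctn_cst _ _) (ctnM (fstC_ctn p) (ctn_cst _ _)).
have cA p : ctn A p by apply: ctnD (ctn_cst _ _) (ctnM (sndC_ctn p) (ctn_cst _ _)).
have cp p : ctn gp p.
  by apply: ctnD (ctnD (ctn_cst _ _) (ctnM (fstC_ctn p) (ctn_cst _ _))) (ctnM (sndC_ctn p) (cB p)).
have cgp (k : R[i] -> R[i]) : (forall s, D s -> ctC k s) ->
    forall u s : R, `|u - u0| <= d -> 0 <= s <= 1 -> ctn (fun p => k (gp p)) (u, s).
  move=> ck u s hu hs; apply: (@ctn_comp R _ k gp (u, s)); last exact: cp.
  by apply: ck; rewrite gpE; exact: gaD.
have dB (u : R) : derR (fun u => B (u, 0)) u b1.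
  have h := derD (der_cst (@inR R) b0 u) (derM (@inR_ctn R) (der_id (@inR R) u) (der_cst (@inR R) b1 u)).
  by apply: der_eq h; ring.
have dA (s : R) : derR (fun s => A (0, s)) s b1.
  have h := derD (der_cst (@inR R) a1 s) (derM (@inR_ctn R) (der_id (@inR R) s) (der_cst (@inR R) b1 s)).
  by apply: der_eq h; ring.
have dgu (u s : R) : derR (fun u => gp (u, s)) u (A (u, s)).
  have h := derD (derD (der_cst (@inR R) a0 u) (derM (@inR_ctn R) (der_id (@inR R) u) (der_cst (@inR R) a1 u)))
    (derZ s%:C (dB u)).
  by apply: der_eq h; rewrite /A /sndC /inR /=; ring.
have dgs (u s : R) : derR (fun s => gp (u, s)) s (B (u, s)).
  have h := derD (der_cst (@inR R) (a0 + u%:C * a1) s)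
    (derM (@inR_ctn R) (der_id (@inR R) s) (der_cst (@inR R) (b0 + u%:C * b1) s)).
  by apply: der_eq h; rewrite /B /fstC /inR /=; ring.
have D0 s : 0 <= s <= 1 -> D (ga u0 s) by apply: gaD; rewrite subrr normr0 ltW.
have := @der_integralC (fun p => B p * g (gp p)) (fun p => b1 * g (gp p) + B p * (g1 (gp p) * A p))
  (fun s => A (0, s) * g (gp (u0, s))) u0 d d0.
rewrite !gpE /A /sndC /= mul1r mul0r addr0 -/sndC -/A.
rewrite (_ : (fun u => integralC _ _) = fun u => integralC `[0, 1] (fun s => v u * g (ga u s))).
  apply.
  - move=> u s hu hs; have hD := gaD u s hu hs; rewrite -gpE in hD.
    exact: (derM (@inR_ctn R) (dB u) (der_comp1 (dg hD) (dgu u s))).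
  - by move=> u s hu hs; apply: ctnM; [exact: cB|exact: (cgp _ cg u s hu hs)].
  - move=> u s hu hs; apply: ctnD; apply: ctnM; try exact: ctn_cst; try exact: cB; first exact: (cgp _ cg u s hu hs).
    by apply: ctnM; [exact: (cgp _ cg1 u s hu hs)|exact: cA].
  - move=> s hs; have hD := D0 s hs; rewrite -gpE in hD.
    have h := derM (@inR_ctn R) (dA s) (der_comp1 (dg hD) (dgs u0 s)).
    by apply: der_eq h; rewrite /A /sndC /=; ring.
by apply/funext => u; congr integralC; apply/funext => s; rewrite gpE vE.
Qed.

Let path_in x y (d : R) x' y' s : 0 < d -> `|x' - x| <= d -> `|y' - y| <= d -> 0 <= s <= 1 ->
  (forall x' y', `|x' - x| <= d -> Num.min b y - d <= y' -> y' <= Num.max b y + d -> D (pnt x' y')) ->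
  D (pnt x' (b + s * (y' - b))).
Proof.
move=> d0 hx hy /andP[s0 s1] h; apply: h => //.
  move: hy; rewrite ler_norml => /andP[h1 h2].
  rewrite lerBlDr; case: (lerP b y) => hb; last first.
    have : b + s * (y' - b) >= b + s * (y - d - b) by rewrite lerD2l ler_wpM2l //; lra.
    nra.
  nra.
move: hy; rewrite ler_norml => /andP[h1 h2].
by case: (lerP b y) => hb; nra.
Qed.

Let V x y := integralC `[0, 1] (fun s => 'i * (y - b)%:C * g (pnt x (b + s * (y - b)))).

Lemma V_hor x y : D (pnt x y) ->
  derR (fun x => V x y) x (g (pnt x y) - g (pnt x b)).
Proof.
move=> hD; have [d d0 hd] := Dtall hD.
have := @der_path_integral ('i * b%:C) 1 ('i * (y - b)%:C) 0 (fun=> 'i * (y - b)%:C)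
  (fun u s => pnt u (b + s * (y - b))) x d d0.
rewrite addr0 !mul1r mul0r addr0 [b + _]addrC subrK; apply=> [u|u s|u s hu hs].
- by rewrite mulr0 addr0.
- by rewrite /pnt rmorphD rmorphM /=; ring.
by apply: (path_in d0 hu _ hs hd); rewrite subrr normr0 ltW.
Qed.

Lemma V_ver x y : D (pnt x y) -> derR (fun y => V x y) y ('i * g (pnt x y)).
Proof.
move=> hD; have [d d0 hd] := Dtall hD.
have := @der_path_integral (pnt x b) 0 (- 'i * b%:C) 'i%R (fun u => 'i * (u - b)%:C)
  (fun u s => pnt x (b + s * (u - b))) y d d0.
rewrite add0r mul0r subr0 mul1r [b + _]addrC subrK; apply=> [u|u s|u s hu hs].
- by rewrite rmorphB; ring.
- by rewrite /pnt rmorphD rmorphM /=; ring.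
by apply: (path_in d0 _ hu hs hd); rewrite subrr normr0 ltW.
Qed.

Let W x := integralC `[0, 1] (fun s => x%:C * g (pnt (s * x) b)).

Lemma W_der x : derR W x (g (pnt x b)).
Proof.
have := @der_path_integral ('i * b%:C) 0 0 1 (fun u => u%:C) (fun u s => pnt (s * u) b) x 1 ltr01.
rewrite add0r mul0r subr0 !mul1r; apply=> [u|u s|u s _ _].
- by rewrite add0r mulr1.
- by rewrite /pnt rmorphM /=; ring.
exact: Dline.
Qed.

(** The integration follows the line of height [b] from abscissa 0 ([W]) and then the vertical
    ([V]). In the horizontal derivative the value at the corner, [g (pnt x b)], cancels between the
    two pieces. *)
Lemma primitive_exists : exists F, forall s, D s -> derC F s (g s).
Proof.
exists (fun s => W (ReC s) + V (ReC s) (ImC s)) => s; rewrite -(pntK s).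
set x0 := ReC s; set y0 := ImC s => hD; have [d d0 hd] := Dtall hD.
have hDD x y : `|x - x0| <= d -> `|y - y0| <= d -> D (pnt x y).
  move=> h1; rewrite ler_norml => h2; apply: hd => //.
    by case: (lerP b y0) => ?; lra.
  by case: (lerP b y0) => ?; lra.
apply: (@derC_of_partials _ g x0 y0 d) => //.
- move=> x hx; have hx0 : D (pnt x y0) by apply: hDD; rewrite // subrr normr0 ltW.
  have h := derD (W_der x) (V_hor hx0).
  apply: (der_fun (F := fun x => W x + V x y0)); first by move=> u; rewrite ReC_pnt ImC_pnt.
  by apply: der_eq h; ring.
- move=> x y hx hy; have hD' := hDD _ _ hx hy.
  have h := derD (der_cst (@inR R) (W x) y) (V_ver hD').
  apply: (der_fun (F := fun y => W x + V x y)); first by move=> u; rewrite ReC_pnt ImC_pnt.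
  by apply: der_eq h; ring.
- exact: cg.
Qed.

End Tall.

Lemma derR_deriveC (gam : R -> R[i]) t : derivableC gam t -> derR gam t (deriveC gam t).
Proof.
by case=> h1 h2; apply/derRP; split; [exact: (DeriveDef h1 (esym (derive1E _ _)))|exact: (DeriveDef h2 (esym (derive1E _ _)))].
Qed.

(** The limits in [contour_integral] are meaningful only when they exist. Their existence is deduced
    from the limits of the primitive at the two ends, so no integrability along the contour has to
    be checked. *)
Lemma contour_integralE D gam g F (l0 l1 : R[i]) : contour_in D gam ->
  (forall s, D s -> derC F s (g s)) -> (forall s, D s -> ctC g s) ->
  clim -oo (fun t => F (gam t)) l0 -> clim +oo (fun t => F (gam t)) l1 ->
  contour_integral gam g = l1 - l0.
Proof.
move=> [hD hd c1 c2] hF hg h0 h1; rewrite /contour_integral.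
pose k t := g (gam t) * deriveC gam t; rewrite -/k.
have hD' t : D (gam t) by have := hD t; rewrite inE.
have dk t : derR (fun t => F (gam t)) t (k t).
  exact: (der_comp1 (hF _ (hD' t)) (derR_deriveC (hd t))).
have ck t : ctR k t.
  apply: ctnM.
    apply: (@ctn_comp R _ g gam); first exact: hg.
    exact: derR_ctR (derR_deriveC (hd t)).
  by apply/ctR_RI; split; [exact: c1|exact: c2].
have e0 : clim -oo (fun a => integralC `[a, 0] k) (F (gam 0) - l0).
  apply: (clim_near (F := fun a => F (gam 0) - F (gam a))).
    near=> a; rewrite (@integralC_FTC _ (fun t => F (gam t))) //.
  by apply: climD; [exact: clim_cst|exact: climN].
have e1 : clim +oo (fun b => integralC `[0, b] k) (l1 - F (gam 0)).
  apply: (clim_near (F := fun b => F (gam b) - F (gam 0))).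
    near=> a; rewrite (@integralC_FTC _ (fun t => F (gam t))) //.
  by apply: climD => //; exact: clim_cst.
have -> : lim ((integralC `[a, 0] k : R[i]^o) @[a --> -oo]) = F (gam 0) - l0.
  by move: e0; rewrite climE => e0; apply: cvg_lim => //; exact: norm_hausdorff.
have -> : lim ((integralC `[0, b] k : R[i]^o) @[b --> +oo]) = l1 - F (gam 0).
  by move: e1; rewrite climE => e1; apply: cvg_lim => //; exact: norm_hausdorff.
by ring.
Unshelve. all: by end_near. Qed.

End Primitives.

(** * Exponential and logarithm *)

Section ExpLog.
Variable R : realType.
Implicit Types (z w : R[i]).

Lemma expCD z w : expC (z + w) = expC z * expC w.
Proof.
apply: complex_eq; rewrite /expC !CE /= expRD cosD sinD; ring.
Qed.

Lemma expC0 : expC (0 : R[i]) = 1.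
Proof. by apply: complex_eq; rewrite /expC !CE /= expR0 cos0 sin0; ring. Qed.

Lemma absC_expC z : absC (expC z) = expR (ReC z).
Proof.
rewrite /expC absCM absC_re ger0_norm ?expR_ge0 //.
by rewrite /absC /= cos2Dsin2 sqrtr1 mulr1.
Qed.

Lemma expC_neq0 z : expC z != 0.
Proof. by rewrite -absC_gt0 absC_expC expR_gt0. Qed.

Lemma expCN z : expC (- z) = (expC z)^-1.
Proof.
apply: (mulfI (expC_neq0 z)); rewrite -expCD subrr expC0 mulfV //; exact: expC_neq0.
Qed.

Lemma rcvg_comp (T : Type) (Fi : set_system T) (f : T -> R) (g : R -> R) (l : R) :
  f x @[x --> Fi] --> l -> {for l, continuous g} -> g (f x) @[x --> Fi] --> g l.
Proof. by move=> h hg A hA; exact: (h _ (hg _ hA)). Qed.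

Lemma rcvg_near (T : Type) (Fi : set_system T) {FF : Filter Fi} (f g : T -> R) (l : R) :
  (\forall x \near Fi, f x = g x) -> f x @[x --> Fi] --> l -> g x @[x --> Fi] --> l.
Proof. by move=> h; apply: cvg_trans; apply: near_eq_cvg. Qed.

Lemma cvg_ReC w : ReC x @[x --> (w : R[i]^o)] --> ReC w.
Proof. by have /climRI [] := @inC_ctn R w. Qed.

Lemma cvg_ImC w : ImC x @[x --> (w : R[i]^o)] --> ImC w.
Proof. by have /climRI [] := @inC_ctn R w. Qed.

Lemma cvg_absC w : absC x @[x --> (w : R[i]^o)] --> absC w.
Proof. exact: clim_abs (@inC_ctn R w). Qed.

Lemma cos_norm (x : R) : cos `|x| = cos x.
Proof. by case: (ger0P x) => h; rewrite ?cosN. Qed.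

Lemma ctC_ReC (f : R -> R) z : {for ReC z, continuous f} -> ctC (fun s => (f (ReC s))%:C) z.
Proof.
move=> hf.
apply/climRI; split; last exact: cvg_cst.
exact: (rcvg_comp (@cvg_ReC _) hf).
Qed.

Lemma ctC_ImC (f : R -> R) z : {for ImC z, continuous f} -> ctC (fun s => (f (ImC s))%:C) z.
Proof.
move=> hf.
apply/climRI; split; last exact: cvg_cst.
exact: (rcvg_comp (@cvg_ImC _) hf).
Qed.

Lemma ctC_expC z : ctC (@expC R) z.
Proof.
have h : ctC (fun s => (expR (ReC s))%:C * ((cos (ImC s))%:C + 'i * (sin (ImC s))%:C)) z.
  apply: ctnM; first by apply: ctC_ReC; exact: continuous_expR.
  apply: ctnD; first by apply: ctC_ImC; exact: continuous_cos.
  by apply: ctnZ; apply: ctC_ImC; exact: continuous_sin.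
congr (ctC _ z): h; apply/funext => s; congr (_ * _).
by apply: complex_eq; rewrite !CE /=; ring.
Qed.

Lemma ReC_expC (x y : R) : ReC (expC (pnt x y)) = expR x * cos y.
Proof. rewrite /expC ReC_pnt ImC_pnt !CE /=; ring. Qed.

Lemma ImC_expC (x y : R) : ImC (expC (pnt x y)) = expR x * sin y.
Proof. rewrite /expC ReC_pnt ImC_pnt !CE /=; ring. Qed.

Lemma derC_expC z : derC (@expC R) z (expC z).
Proof.
rewrite -(pntK z); apply: (@derC_of_partials R _ _ _ _ 1 ltr01).
- move=> x _; apply/derRP; rewrite ReC_expC ImC_expC; split.
    rewrite (_ : _ \o _ = (fun x => expR x * cos (ImC z))); last by apply/funext=> u; exact: ReC_expC.
    by apply: is_derive_eq; rewrite /GRing.scale /=; ring.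
  rewrite (_ : _ \o _ = (fun x => expR x * sin (ImC z))); last by apply/funext=> u; exact: ImC_expC.
  by apply: is_derive_eq; rewrite /GRing.scale /=; ring.
- move=> x y _ _; apply/derRP.
  have -> : ReC ('i * expC (pnt x y)) = expR x * - sin y by rewrite ReCM ReCi ImCi ImC_expC; ring.
  have -> : ImC ('i * expC (pnt x y)) = expR x * cos y by rewrite ImCM ReCi ImCi ReC_expC; ring.
  split.
    rewrite (_ : _ \o _ = (fun y => expR x * cos y)); last by apply/funext=> u; exact: ReC_expC.
    by apply: is_derive_eq; rewrite /GRing.scale /=; ring.
  rewrite (_ : _ \o _ = (fun y => expR x * sin y)); last by apply/funext=> u; exact: ImC_expC.
  by apply: is_derive_eq; rewrite /GRing.scale /=; ring.
- exact: ctC_expC.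
Qed.

Lemma ratio_bounds w : w != 0 -> -1 <= ReC w / absC w <= 1.
Proof.
move=> w0; have h := ReC_le w; have a0 : 0 < absC w by rewrite absC_gt0.
rewrite ler_pdivlMr // ler_pdivrMr // mulN1r mul1r.
by move: h; rewrite ler_norml.
Qed.

Lemma cos_ArgC w : w != 0 -> cos (ArgC w) = ReC w / absC w.
Proof.
move=> w0; rewrite /ArgC; case: ifP => _; rewrite ?cosN acosK // inE /=; exact: ratio_bounds.
Qed.

Lemma sin_ArgC w : w != 0 -> sin (ArgC w) = ImC w / absC w.
Proof.
move=> w0; have a0 : 0 < absC w by rewrite absC_gt0.
have e : Num.sqrt (1 - (ReC w / absC w) ^+ 2) = `|ImC w| / absC w.
  have -> : 1 - (ReC w / absC w) ^+ 2 = (ImC w / absC w) ^+ 2.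
    rewrite !expr_div_n sqr_absC; field.
    by rewrite -sqr_absC expf_neq0 // gt_eqF.
  by rewrite sqrtr_sqr normrM normfV (ger0_norm (ltW a0)).
rewrite /ArgC; case: ifP => h; rewrite ?sinN sin_acos ?ratio_bounds // e.
  by rewrite ger0_norm.
by rewrite ltr0_norm ?mulNr ?opprK // ltNge h.
Qed.

Lemma ArgC_le_pi w : w != 0 -> `|ArgC w| <= pi.
Proof.
move=> w0; rewrite /ArgC; case: ifP => _; rewrite ?normrN.
  by rewrite ger0_norm ?acos_ge0 ?acos_lepi ?ratio_bounds.
by rewrite ger0_norm ?acos_ge0 ?acos_lepi ?ratio_bounds.
Qed.

Lemma expC_LogC w : w != 0 -> expC (LogC w) = w.
Proof.
move=> w0; have a0 : 0 < absC w by rewrite absC_gt0.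
have e : expR (ln (absC w)) = absC w by rewrite lnK // posrE.
apply: complex_eq; rewrite /expC /LogC !CE /= ?cos_ArgC ?sin_ArgC // e; field; by rewrite gt_eqF.
Qed.

Definition slit w : Prop := 0 < ReC w \/ ImC w != 0.

Lemma slit_neq0 w : slit w -> w != 0.
Proof. by case=> h; apply/eqP => w0; move: h; rewrite w0 /= ?ltxx ?eqxx. Qed.

(** On the positive axis the two cases of [ArgC] meet and [acos] is taken at the end point 1 of its
    interval. The formula with [atan] covers the right half-plane at once, which gives continuity
    there. *)
Lemma ArgC_atan w : 0 < ReC w -> ArgC w = atan (ImC w / ReC w).
Proof.
move=> h; have w0 : w != 0 by apply: slit_neq0; left.
have a0 : 0 < absC w by rewrite absC_gt0.
have hp : `|ArgC w| < pi / 2.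
  have := ArgC_le_pi w0.
  have c0 : 0 < cos `|ArgC w| by rewrite cos_norm cos_ArgC // divr_gt0.
  move=> hpi; rewrite ltNge; apply/negP => hge.
  have : cos `|ArgC w| <= cos (pi / 2).
    have i1 : `|ArgC w| \in `[0, pi] by rewrite in_itv /= normr_ge0 hpi.
    have i2 : (pi / 2 : R) \in `[0, pi] by rewrite in_itv /=; have := @pi_gt0 R; lra.
    by rewrite leNgt ltr_cos // -leNgt.
  by rewrite cos_pihalf leNgt c0.
rewrite -[LHS]tanK; last by rewrite in_itv /= -ltr_norml.
congr atan; rewrite /tan cos_ArgC // sin_ArgC //; field.
by rewrite !gt_eqF.
Qed.

Lemma nearC_gt (f : R[i] -> R) w : f x @[x --> (w : R[i]^o)] --> f w -> 0 < f w ->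
  \forall s \near (w : R[i]^o), 0 < f s.
Proof. by move=> h h0; exact: (cvgr_gt _ h _ h0). Qed.

Lemma slit_open w : slit w -> \forall s \near (w : R[i]^o), slit s.
Proof.
case=> h; first by apply: filterS (nearC_gt (@cvg_ReC w) h) => s ?; left.
have [h0|h0|h0] := ltrgtP (ImC w) 0; last by rewrite h0 eqxx in h.
  have h' : 0 < - ImC w by rewrite oppr_gt0.
  apply: filterS (nearC_gt (f := fun s => - ImC s) (cvgN (@cvg_ImC w)) h') => s; rewrite oppr_gt0 => ?.
  by right; rewrite lt_eqF.
by apply: filterS (nearC_gt (@cvg_ImC w) h0) => s ?; right; rewrite gt_eqF.
Qed.

Lemma cvg_ArgC w : slit w -> ArgC s @[s --> (w : R[i]^o)] --> ArgC w.
Proof.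
move=> hw; have w0 := slit_neq0 hw; have a0 : 0 < absC w by rewrite absC_gt0.
have [hr|hr] := boolP (0 < ReC w).
  rewrite ArgC_atan //; apply: (@rcvg_near _ (nbhs (w : R[i]^o)) _ (fun s => atan (ImC s / ReC s))).
    by apply: filterS (nearC_gt (@cvg_ReC w) hr) => s hs; rewrite ArgC_atan.
  apply: (@rcvg_comp _ (nbhs (w : R[i]^o)) (fun s => ImC s / ReC s)).
    apply: cvgM; first exact: cvg_ImC.
    by apply: cvgV; [rewrite gt_eqF|exact: cvg_ReC].
  exact: continuous_atan.
have i0 : ImC w != 0 by case: hw => //; rewrite (negPf hr).
have hac : acos (ReC s / absC s) @[s --> (w : R[i]^o)] --> acos (ReC w / absC w).
  apply: (@rcvg_comp _ (nbhs (w : R[i]^o)) (fun s => ReC s / absC s)).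
    apply: cvgM; first exact: cvg_ReC.
    by apply: cvgV; [rewrite gt_eqF|exact: cvg_absC].
  apply: continuous_acos; rewrite -ltr_norml normrM normfV (ger0_norm (ltW a0)).
  rewrite ltr_pdivrMr // mul1r -ltr_sqr ?nnegrE ?normr_ge0 ?absC_ge0 //.
  by rewrite sqr_absC real_normK ?num_real // ltrDl exprn_even_gt0.
have [h0|h0|h0] := ltrgtP (ImC w) 0; last by rewrite h0 eqxx in i0.
  have -> : ArgC w = - acos (ReC w / absC w) by rewrite /ArgC leNgt h0.
  apply: rcvg_near (cvgN hac).
  have h' : 0 < - ImC w by rewrite oppr_gt0.
  apply: filterS (nearC_gt (f := fun s => - ImC s) (cvgN (@cvg_ImC w)) h') => s; rewrite oppr_gt0 => hs.
  by rewrite /ArgC leNgt hs.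
have -> : ArgC w = acos (ReC w / absC w) by rewrite /ArgC ltW.
apply: rcvg_near hac.
apply: filterS (nearC_gt (@cvg_ImC w) h0) => s hs.
by rewrite /ArgC ltW.
Qed.

Lemma ctC_LogC w : slit w -> ctC (@LogC R) w.
Proof.
move=> hw; apply/climRI; split; last exact: cvg_ArgC.
apply: (@rcvg_comp _ (nbhs (w : R[i]^o)) (@absC R)); first exact: cvg_absC.
by apply: continuous_ln; rewrite absC_gt0 slit_neq0.
Qed.

(** The inverse function rule: the Caratheodory factor of [expC] at [LogC w], composed with the
    continuous [LogC], does not vanish near [w], and its inverse is a factor for [LogC]. *)
Lemma derC_LogC w : slit w -> derC (@LogC R) w w^-1.
Proof.
move=> hw; have w0 := slit_neq0 hw.
have [Q [hQ Q0 Qc]] := derC_expC (LogC w).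
rewrite expC_LogC // in Q0.
have cQ : ctC (fun s => Q (LogC s)) w by exact: (ctn_comp Qc (ctC_LogC hw)).
have nz : \forall s \near (w : R[i]^o), Q (LogC s) != 0 /\ s != 0.
  have h1 : \forall s \near (w : R[i]^o), 0 < absC (Q (LogC s)).
    by apply: (nearC_gt (f := fun s => absC (Q (LogC s)))) (clim_abs cQ) _; rewrite absC_gt0 Q0.
  have h2 : \forall s \near (w : R[i]^o), slit s by exact: slit_open.
  by apply: filterS2 h1 h2 => s; rewrite absC_gt0 => -> /slit_neq0.
have rel s : s != 0 -> s = w + Q (LogC s) * (LogC s - LogC w).
  by move=> s0; rewrite -{1}(expC_LogC s0) hQ /inC expC_LogC.
exists (fun s => if s == w then w^-1 else (LogC s - LogC w) / (s - w)); split.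
- move=> s; have [->|ne] := eqVneq s w; first by rewrite subrr mulr0 addr0.
  by rewrite /inC mulfVK ?subr_eq0 // addrC subrK.
- by rewrite eqxx.
rewrite /ctn eqxx; apply: (clim_near (F := fun s => (Q (LogC s))^-1)).
  apply: filterS nz => s [h1 h2].
  have [->|ne] := eqVneq s w; first by rewrite Q0.
  have e : s - w = Q (LogC s) * (LogC s - LogC w) by rewrite {1}(rel _ h2); ring.
  have : s - w != 0 by rewrite subr_eq0.
  rewrite e mulf_eq0 negb_or => /andP[_ h3].
  by field; rewrite h1 h3.
by have := climV _ cQ; rewrite Q0; apply.
Qed.

Lemma LogC_opp w : 0 < ImC w -> LogC (- w) = LogC w - pi *i.
Proof.
move=> h; have w0 : w != 0 by apply: slit_neq0; right; rewrite gt_eqF.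
rewrite /LogC absCN; apply: complex_eq; rewrite ?CE /= ?subr0 //.
rewrite /ArgC !CE absCN (ltW h) oppr_ge0 leNgt h /= mulNr acosN ?ratio_bounds //.
by ring.
Qed.

Lemma expC_slit u v : `|v| < pi -> slit (expC (u +i* v)).
Proof.
move=> hv; have [v0|v0] := eqVneq (sin v) 0; last first.
  by right; rewrite pntE ImC_expC mulf_neq0 // gt_eqF ?expR_gt0.
left; have -> : v = 0.
  apply/eqP; apply: contraTT isT => vn0; move: v0.
  have s0 : 0 < sin `|v| by apply: sin_gt0_pi; rewrite normr_gt0 vn0 hv.
  move: s0; case: (ger0P v) => hv0; rewrite ?sinN => h h'; rewrite ?h' ?oppr0 ltxx in h => //.
by rewrite pntE ReC_expC cos0 mulr1 expR_gt0.
Qed.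

Lemma LogC_lt_pi w : slit w -> `|ArgC w| < pi.
Proof.
move=> h; have w0 := slit_neq0 h; have a0 : 0 < absC w by rewrite absC_gt0.
rewrite lt_neqAle ArgC_le_pi // andbT; apply/eqP => e.
have c : cos (ArgC w) = -1 by rewrite -cos_norm e cospi.
have s : sin (ArgC w) = 0.
  have := sin2cos2 (ArgC w); rewrite c sqrrN expr1n subrr => /eqP.
  by rewrite sqrf_eq0 => /eqP.
move: c s; rewrite cos_ArgC // sin_ArgC // => c s.
case: h => h.
  have : 0 < ReC w / absC w by rewrite divr_gt0.
  by rewrite c; lra.
by move/eqP: s; rewrite mulf_eq0 invr_eq0 (negPf h) gt_eqF.
Qed.

End ExpLog.

(** * The potential and the two cut planes *)

Section Finite.
Variables (R : realType) (I : finType).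

Lemma fin_pos (Q : I -> R -> Prop) :
  (forall p d d', 0 < d' -> d' <= d -> Q p d -> Q p d') ->
  (forall p, exists2 d, 0 < d & Q p d) -> exists2 d, 0 < d & forall p, Q p d.
Proof.
move=> mono h.
have [f hf] : {f : I -> R & forall p, 0 < f p /\ Q p (f p)}.
  by apply: (@choice _ _ (fun p d => 0 < d /\ Q p d)) => p; have [d] := h p; exists d.
suff [d d0 hd] : exists2 d : R, 0 < d & forall p, d <= f p.
  by exists d => // p; have [f0 fQ] := hf p; exact: (mono p (f p)).
suff [d d0 hd] : exists2 d : R, 0 < d & forall p, p \in enum I -> d <= f p.
  by exists d => // p; apply: hd; rewrite mem_enum.
elim: (enum I) => [|p s [d d0 hd]]; first by exists 1.
exists (Num.min (f p) d); first by rewrite lt_min (hf p).1.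
by move=> q; rewrite inE => /orP[/eqP ->|/hd hq]; rewrite ge_min ?lexx ?hq ?orbT.
Qed.

End Finite.

Section Bounded.
Variables (R : realType) (T : Type).
Implicit Types (A : set T) (f g : T -> R).

Definition bdd A f := exists K : R, forall s, A s -> `|f s| <= K.

Lemma bddD A f g : bdd A f -> bdd A g -> bdd A (fun s => f s + g s).
Proof.
move=> [K h] [K' h']; exists (K + K') => s As.
by rewrite (le_trans (ler_normD _ _)) // lerD ?h ?h'.
Qed.

Lemma bddZ A f k : bdd A f -> bdd A (fun s => k * f s).
Proof.
by move=> [K h]; exists (`|k| * K) => s As; rewrite normrM ler_wpM2l // h.
Qed.

Lemma bdd_sum (I : Type) (r : seq I) (p : pred I) A (f : I -> T -> R) :
  (forall i, p i -> bdd A (f i)) -> bdd A (fun s => \sum_(i <- r | p i) f i s).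
Proof.
move=> h; elim: r => [|i r [K IH]]; first by exists 0 => s _; rewrite big_nil normr0.
have [pi|pi] := boolP (p i); last first.
  by exists K => s As; rewrite big_cons (negPf pi); exact: IH.
have [K' h'] := h i pi; exists (K' + K) => s As; rewrite big_cons pi.
by rewrite (le_trans (ler_normD _ _)) // lerD ?h' ?IH.
Qed.

Lemma ln_diff_bound (u v m : R) : 0 < m -> m <= u -> m <= v -> `|ln u - ln v| <= `|u - v| / m.
Proof.
move=> m0; wlog uv : u v / v <= u => [H mu mv|mu mv].
  have /orP[h|h] := le_total v u; first exact: H.
  by rewrite distrC [X in X / m]distrC; exact: H.
have u0 : 0 < u by exact: lt_le_trans mu.
have v0 : 0 < v by exact: lt_le_trans mv.
have lv : ln v <= ln u by rewrite ler_ln ?posrE.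
rewrite !ger0_norm ?subr_ge0 // -ln_div ?posrE //.
have -> : u / v = 1 + (u - v) / v by field; rewrite gt_eqF.
have h0 : 0 <= (u - v) / v by rewrite divr_ge0 ?subr_ge0 // ltW.
rewrite (le_trans (le_ln1Dx _)) //; first by rewrite (lt_le_trans _ h0) // oppr_lt0.
by rewrite ler_wpM2l ?subr_ge0 // lef_pV2 ?posrE.
Qed.

End Bounded.

Section Potential.
Variables (R : realType) (P : nat) (eps lambda rad : R) (c z ph : 'I_P -> R[i]).
Hypotheses (heps : 0 < eps) (hlambda : lambda < 0) (rad0 : 0 < rad).
Hypotheses (hzim : forall p, 0 < ImC (z p)) (hrad : forall p, absC (z p) < rad).
Implicit Types (sg s : R[i]) (p m : 'I_P).

(* [Dom 'i] is the domain [G] of the statement; in [Dom (- 'i)] the cuts that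
   issue from the [z p] point downwards too. *)
Definition Dom sg : set R[i] :=
  [set s | forall p, slit (sg * (s - z p)) /\ slit (- 'i * (s - (z p)^*%R))].

(** For [sg = 'i] this is [h] without the constants [+- pi i / 2] of [f]; they reappear as the
    single factor [branch_factor]. *)
Definition expo sg s : R[i] := lambda%:C * s +
  \sum_p (c p * LogC (sg * (s - z p)) + (c p)^*%R * LogC (- 'i * (s - (z p)^*%R))).

Definition EE sg s : R[i] := expC (- ('i / eps%:C) * expo sg s).

Definition SS s : R[i] := \sum_p (ph p / (s - z p)).

Definition dSS s : R[i] := \sum_p (- ph p / (s - z p) ^+ 2).

Definition rot sg := sg = 'i \/ sg = - 'i.

Lemma rot_i : rot 'i. Proof. by left. Qed.
Lemma rot_Ni : rot (- 'i). Proof. by right. Qed.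

Lemma rot_abs sg : rot sg -> absC sg = 1.
Proof. by case=> ->; rewrite ?absCN absCi. Qed.

Lemma Dom_i s : Dom 'i s <-> forall p, ReC s = ReC (z p) ->
  - ImC (z p) < ImC s < ImC (z p).
Proof.
split=> [h p e|h p].
  have [] := h p; rewrite /slit !CE e !subrr => -[h1|h1] [h2|h2].
  - by apply/andP; split; lra.
  - by exfalso; move/eqP: h2; apply; ring.
  - by exfalso; move/eqP: h1; apply; ring.
  - by exfalso; move/eqP: h1; apply; ring.
have [e|ne] := eqVneq (ReC s) (ReC (z p)).
  by have /andP[h1 h2] := h p e; split; left; rewrite !CE; lra.
have ne' : ReC s - ReC (z p) != 0 by rewrite subr_eq0.
split; right; rewrite !CE.
  by rewrite mul0r add0r mul1r.
by rewrite oppr0 mul0r add0r mulN1r oppr_eq0.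
Qed.

Lemma Dom_Ni s : Dom (- 'i) s <-> forall p, ReC s = ReC (z p) -> ImC (z p) < ImC s.
Proof.
split=> [h p e|h p].
  have [] := h p; rewrite /slit !CE e !subrr => -[h1|h1] _.
  - by lra.
  - by exfalso; move/eqP: h1; apply; ring.
have z0 := hzim p.
have [e|ne] := eqVneq (ReC s) (ReC (z p)).
  by have h1 := h p e; split; left; rewrite !CE; lra.
have ne' : ReC s - ReC (z p) != 0 by rewrite subr_eq0.
by split; right; rewrite !CE oppr0 mul0r add0r mulN1r oppr_eq0.
Qed.

Lemma real_Dom (x : R) : Dom 'i x%:C.
Proof. by apply/Dom_i => p _; rewrite ImCr oppr_lt0 hzim. Qed.

Lemma Im_lt_rad p : ImC (z p) < rad.
Proof. by rewrite (le_lt_trans _ (hrad p)) // (le_trans (ler_norm _)) // ImC_le. Qed.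

Lemma Dom_Ni_high (x y : R) : rad <= y -> Dom (- 'i) (pnt x y).
Proof. by move=> h; apply/Dom_Ni => p _; rewrite ImC_pnt (lt_le_trans _ h) // Im_lt_rad. Qed.

Lemma G_Dom s : G z s <-> Dom 'i s.
Proof.
rewrite Dom_i; split=> [h p e|h p t t0].
  apply/andP; split; rewrite ltNge; apply/negP => hle.
    have [_ /eqP] := h p (- ImC (z p) - ImC s) ltac:(lra); apply.
    by apply: complex_eq; rewrite !CE ?e; ring.
  have [/eqP + _] := h p (ImC s - ImC (z p)) ltac:(lra); apply.
  by apply: complex_eq; rewrite !CE ?e; ring.
split; apply/eqP => e.
  have := h p; rewrite e !CE => /(_ ltac:(ring)) /andP[_]; lra.
have := h p; rewrite e !CE => /(_ ltac:(ring)) /andP[]; lra.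
Qed.

Lemma Dom_neq sg s p : rot sg -> Dom sg s -> s - z p != 0 /\ s - (z p)^*%R != 0.
Proof.
move=> _ h; have [/slit_neq0 h1 /slit_neq0 h2] := h p.
by move: h1 h2; rewrite !mulf_eq0 !negb_or => /andP[_ ->] /andP[_ ->].
Qed.

Lemma derC_affine sg a s : derC (fun s => sg * (s - a)) s sg.
Proof.
have h := derZ sg (derB (der_id (@inC R) s) (der_cst (@inC R) a s)).
by apply: der_eq h; rewrite subr0 mulr1.
Qed.

Lemma derC_comp F H s d e : derC F (H s) d -> derC H s e -> derC (fun s => F (H s)) s (d * e).
Proof. exact: (der_comp (@inC_ctn R)). Qed.

Lemma derC_Log_affine sg a s : slit (sg * (s - a)) ->
  derC (fun s => LogC (sg * (s - a))) s (s - a)^-1.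
Proof.
move=> h; apply: der_eq; last exact: (derC_comp (H := fun s => sg * (s - a)) (derC_LogC h) (derC_affine sg a s)).
have := slit_neq0 h; rewrite mulf_eq0 negb_or => /andP[h1 h2].
by field; rewrite h1 h2.
Qed.

Lemma derC_sum (I : Type) (r : seq I) (F : I -> R[i] -> R[i]) (d : I -> R[i]) s :
  (forall i, derC (F i) s (d i)) ->
  derC (fun x => \sum_(i <- r) F i x) s (\sum_(i <- r) d i).
Proof.
move=> h; elim: r => [|i r IH].
  rewrite big_nil; apply: der_fun (der_cst (@inC R) 0 s) => x; by rewrite big_nil.
rewrite big_cons; apply: der_fun (derD (h i) IH) => x; by rewrite big_cons.
Qed.

Lemma derC_expo sg s : rot sg -> Dom sg s -> derC (expo sg) s (lambda%:C + u0 c z s).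
Proof.
move=> hsg h; apply: derD.
  by apply: der_eq (derZ lambda%:C (der_id (@inC R) s)); rewrite mulr1.
apply: derC_sum => p; have [h1 h2] := h p.
by apply: derD; apply: derZ; exact: derC_Log_affine.
Qed.

Definition dEE sg s : R[i] := - ('i / eps%:C) * (lambda%:C + u0 c z s) * EE sg s.

Lemma derC_EE sg s : rot sg -> Dom sg s -> derC (EE sg) s (dEE sg s).
Proof.
move=> hsg h.
apply: der_eq (derC_comp (derC_expC _) (derZ (- ('i / eps%:C)) (derC_expo hsg h))).
by rewrite /dEE /EE; ring.
Qed.

Lemma derC_inv a s : s - a != 0 -> derC (fun s => (s - a)^-1) s (- (s - a) ^- 2).
Proof.
move=> h; have h1 := derB (der_id (@inC R) s) (der_cst (@inC R) a s).
apply: der_eq; last exact: (derV (F := fun x => inC x - a) (@inC_ctn R) (@inC_inj R) h h1).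
by rewrite /inC subr0 mulN1r.
Qed.

Lemma derC_SS s : (forall p, s - z p != 0) -> derC SS s (dSS s).
Proof.
move=> h; apply: derC_sum => p.
apply: der_eq (derZ (ph p) (derC_inv (h p))).
by rewrite mulrN mulNr.
Qed.

Lemma ctC_inv a s : s - a != 0 -> ctC (fun s => (s - a)^-1) s.
Proof. by move=> h; exact: derC_ctC (derC_inv h). Qed.

Lemma ctC_u0 sg s : rot sg -> Dom sg s -> ctC (u0 c z) s.
Proof.
move=> hsg h; apply: ctn_sum => p; have [h1 h2] := Dom_neq p hsg h.
by apply: ctnD; apply: ctnM; try exact: ctn_cst; exact: ctC_inv.
Qed.

Lemma ctC_dSS s : (forall p, s - z p != 0) -> ctC dSS s.
Proof.
move=> h; apply: ctn_sum => p; apply: ctnZ.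
rewrite (_ : (fun x => _) = (fun x => (x - z p)^-1 * (x - z p)^-1)).
  by apply: ctnM; exact: ctC_inv.
by apply/funext => x; rewrite expr2 invfM.
Qed.

Definition integrand sg s := EE sg s * SS s.
Definition dintegrand sg s := dEE sg s * SS s + EE sg s * dSS s.

Lemma derC_integrand sg s : rot sg -> Dom sg s ->
  derC (integrand sg) s (dintegrand sg s).
Proof.
move=> hsg h; apply: (derM (@inC_ctn R) (derC_EE hsg h)).
by apply: derC_SS => p; have [] := Dom_neq p hsg h.
Qed.

Lemma ctC_dintegrand sg s : rot sg -> Dom sg s -> ctC (dintegrand sg) s.
Proof.
move=> hsg h; have nz p : s - z p != 0 by have [] := Dom_neq p hsg h.
have cE := derC_ctC (derC_EE hsg h).
apply: ctnD.
  apply: ctnM; last exact: derC_ctC (derC_SS nz).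
  apply: ctnM cE; apply: ctnZ.
  by apply: ctnD; [exact: ctn_cst|exact: ctC_u0 hsg h].
by apply: ctnM cE _; exact: ctC_dSS.
Qed.

(** The domain is restricted only on the finitely many vertical lines through the poles. For each of
    them the margin is small enough either to miss the line or to keep the enlarged segment inside
    the open interval [J p], which contains [b]. *)
Lemma tall_columns (J : 'I_P -> set R) (b : R) (D : set R[i]) :
  (forall s, D s <-> forall p, ReC s = ReC (z p) -> J p (ImC s)) -> (forall p, J p b) ->
  (forall p y, J p y -> exists2 d, 0 < d & forall y', `|y' - y| <= d -> J p y') ->
  (forall p y1 y2 y, J p y1 -> J p y2 -> y1 <= y <= y2 -> J p y) -> tall D b.
Proof.
move=> DE Jb Jop Jcvx x0 y0 /DE h.
have [||d d0 hd] := @fin_pos R _ (fun p d => forall x y, `|x - x0| <= d ->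
   Num.min b y0 - d <= y -> y <= Num.max b y0 + d -> x = ReC (z p) -> J p y).
- by move=> p d d' d'0 dd' H x y h1 h2 h3; apply: H; lra.
- move=> p; have := h p; rewrite ReC_pnt ImC_pnt.
  have [e /(_ e) Jy|ne _] := eqVneq x0 (ReC (z p)).
    have [d1 d10 h1] := Jop p b (Jb p); have [d2 d20 h2] := Jop p y0 Jy.
    exists (Num.min d1 d2) => [|x y _]; first by rewrite lt_min d10.
    set d := Num.min d1 d2 => hy1 hy2 _.
    have k1 : d <= d1 by rewrite /d ge_min lexx.
    have k2 : d <= d2 by rewrite /d ge_min lexx orbT.
    have d0 : 0 < d by rewrite lt_min d10.
    have J1 t : `|t| <= d -> J p (b + t) by move=> ht; apply: h1; rewrite addrAC subrr add0r (le_trans ht).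
    have J2 t : `|t| <= d -> J p (y0 + t) by move=> ht; apply: h2; rewrite addrAC subrr add0r (le_trans ht).
    have dn : `|- d| <= d by rewrite normrN gtr0_norm.
    have dp : `|d| <= d by rewrite gtr0_norm.
    move: hy1 hy2; case: (lerP b y0) => hb hy1 hy2.
      by apply: (Jcvx p _ _ y (J1 _ dn) (J2 _ dp)); rewrite hy1.
    by apply: (Jcvx p _ _ y (J2 _ dn) (J1 _ dp)); rewrite hy1.
  exists (`|ReC (z p) - x0| / 2).
    by rewrite divr_gt0 // normr_gt0 subr_eq0 eq_sym.
  move=> x y + _ _ ex; rewrite ex.
  have : 0 < `|ReC (z p) - x0| by rewrite normr_gt0 subr_eq0 eq_sym.
  by lra.
by exists d => // x y h1 h2 h3; apply/DE => p; rewrite ReC_pnt ImC_pnt; exact: hd.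
Qed.

Lemma tall_i : tall (Dom 'i) 0.
Proof.
apply: (tall_columns (J := fun p y => - ImC (z p) < y < ImC (z p)) Dom_i) => [p|p y /andP[h1 h2]|p y1 y2 y].
- by rewrite oppr_lt0 hzim.
- exists (Num.min (y + ImC (z p)) (ImC (z p) - y) / 2) => [|y'].
    by rewrite divr_gt0 // lt_min; apply/andP; split; lra.
  set d := Num.min _ _; have k1 : d <= y + ImC (z p) by rewrite /d ge_min lexx.
  have k2 : d <= ImC (z p) - y by rewrite /d ge_min lexx orbT.
  by rewrite ler_norml => /andP[? ?]; apply/andP; split; lra.
by move=> /andP[? ?] /andP[? ?] /andP[? ?]; apply/andP; split; lra.
Qed.

Lemma tall_Ni : tall (Dom (- 'i)) rad.
Proof.
apply: (tall_columns (J := fun p y => ImC (z p) < y) Dom_Ni) => [p|p y h|p y1 y2 y h _ /andP[h1 _]].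
- exact: Im_lt_rad.
- by exists ((y - ImC (z p)) / 2) => [|y']; rewrite ?divr_gt0 ?subr_gt0 // ler_norml; lra.
exact: lt_le_trans h1.
Qed.

Lemma primitive_Dom sg (g g1 : R[i] -> R[i]) : rot sg ->
  (forall s, Dom sg s -> derC g s (g1 s)) -> (forall s, Dom sg s -> ctC g1 s) ->
  exists F, forall s, Dom sg s -> derC F s (g s).
Proof.
case=> -> hg hg1.
  apply: (primitive_exists tall_i _ hg hg1) => x; apply/Dom_i => p _.
  by rewrite ImC_pnt oppr_lt0 hzim.
by apply: (primitive_exists tall_Ni _ hg hg1) => x; exact: Dom_Ni_high.
Qed.

(* Unlike the modulus, [mu s] is large only when [s] is far away in a direction
   that avoids the cuts of [Dom (- 'i)]. *)
Definition mu s : R := Num.max `|ReC s| (ImC s).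

Lemma mu_le s : mu s <= absC s.
Proof. by rewrite /mu ge_max ReC_le (le_trans (ler_norm _)) // ImC_le. Qed.

Definition logabs sg s : R := \sum_p
  ((ImC (c p) * ln (absC (s - z p)) + ReC (c p) * ArgC (sg * (s - z p))) +
   (- ImC (c p) * ln (absC (s - (z p)^*%R)) + ReC (c p) * ArgC (- 'i * (s - (z p)^*%R)))).

Lemma absC_EE sg s : rot sg ->
  absC (EE sg s) = expR ((lambda * ImC s + logabs sg s) / eps).
Proof.
move=> hsg; rewrite /EE absC_expC; congr expR.
have -> : ReC (- ('i / eps%:C) * expo sg s) = ImC (expo sg s) / eps.
  rewrite (_ : - ('i / eps%:C) * expo sg s = (- 'i * expo sg s) / eps%:C); last by ring.
  by rewrite ReC_div !CE; ring.
congr (_ / _); rewrite /expo ImCD; congr (_ + _); first by rewrite !CE; ring.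
have -> (F : 'I_P -> R[i]) : ImC (\sum_p F p) = \sum_p ImC (F p).
  by apply: (big_morph (@ImC R)) => // *; exact: ImCD.
apply: eq_bigr => p _; rewrite ImCD !ImCM !CE.
have e1 : absC (sg * (s - z p)) = absC (s - z p) by rewrite absCM rot_abs // mul1r.
have e2 : absC (- 'i * (s - (z p)^*%R)) = absC (s - (z p)^*%R) by rewrite absCM absCN absCi mul1r.
have L (w : R[i]) : (ReC (LogC w) = ln (absC w)) * (ImC (LogC w) = ArgC w) by [].
by rewrite !L e1 e2; ring.
Qed.

Lemma bdd_Arg sg a : rot sg -> bdd [set s | slit (sg * (s - a))] (fun s => ArgC (sg * (s - a))).
Proof. by move=> hsg; exists pi => s /slit_neq0; exact: ArgC_le_pi. Qed.

Lemma bdd_sub (T : Type) (A B : set T) (f : T -> R) : A `<=` B -> bdd B f -> bdd A f.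
Proof. by move=> AB [K h]; exists K => s /AB; exact: h. Qed.

(** The logarithms of [|s - z_p|] and [|s - conj z_p|] enter with opposite coefficients, and
    arguments are bounded. Beyond [4 * rad] both moduli are at least [3 * rad] while they differ by
    at most [2 * rad], so the difference of logarithms is at most 1. *)
Lemma logabs_far sg : rot sg -> bdd [set s | Dom sg s /\ 4 * rad <= mu s] (logabs sg).
Proof.
move=> hsg; apply: bdd_sum => p _; set A := [set s | _].
have B1 : bdd A (fun s => ImC (c p) * (ln (absC (s - z p)) - ln (absC (s - (z p)^*%R)))).
  apply: bddZ; exists 1 => s [_ hs]; have m0 := mu_le s.
  have hz := hrad p; have hz' := hz; rewrite -absC_conj in hz'.
  have h1 := absC_lb s (z p); have h2 := absC_lb s (z p)^*%R.
  rewrite (le_trans (ln_diff_bound (m := 3 * rad) _ _ _)) ?mulr_gt0 //; try lra.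
  rewrite ler_pdivrMr ?mulr_gt0 // mul1r ler_norml.
  have t1 := absC_tri (z p) s (z p)^*%R; have t2 := absC_tri (z p)^*%R s (z p).
  have t3 := absCB (z p) (z p)^*%R; have t4 := absCBC (z p) (z p)^*%R.
  lra.
have B2 : bdd A (fun s => ReC (c p) * ArgC (sg * (s - z p))).
  by apply: bddZ; apply: bdd_sub (bdd_Arg (z p) hsg) => s [hs _]; have [] := hs p.
have B3 : bdd A (fun s => ReC (c p) * ArgC (- 'i * (s - (z p)^*%R))).
  by apply: bddZ; apply: bdd_sub (bdd_Arg (sg := - 'i) ((z p)^*%R) _) => [s [hs _]|]; [have [] := hs p|right].
have [K h] := bddD (bddD B1 B2) B3; exists K => s /h; congr (`| _ | <= K); ring.
Qed.

(** Far away only the linear term of [h] matters. The upper bound controls the integrand, the lower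
    one the division by [E] in the solution. *)
Lemma EE_far sg : rot sg -> exists2 K, 0 < K & forall s, Dom sg s -> 4 * rad <= mu s ->
  absC (EE sg s) <= K * expR (lambda * ImC s / eps) /\
  expR (lambda * ImC s / eps) <= K * absC (EE sg s).
Proof.
move=> hsg; have [K hK] := logabs_far hsg; exists (expR (K / eps)); first exact: expR_gt0.
move=> s h1 h2; have := hK s (conj h1 h2); rewrite ler_norml => /andP[k1 k2].
rewrite absC_EE // -!expRD -!mulrDl !ler_expR !ler_pM2r ?invr_gt0 //.
by split; lra.
Qed.

Lemma far_pos s : 4 * rad <= mu s -> 0 < mu s.
Proof. by move=> hs; rewrite (lt_le_trans _ hs) // mulr_gt0. Qed.

Lemma far_pole s b : absC b * 2 <= mu s -> mu s / 2 <= absC (s - b).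
Proof. have := absC_lb s b; have := mu_le s; lra. Qed.

Lemma SS_far : exists2 K, 0 < K & forall s, 4 * rad <= mu s -> absC (SS s) <= K / mu s.
Proof.
exists (1 + \sum_p absC (ph p) * 2) => [|s hs].
  by rewrite ltr_wpDr // sumr_ge0 // => p _; rewrite mulr_ge0 ?absC_ge0.
have m0 := far_pos hs; rewrite (le_trans (absC_sum _ _)) // mulrDl mul1r.
apply: (@le_trans _ _ (\sum_p absC (ph p) * 2 / mu s)); last by rewrite -mulr_suml lerDr invr_ge0 ltW.
apply: ler_sum => p _; rewrite absCM absCV -mulrA ler_wpM2l ?absC_ge0 //.
have h : mu s / 2 <= absC (s - z p) by apply: far_pole; have := hrad p; have := rad0; move: hs; lra.
by rewrite -[leRHS]invrK invf_div lef_pV2 ?posrE ?divr_gt0 // (lt_le_trans _ h) ?divr_gt0.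
Qed.

End Potential.
Arguments rot_i {R}.
Arguments rot_Ni {R}.

(** * Functions on a half-strip with exponentially bounded derivative *)

Section HalfStrip.
Variable R : realType.
Implicit Types (W : R[i] -> R[i]).

Lemma cvg_expRN (k : R) : 0 < k -> expR (- (k * t)) @[t --> +oo] --> (0 : R).
Proof.
move=> k0; apply: (@cvg_comp _ _ _ (fun t : R => k * t) (fun t => expR (- t)) _ (+oo)).
  exact: gt0_cvgMry.
exact: cvgr_expR.
Qed.

Lemma cvg_scaled_expR (a b : R) : b < 0 -> a * expR (b * t) @[t --> +oo] --> (0 : R).
Proof.
move=> b0; rewrite -(mulr0 a); apply: cvgM; first exact: cvg_cst.
have -> : (fun x => expR (b * x)) = (fun x => expR (- (- b * x))).
  by apply/funext => x; rewrite mulNr opprK.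
by apply: cvg_expRN; rewrite oppr_gt0.
Qed.

Lemma is_derive_scaled_expR (a b t : R) :
  is_derive t 1 (fun t => a * expR (b * t)) (a * b * expR (b * t)).
Proof.
have h : is_derive t 1 (fun t => b * t) b.
  by apply: is_derive_eq; rewrite /GRing.scale /=; ring.
have h2 : is_derive t 1 (fun t => expR (b * t)) (expR (b * t) * b).
  exact: (@is_derive1_comp R expR (fun t => b * t) t _ _ (is_derive_expR _) h).
by apply: (is_derive_eq (@is_deriveZ R _ _ _ a t 1 _ h2)); rewrite /GRing.scale /=; ring.
Qed.

Lemma derR_horN y t : derR (fun t : R => pnt (- t) y) t (- 1).
Proof.
have h := derD (derN (der_id (@inR R) t)) (der_cst (@inR R) ('i * y%:C) t).
rewrite addr0 in h; apply: der_fun h => u; by rewrite /pnt /inR rmorphN.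
Qed.

Lemma exp_limit (w w' : R -> R[i]) (A b a0 : R) : b < 0 -> 0 <= A ->
  (forall t, a0 <= t -> derR w t (w' t)) ->
  (forall t, a0 <= t -> absC (w' t) <= A * expR (b * t)) ->
  exists l, clim +oo w l /\ forall a, a0 <= a -> absC (l - w a) <= A / - b * expR (b * a).
Proof.
move=> b0 A0 dw hw; apply: cauchy_at_pinfty (cvg_scaled_expR _ b0) => x y hx xy.
have -> : A / - b * expR (b * x) = 0 - A / b * expR (b * x) by rewrite invrN; ring.
apply: le_trans (_ : A / b * expR (b * y) - A / b * expR (b * x) <= _).
  apply: (@mean_value R w w' (fun t => A / b * expR (b * t)) (fun t => A / b * b * expR (b * t))) => // [t /andP[xt _]|t _|t /andP[xt _]].
  - by apply: dw; exact: le_trans xt.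
  - exact: is_derive_scaled_expR.
  by rewrite divfK ?lt_eqF //; apply: hw; exact: le_trans xt.
by rewrite lerD2r mulr_le0_ge0 ?expR_ge0 // mulr_ge0_le0 // invr_le0 ltW.
Qed.

Section Strip.
Variables (W W' : R[i] -> R[i]) (u0 K b : R).
Hypothesis K0 : 0 <= K.
Hypothesis dW : forall w, ReC w < u0 -> `|ImC w| < pi -> derC W w (W' w).
Hypothesis hW : forall w, ReC w < u0 -> `|ImC w| < pi -> absC (W' w) <= K * expR (b * ReC w).

Lemma strip_vertical u v v' : u < u0 -> `|v| < pi -> `|v'| < pi ->
  absC (W (pnt u v') - W (pnt u v)) <= 2 * pi * K * expR (b * u).
Proof.
move=> hu hv hv'.
have hb t : Num.min v v' <= t <= Num.max v v' -> `|t| < pi.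
  move: hv hv'; rewrite !ltr_norml => hv hv'.
  by case: (lerP v v') => h h'; lra.
have := @mean_value_unordered R (fun v => W (pnt u v)) (fun v => W' (pnt u v) * 'i) (K * expR (b * u)) v v'.
move=> /(_ _ _)/le_trans -> //.
- move=> t /hb ht; apply: der_comp1 (derR_ver u t); apply: dW; rewrite ?ReC_pnt ?ImC_pnt //.
- move=> t /hb ht; rewrite absCM absCi mulr1 -[X in b * X](ReC_pnt u t); apply: hW; rewrite ?ReC_pnt ?ImC_pnt //.
- rewrite [leRHS](_ : _ = K * expR (b * u) * (2 * pi)); last by ring.
  rewrite ler_wpM2l ?mulr_ge0 ?expR_ge0 //.
  move: hv hv'; rewrite !ltr_norml => hv hv'; rewrite ler_norml; lra.
Qed.

(** The derivative is integrable towards [Re w = -oo], so there is a limit along each horizontal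
    line; the limits coincide because the oscillation over a vertical section, of length at most
    [2 * pi], tends to 0. *)
Lemma strip_limit : 0 < b -> exists l, forall w, ReC w < u0 -> `|ImC w| < pi ->
  absC (W w - l) <= K / b * expR (b * ReC w).
Proof.
move=> b0.
have hor v u : u < u0 -> `|v| < pi -> exists l, clim +oo (fun t => W (pnt (- t) v)) l /\
    absC (l - W (pnt u v)) <= K / b * expR (b * u).
  move=> hu hv.
  have [||t ht|t ht|l [hl hb]] := @exp_limit (fun t => W (pnt (- t) v)) (fun t => W' (pnt (- t) v) * - 1) K (- b) (- u).
  - by rewrite oppr_lt0.
  - exact: K0.
  - by apply: der_comp1 (derR_horN v t); apply: dW; rewrite ?ReC_pnt ?ImC_pnt //; lra.
  - rewrite absCM absCN absC1 mulr1 mulNr -mulrN -{2}(ReC_pnt (- t) v).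
    by apply: hW; rewrite ?ReC_pnt ?ImC_pnt //; lra.
  by exists l; split=> //; have := hb (- u) (lexx _); rewrite opprK mulrNN opprK.
have [l [hl _]] := hor 0 (u0 - 1) ltac:(lra) ltac:(rewrite normr0; exact: pi_gt0).
exists l => w hw hw'.
have [l' [hl' hb]] := hor (ImC w) (ReC w) hw hw'.
rewrite pntK in hb; rewrite absCBC; suff -> : l = l' by [].
have hd : clim +oo (fun t => W (pnt (- t) (ImC w)) - W (pnt (- t) 0)) 0.
  apply: (@clim_norm0 R _ _ _ _ _ (fun t => 2 * pi * K * expR (- b * t))).
    near=> t; rewrite subr0 mulNr -mulrN; apply: strip_vertical => //.
      by near: t; apply: filterS (nbhs_pinfty_gt (num_real (- u0))) => t; lra.
    by rewrite normr0 pi_gt0.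
  by apply: cvg_scaled_expR; rewrite oppr_lt0.
apply/esym/eqP; rewrite -subr_eq0; apply/eqP.
apply: (clim_unique _ hd).
by apply: climD => //; exact: climN.
Unshelve. all: by end_near. Qed.

Lemma strip_growth : b < 0 -> exists K', forall w, ReC w <= u0 - 1 -> `|ImC w| < pi ->
  absC (W w) <= K' * expR (b * ReC w).
Proof.
move=> b0; pose u1 := u0 - 1; pose w1 := pnt u1 0.
(* The path goes from [w1] vertically at abscissa [u1] and then to the left. The contribution up to
   the corner is constant; the factor [expR (- (b * u1))] makes it a multiple of [expR (b * Re w)],
   which is at least [expR (b * u1)] since [b < 0]. *)
pose K1 := (absC (W w1) + 2 * pi * K * expR (b * u1)) * expR (- (b * u1)) + K / - b.
exists K1 => w hw hv.
have hb t : ReC w <= t -> expR (b * t) <= expR (b * ReC w).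
  by move=> h; rewrite ler_expR ler_wnM2l // ltW.
have H : absC (W (pnt u1 (ImC w)) - W (pnt (ReC w) (ImC w))) <=
    K / b * expR (b * u1) - K / b * expR (b * ReC w).
  apply: (@mean_value R (fun t => W (pnt t (ImC w))) (fun t => W' (pnt t (ImC w)) * 1)
     (fun t => K / b * expR (b * t)) (fun t => K / b * b * expR (b * t))) => //.
  - move=> t /andP[h1 h2]; apply: der_comp1 (derR_hor (ImC w) t).
    by apply: dW; rewrite ?ReC_pnt ?ImC_pnt //; rewrite /u1 in h2; lra.
  - by move=> t _; exact: is_derive_scaled_expR.
  - move=> t /andP[h1 h2]; rewrite mulr1 divfK ?lt_eqF // -{2}(ReC_pnt t (ImC w)).
    by apply: hW; rewrite ?ReC_pnt ?ImC_pnt //; rewrite /u1 in h2; lra.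
have V : absC (W (pnt u1 (ImC w)) - W w1) <= 2 * pi * K * expR (b * u1).
  by apply: strip_vertical; rewrite ?normr0 ?pi_gt0 // /u1; lra.
rewrite pntK in H; set A := W (pnt u1 (ImC w)) in H V.
have T : absC (W w) <= absC (W w1) + absC (A - W w1) + absC (A - W w).
  have t1 := absC_lb (W w) A; have t2 := absC_lb A (W w1).
  by rewrite absCBC in t1; lra.
rewrite (le_trans T) // /K1 [leRHS]mulrDl; apply: lerD.
  rewrite -mulrA -expRD (le_trans (lerD (lexx _) V)) // ler_peMr //.
    by rewrite addr_ge0 ?absC_ge0 // !mulr_ge0 ?expR_ge0 // pi_ge0.
  by rewrite -[leLHS]expR0 ler_expR addrC subr_ge0 ler_wnM2l // ltW.
rewrite (le_trans H) // invrN mulrN mulNr gerDr.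
by rewrite mulr_le0_ge0 ?expR_ge0 // mulr_ge0_le0 // invr_le0 ltW.
Qed.

End Strip.

End HalfStrip.

(** * Behaviour of the integrand, its primitives and the solutions at the poles and at infinity *)

Section Solutions.
Variables (R : realType) (P : nat) (eps lambda rad : R) (c z ph : 'I_P -> R[i]).
Hypotheses (heps : 0 < eps) (hlambda : lambda < 0) (rad0 : 0 < rad).
Hypotheses (hzim : forall p, 0 < ImC (z p)) (hrad : forall p, absC (z p) < rad).
Hypothesis hzre : forall p q : 'I_P, (p < q)%N -> ReC (z p) < ReC (z q).
Implicit Types (sg s : R[i]) (p m : 'I_P).

Local Notation D := (Dom z).
Local Notation E := (EE eps lambda c z).
Local Notation itg := (integrand eps lambda c z ph).

Lemma Re_z_neq p m : p != m -> ReC (z p) != ReC (z m).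
Proof.
move=> pm; have [/hzre h|/hzre h|/val_inj h] := ltngtP p m.
- by rewrite lt_eqF.
- by rewrite gt_eqF.
- by rewrite h eqxx in pm.
Qed.

Lemma z_neq p m : p != m -> z p - z m != 0.
Proof.
move=> /Re_z_neq h; rewrite subr_eq0; apply: contra h => /eqP ->; exact: eqxx.
Qed.

(** The order of [|E|] at [z m]: there [E] behaves like the power of exponent [- i c_m / eps], of
    which this is the real part. *)
Definition alp m : R := ImC (c m) / eps.
Local Notation al := alp.

(** In the disc of radius [d] about [z m] no cut but the one from [z m] itself is met. *)
Definition near_ok m (d : R) := d <= ImC (z m) /\
  forall p, p != m -> d <= `|ReC (z p) - ReC (z m)|.

Lemma near_ok_exists m (d1 : R) : 0 < d1 -> exists d, [/\ 0 < d, d <= d1 & near_ok m d].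
Proof.
move=> d10; have [||d2 d20 h2] := @fin_pos R _ (fun p d => p != m -> d <= `|ReC (z p) - ReC (z m)|).
- by move=> p d d' _ dd' h /h; exact: le_trans.
- move=> p; have [e|ne] := eqVneq p m; first by exists 1.
  by exists `|ReC (z p) - ReC (z m)| => //; rewrite normr_gt0 subr_eq0 Re_z_neq.
exists (Num.min (Num.min d1 d2) (ImC (z m))); split.
- by rewrite !lt_min d10 d20 hzim.
- by rewrite !ge_min lexx.
split; first by rewrite ge_min lexx orbT.
by move=> p /h2; apply: le_trans; rewrite !ge_min lexx orbT.
Qed.

Lemma near_Dom sg m d s : rot sg -> near_ok m d -> absC (s - z m) < d ->
  slit (sg * (s - z m)) -> D sg s.
Proof.
move=> hsg [h1 h2] hs hsl.
have hR : `|ReC s - ReC (z m)| < d by rewrite -ReCN -ReCD (le_lt_trans (ReC_le _)).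
have hI : `|ImC s - ImC (z m)| < d by rewrite -ImCN -ImCD (le_lt_trans (ImC_le _)).
have pm p : ReC s = ReC (z p) -> p = m.
  move=> e; apply/eqP; apply: contraTT isT => /h2; rewrite -e; lra.
have z0 := hzim m; move: hI; rewrite ltr_norml => /andP[i1 i2].
case: hsg hsl => ->; rewrite /slit !CE.
  move=> h; apply/Dom_i => p e; have := pm p e => ep; rewrite ep in e *.
  case: h; rewrite e; last by move/eqP => h; case: h; ring.
  by move=> h; apply/andP; split; lra.
move=> h; apply/Dom_Ni => // p e; have := pm p e => ep; rewrite ep in e *.
case: h; rewrite e; last by move/eqP => h; case: h; ring.
by move=> h; lra.
Qed.

(** This is [f = O(|s - z_m|^a)] within the cut plane, for a real exponent [a], the power being
    written with [expR] and [ln]. *)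
Definition pole_bound sg m (f : R[i] -> R[i]) (a : R) := exists K d, 0 < d /\
  forall s, D sg s -> absC (s - z m) < d -> absC (f s) <= K * expR (a * ln (absC (s - z m))).

Section PoleBounds.
Variables (sg : R[i]) (m : 'I_P).
Hypothesis hsg : rot sg.
Implicit Types (f g : R[i] -> R[i]) (a b : R).
Local Notation pb := (pole_bound sg m).

Lemma pole_bound_norm f a : pb f a -> exists K d, [/\ 0 <= K, 0 < d, d <= 1 &
  forall s, D sg s -> absC (s - z m) < d -> absC (f s) <= K * expR (a * ln (absC (s - z m)))].
Proof.
move=> [K [d [d0 h]]]; exists `|K|, (Num.min d 1); split=> //.
- by rewrite lt_min d0 ltr01.
- by rewrite ge_min lexx orbT.
move=> s hD; rewrite lt_min => /andP[hs _].
by rewrite (le_trans (h s hD hs)) // ler_wpM2r ?expR_ge0 ?ler_norm.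
Qed.

Lemma pole_bound_le f a b : b <= a -> pb f a -> pb f b.
Proof.
move=> ba /pole_bound_norm [K [d [K0 d0 d1 h]]]; exists K, d; split=> // s hD hs.
rewrite (le_trans (h s hD hs)) // ler_wpM2l // ler_expR ler_wnM2r //.
by apply: ln_le0; rewrite ltW // (lt_le_trans hs).
Qed.

Lemma pole_boundM f g a b : pb f a -> pb g b -> pb (fun s => f s * g s) (a + b).
Proof.
move=> /pole_bound_norm [K [d [_ d0 _ h]]] /pole_bound_norm [K' [d' [_ d'0 _ h']]].
exists (K * K'), (Num.min d d'); split; first by rewrite lt_min d0.
move=> s hD; rewrite lt_min => /andP[s1 s2]; rewrite absCM mulrDl expRD mulrACA.
by apply: ler_pM; rewrite ?absC_ge0 ?h ?h'.
Qed.

Lemma pole_boundD f g a : pb f a -> pb g a -> pb (fun s => f s + g s) a.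
Proof.
move=> [K [d [d0 h]]] [K' [d' [d'0 h']]].
exists (K + K'), (Num.min d d'); split; first by rewrite lt_min d0.
move=> s hD; rewrite lt_min => /andP[s1 s2].
by rewrite (le_trans (absCD _ _)) // mulrDl lerD ?h ?h'.
Qed.

Lemma pole_bound_sum (r : seq 'I_P) (f : 'I_P -> R[i] -> R[i]) a :
  (forall p, pb (f p) a) -> pb (fun s => \sum_(p <- r) f p s) a.
Proof.
move=> h; elim: r => [|p r IH].
  by exists 0, 1; split=> // s _ _; rewrite big_nil absC0 mul0r.
by under [X in pb X]funext do rewrite big_cons; exact: pole_boundD.
Qed.

Lemma pole_bound_near f g a : (\forall s \near (z m : R[i]^o), f s = g s) -> pb f a -> pb g a.
Proof.
move=> /nearC [r r0 hr] [K [d [d0 h]]]; exists K, (Num.min d r); split; first by rewrite lt_min d0.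
by move=> s hD; rewrite lt_min => /andP[s1 s2]; rewrite -hr // h.
Qed.

Lemma pole_bound_ctn f : ctC f (z m) -> pb f 0.
Proof.
move=> /climP /(_ _ ltr01) /nearC [d d0 h]; exists (absC (f (z m)) + 1), d; split=> // s _ /h hs.
by rewrite mul0r expR0 mulr1; have := absC_lb (f s) (f (z m)); lra.
Qed.

Lemma pole_bound_SS : pb (SS z ph) (-1).
Proof.
apply: pole_bound_sum => p; have [->|pm] := eqVneq p m.
  exists (absC (ph m)), 1; split=> // s hD hs; rewrite absCM absCV mulN1r expRN lnK // posrE absC_gt0.
  by have [] := Dom_neq m hsg hD.
apply: (@pole_bound_le _ 0); first by rewrite lerN10.
apply: pole_bound_ctn; apply: ctnZ.
by apply: ctC_inv; apply: z_neq; rewrite eq_sym.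
Qed.

Lemma pole_bound_power (k : R[i]) : pb (fun s => expC (k * LogC (sg * (s - z m)))) (ReC k).
Proof.
exists (expR (`|ImC k| * pi)), 1; split=> // s hD _.
have [/slit_neq0 w0 _] := hD m; rewrite absC_expC -expRD ler_expR.
have -> : ReC (k * LogC (sg * (s - z m))) = ReC k * ln (absC (s - z m)) - ImC k * ArgC (sg * (s - z m)).
  by rewrite !CE /LogC /= absCM rot_abs // mul1r.
rewrite addrC lerD2r -mulNr (le_trans (ler_norm _)) // normrM normrN ler_wpM2l //.
exact: ArgC_le_pi.
Qed.

Lemma pole_bound_EE : pb (E sg) (al m) /\ pb (fun s => (E sg s)^-1) (- al m).
Proof.
pose k := - ('i / eps%:C) * c m.
(* The part of the exponent continuous at [z m]: the poles have distinct real parts, so [z m] is off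
   the cuts of the other logarithms. The remaining factor is a power of [s - z m], whose argument is
   bounded. *)
pose rest s := - ('i / eps%:C) * (lambda%:C * s + \sum_p ((if p == m then 0 else c p * LogC (sg * (s - z p))) +
  (c p)^*%R * LogC (- 'i * (s - (z p)^*%R)))).
have EEk s : E sg s = expC (k * LogC (sg * (s - z m))) * expC (rest s).
  rewrite -expCD; congr expC; rewrite /expo /k /rest (bigD1 m) //= [in RHS](bigD1 m) //= eqxx.
  rewrite [in RHS](eq_bigr (fun p => c p * LogC (sg * (s - z p)) + (c p)^*%R * LogC (- 'i * (s - (z p)^*%R)))).
    by ring.
  by move=> p /negPf ->.
have kE : ReC k = al m.
  rewrite /alp -ImC_div (_ : k = - ('i * (c m / eps%:C))); first by rewrite !CE; ring.
  by rewrite /k; ring.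
have ct : ctC rest (z m).
  apply: ctnZ.
  apply: ctnD; first by apply: ctnZ; exact: (@inC_ctn R).
  apply: ctn_sum => p; apply: ctnD.
    have [_|pm] := eqVneq p m; first exact: ctn_cst.
    apply: ctnZ.
    apply: derC_ctC; apply: derC_Log_affine; right.
    have := Re_z_neq pm; rewrite eq_sym -subr_eq0.
    by case: hsg => -> h; rewrite !CE ?oppr0 mul0r add0r ?mul1r ?mulN1r ?oppr_eq0.
  apply: ctnZ.
  apply: derC_ctC; apply: derC_Log_affine; left; rewrite !CE.
  by have := hzim p; have := hzim m; lra.
have cE f : ctC f (z m) -> pb (fun s => expC (f s)) 0.
  move=> h; apply: pole_bound_ctn.
  exact: (@ctn_comp R R[i]^o (@expC R) f (z m) (derC_ctC (derC_expC _)) h).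
split.
  have := pole_boundM (pole_bound_power k) (cE _ ct).
  by rewrite addr0 kE; under [X in pb X]funext do rewrite -EEk.
have := pole_boundM (pole_bound_power (- k)) (cE _ (ctnN ct)).
rewrite addr0 ReCN kE; under [X in pb X]funext do rewrite mulNr !expCN -invfM -EEk.
by [].
Qed.

Section Primitive.
Variables (F H : R[i] -> R[i]).
Hypothesis dF : forall s, D sg s -> derC F s (H s).

(* The slit disc around the pole is the image of a half-strip. *)
Let W w := F (z m + sg^-1 * expC w).
Let W' w := H (z m + sg^-1 * expC w) * (sg^-1 * expC w).

Let sgn0 : sg != 0. Proof. by case: hsg => ->; rewrite ?oppr_eq0 i_neq0. Qed.

Let ptw w : z m + sg^-1 * expC w - z m = sg^-1 * expC w.
Proof. by rewrite addrC addKr. Qed.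

Let ptw_abs w : absC (z m + sg^-1 * expC w - z m) = expR (ReC w).
Proof. by rewrite ptw absCM absCV rot_abs // invr1 mul1r absC_expC. Qed.

Let ptw_Dom d w : 0 < d -> near_ok m d -> ReC w < ln d -> `|ImC w| < pi ->
  D sg (z m + sg^-1 * expC w) /\ absC (z m + sg^-1 * expC w - z m) < d.
Proof.
move=> d0 hd h1 h2.
have h : absC (z m + sg^-1 * expC w - z m) < d.
  by rewrite ptw_abs -[d]lnK ?posrE // ltr_expR.
split=> //; apply: (near_Dom hsg hd h); rewrite ptw mulVKf //.
have := @expC_slit R (ReC w) (ImC w) h2; by case: (w).
Qed.

Let W_der d w : 0 < d -> near_ok m d -> ReC w < ln d -> `|ImC w| < pi -> derC W w (W' w).
Proof.
move=> d0 hd h1 h2; have [hD _] := ptw_Dom d0 hd h1 h2.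
have h := derD (der_cst (@inC R) (z m) w) (derZ sg^-1 (derC_expC w)).
rewrite add0r in h; exact: (derC_comp (H := fun w => z m + sg^-1 * expC w) (dF hD) h).
Qed.

Let W_bound b : pb H b -> exists d K, [/\ 0 < d, near_ok m d, d <= 1, 0 <= K &
  forall w, ReC w < ln d -> `|ImC w| < pi -> absC (W' w) <= K * expR ((b + 1) * ReC w)].
Proof.
move=> /pole_bound_norm [K [d1 [K0 d10 d11 h]]]; have [d [d0 dd hd]] := near_ok_exists m d10.
exists d, K; split=> // [|w h1 h2]; first exact: le_trans d11.
have [hD hs] := ptw_Dom d0 hd h1 h2; have := h _ hD (lt_le_trans hs dd).
rewrite ptw_abs expRK => e1; rewrite /W' absCM [absC (sg^-1 * _)]absCM absCV (rot_abs hsg) invr1 mul1r absC_expC.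
by rewrite mulrDl mul1r expRD [leRHS]mulrA ler_wpM2r ?expR_ge0.
Qed.

Let unw s d : 0 < d -> D sg s -> absC (s - z m) < d ->
  [/\ ReC (LogC (sg * (s - z m))) = ln (absC (s - z m)), `|ImC (LogC (sg * (s - z m)))| < pi,
  F s = W (LogC (sg * (s - z m))) & ln (absC (s - z m)) < ln d].
Proof.
move=> d0 hD hs; have [hsl _] := hD m; split.
- by rewrite /LogC /= absCM rot_abs // mul1r.
- exact: LogC_lt_pi.
- by rewrite /W expC_LogC ?slit_neq0 // mulKf // addrC subrK.
- by rewrite ltr_ln // posrE // absC_gt0; have [] := Dom_neq m hsg hD.
Qed.

(** In the half-strip a bound of order [b] on the integrand becomes [expR ((b + 1) * Re w)], the
    extra 1 being the Jacobian of the exponential; integrating keeps this order. *)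
Lemma pole_limit a b : b + 1 = a -> 0 < a -> pb H b -> exists l, pb (fun s => F s - l) a.
Proof.
move=> <- a0 /W_bound [d [K [d0 hd _ K0 hK]]].
have [l hl] := strip_limit K0 (fun w => @W_der d w d0 hd) hK a0.
exists l, (K / (b + 1)), d; split=> // s hD hs.
have [e1 e2 -> e3] := unw d0 hD hs.
by rewrite -e1; apply: hl => //; rewrite e1.
Qed.

Lemma pole_growth a b : b + 1 = a -> a < 0 -> pb H b -> pb F a.
Proof.
move=> <- a0 /W_bound [d [K [d0 hd d1 K0 hK]]].
have [K' hl] := strip_growth K0 (fun w => @W_der d w d0 hd) hK a0.
(* [strip_growth] starts one unit to the left of the edge [ln d] of the half-strip, which divides
   the radius by [e]. *)
exists K', (d * expR (- 1)); split; first by rewrite mulr_gt0 ?expR_gt0.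
move=> s hD hs.
have hs' : absC (s - z m) < d.
  by rewrite (lt_le_trans hs) // ler_piMr ?(ltW d0) // -expR0 ler_expR; lra.
have [e1 e2 -> e3] := unw d0 hD hs'.
rewrite -e1; apply: hl => //; rewrite e1.
have e : ln (d * expR (-1)) = ln d - 1 by rewrite lnM ?posrE ?expR_gt0 // expRK.
rewrite -e ler_ln ?posrE ?mulr_gt0 ?expR_gt0 ?(ltW hs) //.
by rewrite absC_gt0; have [] := Dom_neq m hsg hD.
Qed.

End Primitive.

Section Solution.
Variable F : R[i] -> R[i].
Hypothesis dF : forall s, D sg s -> derC F s (itg sg s).

Lemma pole_bound_integrand : pb (itg sg) (al m - 1).
Proof. exact: (pole_boundM pole_bound_EE.1 pole_bound_SS). Qed.

Definition sol k s : R[i] := - ('i / eps%:C) * ((E sg s)^-1 * (F s - k)).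

(** If [alp m > 0], the bound on [F - k] compensates [E^-1] and the solution is even bounded.
    Otherwise [F] is integrated after weakening the order [alp m - 1] of the integrand by one half:
    this keeps the order of the primitive negative and avoids the logarithm at [alp m = 0]. The
    result is a singularity of order [-1/2], still integrable. *)
Lemma solution_small_at_pole k :
  (0 < al m -> pb (fun s => F s - k) (al m)) -> pb (sol k) (- (1 / 2)).
Proof.
move=> hk; rewrite -[- _]add0r; apply: pole_boundM; first by apply: pole_bound_ctn; exact: ctn_cst.
have [a0|a0] := ltP 0 (al m).
  by apply: (@pole_bound_le _ (- al m + al m)); [lra|exact: (pole_boundM pole_bound_EE.2 (hk a0))].
have -> : - (1 / 2) = - al m + (al m - 1 / 2) by ring.
apply: (pole_boundM pole_bound_EE.2); apply: pole_boundD.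
  apply: (@pole_growth _ _ dF _ (al m - 3 / 2)); [by field|lra|].
  by apply: pole_bound_le pole_bound_integrand; lra.
by apply: (@pole_bound_le _ 0); [lra|apply: pole_bound_ctn; exact: ctn_cst].
Qed.

Lemma solution_ode k s : D sg s ->
  derC (sol k) s ('i / eps%:C * ((lambda%:C + u0 c z s) * sol k s - SS z ph s)).
Proof.
move=> hD; have E0 : E sg s != 0 by exact: expC_neq0.
have h1 := derV (@inC_ctn R) (@inC_inj R) E0 (derC_EE eps lambda c hsg hD).
have h2 := derB (dF hD) (der_cst (@inC R) k s).
apply: der_eq (derZ (- ('i / eps%:C)) (derM (@inC_ctn R) h1 h2)).
rewrite /sol /dEE /integrand; have : eps%:C != 0 by rewrite real_neq0 gt_eqF.
by move=> e0; field; rewrite E0 e0.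
Qed.

End Solution.

End PoleBounds.

Lemma small_power (a K e : R) : 0 < a -> 0 < e ->
  exists2 d, 0 < d & forall r, 0 < r -> r < d -> K * expR (a * ln r) < e.
Proof.
move=> a0 e0; have K0 : 0 < `|K| + 1 by rewrite ltr_wpDl.
exists (expR (ln (e / (`|K| + 1)) / a)); first exact: expR_gt0.
move=> r r0; rewrite -[r in r < _]lnK ?posrE // ltr_expR ltr_pdivlMr // mulrC => h.
have h1 : expR (a * ln r) < e / (`|K| + 1).
  by rewrite -[ltRHS]lnK ?posrE ?divr_gt0 // ltr_expR.
rewrite ltr_pdivlMr // in h1; apply: le_lt_trans h1.
by rewrite mulrC ler_wpM2l ?expR_ge0 // (le_trans (ler_norm K)) // lerDl.
Qed.

Lemma lim_at_pole (T : Type) (Fi : set_system T) {FF : Filter Fi} (gam : T -> R[i]) sg m F l a :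
  rot sg -> 0 < a -> pole_bound sg m (fun s => F s - l) a -> clim Fi gam (z m) ->
  (\forall t \near Fi, D sg (gam t)) -> clim Fi (fun t => F (gam t)) l.
Proof.
move=> hsg a0 [K [d [d0 h]]] /climP hg hD; apply/climP => e e0.
have [d' d'0 hd] := small_power K a0 e0.
have mm : 0 < Num.min d d' by rewrite lt_min d0.
apply: filterS2 hD (hg _ mm) => t ht; rewrite lt_min => /andP[t1 t2].
apply: le_lt_trans (h _ ht t1) _; apply: hd t2.
by rewrite absC_gt0; have [] := Dom_neq m hsg ht.
Qed.

Lemma integrand_bound sg : rot sg -> exists2 K, 0 < K & forall s, D sg s -> 4 * rad <= mu s ->
  absC (itg sg s) <= K / mu s * expR (lambda * ImC s / eps).
Proof.
move=> hsg; have [K1 K10 h1] := EE_far lambda c heps rad0 hrad hsg.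
have [K2 K20 h2] := SS_far ph rad0 hrad.
exists (K1 * K2) => [|s hD hs]; first exact: mulr_gt0.
have [e1 _] := h1 s hD hs; have e2 := h2 s hs.
rewrite absCM (le_trans (ler_pM (absC_ge0 _) (absC_ge0 _) e1 e2)) //.
by rewrite le_eqVlt; apply/orP; left; apply/eqP; ring.
Qed.

Lemma mu_pnt_ge (x y y' : R) : y <= y' -> mu (pnt x y) <= mu (pnt x y').
Proof. by move=> h; rewrite /mu !ReC_pnt !ImC_pnt ge_max !le_max lexx /= h orbT. Qed.

Lemma Dom_Ni_up (x y y' : R) : y <= y' -> D (- 'i) (pnt x y) -> D (- 'i) (pnt x y').
Proof.
move=> h /(Dom_Ni hzim) hD; apply/(Dom_Ni hzim) => p; have := hD p.
by rewrite !ReC_pnt !ImC_pnt => h1 /h1; lra.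
Qed.

(** In [Dom (- 'i)] one can always move upwards, and [mu] does not decrease on the way, so a
    primitive has a limit on each vertical with the rate of the integrand. Two verticals share this
    limit, as seen along horizontal segments of increasing height; subtracting it gives the
    decay. *)
Lemma normalized_primitive : exists F K, [/\ 0 < K,
  forall s, D (- 'i) s -> derC F s (itg (- 'i) s) &
  forall s, D (- 'i) s -> 4 * rad <= mu s ->
     absC (F s) <= K / mu s * expR (lambda * ImC s / eps)].
Proof.
have [F dF] := primitive_Dom hzim hrad rot_Ni (fun s hs => derC_integrand eps lambda c ph rot_Ni hs)
  (fun s hs => ctC_dintegrand eps lambda c ph rot_Ni hs).
have [K K0 hK] := integrand_bound rot_Ni.
pose b := lambda / eps.
have b0 : b < 0 by rewrite pmulr_llt0 // invr_gt0.
have be t : lambda * t / eps = b * t by rewrite /b mulrAC.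
have ver x y : D (- 'i) (pnt x y) -> 4 * rad <= mu (pnt x y) ->
  exists l, clim +oo (fun t => F (pnt x t)) l /\
    absC (l - F (pnt x y)) <= K / - b / mu (pnt x y) * expR (b * y).
  move=> hD hm; have m0 := far_pos rad0 hm.
  have [||t yt|t yt|l [h1 h2]] := @exp_limit R (fun t => F (pnt x t)) (fun t => itg (- 'i) (pnt x t) * 'i)
    (K / mu (pnt x y)) b y.
  - exact: b0.
  - by rewrite divr_ge0 // ltW.
  - by apply: der_comp1 (derR_ver x t); apply: dF; exact: Dom_Ni_up hD.
  - have hm' : 4 * rad <= mu (pnt x t) by exact: le_trans hm (mu_pnt_ge _ yt).
    rewrite absCM absCi mulr1 (le_trans (hK _ (Dom_Ni_up yt hD) hm')) // ImC_pnt be.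
    rewrite ler_wpM2r ?expR_ge0 // ler_pM2l // lef_pV2 ?posrE //; first exact: mu_pnt_ge.
    exact: far_pos hm'.
  by exists l; split=> //; rewrite (mulrAC K); exact: h2.
have r4 : 4 * rad <= mu (pnt 0 (4 * rad)) by rewrite /mu ImC_pnt le_max lexx orbT.
have rr : rad <= 4 * rad by rewrite ler_peMl ?(ltW rad0) // ler1n.
have [l0 [hl0 _]] := ver 0 (4 * rad) (Dom_Ni_high hzim hrad _ rr) r4.
exists (fun s => F s - l0), (K / - b); split.
- by rewrite divr_gt0 // oppr_gt0.
- move=> s hD; apply: der_eq (derB (dF _ hD) (der_cst (@inC R) l0 s)).
  by rewrite subr0.
move=> s hD hm; rewrite -(pntK s) in hD hm *; set x := ReC s in hD hm *; set y := ImC s in hD hm *.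
have [l [hl hb]] := ver x y hD hm.
rewrite ImC_pnt be absCBC; suff <- : l = l0 by [].
apply/eqP; rewrite -subr_eq0; apply/eqP.
have hh : clim +oo (fun t => F (pnt x t) - F (pnt 0 t)) (l - l0).
  by apply: climD => //; exact: climN.
apply: (clim_unique hh).
apply: (@clim_norm0 R _ _ _ _ _ (fun t => (K / (4 * rad) * `|x - 0|) * expR (b * t))).
  near=> t; rewrite subr0.
  have t4 : 4 * rad <= t by near: t; apply: nbhs_pinfty_ge; rewrite num_real.
  rewrite [leRHS]mulrAC.
  apply: (@mean_value_unordered R (fun x => F (pnt x t)) (fun x => itg (- 'i) (pnt x t) * 1)).
    move=> u _; apply: der_comp1 (derR_hor t u); apply: dF; apply: (Dom_Ni_high hzim hrad); exact: le_trans t4.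
  move=> u _; rewrite mulr1.
  have hm' : 4 * rad <= mu (pnt u t) by rewrite /mu ImC_pnt le_max t4 orbT.
  rewrite (le_trans (hK _ (Dom_Ni_high hzim hrad u (le_trans rr t4)) hm')) // ImC_pnt be ler_wpM2r ?expR_ge0 //.
  by rewrite ler_pM2l // lef_pV2 ?posrE ?(far_pos rad0 hm') // mulr_gt0.
exact: cvg_scaled_expR.
Unshelve. all: by end_near. Qed.

End Solutions.

(** * Cauchy's theorem across the cuts *)

Section Segments.
Variable R : realType.
Implicit Types (F g : R[i] -> R[i]).

Lemma derR_segment (a b : R[i]) (t : R) : derR (fun t : R => a + t%:C * (b - a)) t (b - a).
Proof.
have h := derD (der_cst (@inR R) a t) (derM (@inR_ctn R) (der_id (@inR R) t) (der_cst (@inR R) (b - a) t)).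
by apply: der_eq h; rewrite mul1r mulr0 addr0 add0r.
Qed.

Lemma segment_mean_value F g (a b : R[i]) (B : R) :
  (forall t : R, 0 <= t <= 1 -> derC F (a + t%:C * (b - a)) (g (a + t%:C * (b - a)))) ->
  (forall t : R, 0 <= t <= 1 -> absC (g (a + t%:C * (b - a))) <= B) ->
  absC (F b - F a) <= B * absC (b - a).
Proof.
move=> hd hB.
have := @mean_value_cst R (fun t => F (a + t%:C * (b - a))) (fun t => g (a + t%:C * (b - a)) * (b - a))
  (B * absC (b - a)) 0 1 ler01.
have e1 : a + 1%:C * (b - a) = b by rewrite mul1r addrC subrK.
have e0 : a + 0%:C * (b - a) = a by rewrite mul0r addr0.
rewrite e1 e0 subr0 mulr1; apply.
  by move=> t ht; exact: (der_comp1 (hd t ht) (derR_segment a b t)).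
by move=> t ht; rewrite absCM ler_wpM2r ?absC_ge0 ?hB.
Qed.

Lemma segment_constant F g1 g2 (k : R[i]) (F2 : R[i] -> R[i]) (a b : R[i]) :
  (forall t : R, 0 <= t <= 1 -> derC F (a + t%:C * (b - a)) (g1 (a + t%:C * (b - a))) /\
    derC F2 (a + t%:C * (b - a)) (g2 (a + t%:C * (b - a))) /\
    g1 (a + t%:C * (b - a)) = k * g2 (a + t%:C * (b - a))) ->
  F b - k * F2 b = F a - k * F2 a.
Proof.
move=> h; apply/eqP; rewrite -subr_eq0 -absC_eq0 eq_le absC_ge0 andbT.
have := @segment_mean_value (fun s => F s - k * F2 s) (fun s => g1 s - k * g2 s) a b 0.
rewrite mul0r; apply=> t ht; have [h1 [h2 h3]] := h t ht.
  by apply: (derB h1); exact: derZ _ _ _ _ h2.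
by rewrite h3 subrr absC0.
Qed.

End Segments.

(** * Division by [s - zeta] at a zero *)

Section Quotient.
Variable R : realType.
Variables (D : set R[i]) (N N1 N2 : R[i] -> R[i]) (zeta : R[i]).
Hypothesis Dop : forall s, D s -> exists2 r : R, 0 < r & forall s', absC (s' - s) < r -> D s'.
Hypotheses (dN : forall s, D s -> derC N s (N1 s)) (dN1 : forall s, D s -> derC N1 s (N2 s)).
Hypothesis N0 : D zeta -> N zeta = 0.

Lemma first_order (F : R[i] -> R[i]) s d (e : R) : derC F s d -> 0 < e ->
  exists2 r : R, 0 < r & forall s', absC (s' - s) < r ->
    absC (F s' - F s - d * (s' - s)) <= e * absC (s' - s).
Proof.
move=> [Q [hQ <- cQ]] e0; move/climP: cQ => /(_ _ e0) /nearC [r r0 hr].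
exists r => // s' /hr h.
have -> : F s' - F s - Q s * (s' - s) = (Q s' - Q s) * (s' - s) by rewrite (hQ s') /inC; ring.
by rewrite absCM ler_wpM2r ?absC_ge0 // ltW.
Qed.

Lemma taylor2 (e : R) : D zeta -> 0 < e -> exists2 r : R, 0 < r & forall s, absC (s - zeta) < r ->
  absC (N s - N1 zeta * (s - zeta) - N2 zeta / 2 * (s - zeta) ^+ 2) <= e * absC (s - zeta) ^+ 2 /\
  absC (N1 s - N1 zeta - N2 zeta * (s - zeta)) <= e * absC (s - zeta).
Proof.
move=> Dz e0; have [r1 r10 h1] := Dop Dz; have [r2 r20 h2] := first_order (dN1 Dz) e0.
exists (Num.min r1 r2) => [|s]; first by rewrite lt_min r10.
rewrite lt_min => /andP[s1 s2]; split; last exact: h2.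
pose T s := N s - N1 zeta * (s - zeta) - N2 zeta / 2 * ((s - zeta) * (s - zeta)).
pose T' s := N1 s - N1 zeta - N2 zeta * (s - zeta).
have seg (t : R) : 0 <= t <= 1 -> absC (zeta + t%:C * (s - zeta) - zeta) <= absC (s - zeta).
  move=> /andP[t0 t1]; rewrite addrC addKr absCM absC_re ger0_norm //.
  by rewrite ler_piMl ?absC_ge0.
have -> : N s - N1 zeta * (s - zeta) - N2 zeta / 2 * (s - zeta) ^+ 2 = T s - T zeta.
  by rewrite /T N0 // subrr expr2; ring.
rewrite expr2 mulrA; apply: (@segment_mean_value _ T T') => t ht.
  have hD : D (zeta + t%:C * (s - zeta)) by apply: h1; rewrite (le_lt_trans (seg t ht)).
  set u := zeta + _ in hD *.
  have hi := derB (der_id (@inC R) u) (der_cst (@inC R) zeta u).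
  have h := derB (derB (dN hD) (derZ (N1 zeta) hi))
     (derZ (N2 zeta / 2) (derM (@inC_ctn R) hi hi)).
  by apply: der_eq h; rewrite /T' /inC; field.
rewrite (le_trans (h2 _ (le_lt_trans (seg t ht) s2))) //.
by rewrite ler_pM2l // seg.
Qed.

Definition quot s := if s == zeta then N1 zeta else N s / (s - zeta).
Definition dquot s := if s == zeta then N2 zeta / 2 else (N1 s * (s - zeta) - N s) / (s - zeta) ^+ 2.

(** The singularity is removed by a Taylor expansion, in which the two derivatives of [N] yield a
    derivative of the quotient that is again continuous, as [primitive_Dom] demands. The vanishing
    of [N] at [zeta] is conditional because [zeta] may lie on a cut. *)
Lemma derC_quot s : D s -> derC quot s (dquot s).
Proof.
move=> Ds; rewrite /dquot; have [e|ne] := eqVneq s zeta; last first.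
  have nz : s - zeta != 0 by rewrite subr_eq0.
  apply: (der_near (@inC_inj R) (F := fun s => N s * (s - zeta)^-1)).
    by apply: filterS (near_neq ne) => x /negPf h; rewrite /quot h.
  have h := derM (@inC_ctn R) (dN Ds) (derC_inv nz).
  by apply: der_eq h; field.
rewrite e in Ds *; apply: derC_bound => eps eps0.
have [r r0 hr] := taylor2 Ds eps0; exists r => // s' /hr [h _].
rewrite /quot eqxx; have [->|ne] := eqVneq s' zeta; first by rewrite !subrr mulr0 subr0 absC0 mulr0.
have nz : s' - zeta != 0 by rewrite subr_eq0.
have -> : N s' / (s' - zeta) - N1 zeta - N2 zeta / 2 * (s' - zeta) =
  (N s' - N1 zeta * (s' - zeta) - N2 zeta / 2 * (s' - zeta) ^+ 2) / (s' - zeta) by field.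
by rewrite absCM absCV ler_pdivrMr ?absC_gt0 // (le_trans h) // expr2 mulrA.
Qed.

Lemma ctC_dquot s : D s -> ctC dquot s.
Proof.
move=> Ds; have [e|ne] := eqVneq s zeta; last first.
  have nz : s - zeta != 0 by rewrite subr_eq0.
  apply: (@ctn_near R (R[i]^o) (fun s => (N1 s * (s - zeta) - N s) * ((s - zeta)^-1 * (s - zeta)^-1))).
    by apply: filterS (near_neq ne) => x /negPf h; rewrite /dquot h expr2 invfM.
  apply: ctnM; last by apply: ctnM; exact: ctC_inv.
  apply: ctnB (derC_ctC (dN Ds)); apply: ctnM (derC_ctC (dN1 Ds)) _.
  by apply: ctnB; [exact: (@inC_ctn R s)|exact: ctn_cst].
rewrite e in Ds *; apply/climP => eps eps0.
have e3 : 0 < eps / 3 by rewrite divr_gt0.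
have [r r0 hr] := taylor2 Ds e3.
have /climP /(_ _ r0) := @inC_ctn R zeta; apply: filterS => x /hr [h1 h2].
rewrite /dquot eqxx; have [_|ne] := eqVneq x zeta; first by rewrite subrr absC0.
have nz : x - zeta != 0 by rewrite subr_eq0.
have a0 : 0 < absC (x - zeta) by rewrite absC_gt0.
have -> : (N1 x * (x - zeta) - N x) / (x - zeta) ^+ 2 - N2 zeta / 2 =
  ((N1 x - N1 zeta - N2 zeta * (x - zeta)) * (x - zeta) -
   (N x - N1 zeta * (x - zeta) - N2 zeta / 2 * (x - zeta) ^+ 2)) / (x - zeta) ^+ 2 by field.
rewrite absCM absCV absCX ltr_pdivrMr ?exprn_gt0 //.
rewrite (le_lt_trans (absCB _ _)) // absCM.
rewrite (le_lt_trans (lerD (ler_wpM2r (ltW a0) h2) h1)) //.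
have a2 : 0 < absC (x - zeta) ^+ 2 by rewrite exprn_gt0.
rewrite [ltLHS](_ : _ = 2 / 3 * eps * absC (x - zeta) ^+ 2); last by rewrite expr2; field.
by rewrite ltr_pM2r //; lra.
Qed.

End Quotient.

Section Columns.
Variables (R : realType) (P : nat) (rad : R) (z : 'I_P -> R[i]).
Hypothesis rad0 : 0 < rad.
Hypotheses (hzim : forall p, 0 < ImC (z p)) (hrad : forall p, absC (z p) < rad).
Hypothesis hzre : forall p q : 'I_P, (p < q)%N -> ReC (z p) < ReC (z q).
Implicit Types (s : R[i]) (p m : 'I_P) (k : nat).

Local Notation D := (Dom z).

Definition col k s := (forall p, (p < k)%N -> ReC (z p) < ReC s) /\
  (forall p, (k <= p)%N -> ReC s < ReC (z p)).

Lemma col_Re k s p : col k s -> ReC s != ReC (z p).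
Proof.
move=> [h1 h2]; case: (ltnP p k) => [/h1|/h2] h; rewrite ?(lt_eqF h) ?(gt_eqF h) //.
Qed.

Lemma off_Dom s : (forall p, ReC s != ReC (z p)) -> D 'i s /\ D (- 'i) s.
Proof.
move=> h; split; first by apply/Dom_i => p e; move: (h p); rewrite e eqxx.
by apply/(Dom_Ni hzim) => p e; move: (h p); rewrite e eqxx.
Qed.

Lemma col_Dom k s sg : rot sg -> col k s -> D sg s.
Proof.
move=> hsg h; have [h1 h2] := off_Dom (fun p => col_Re p h).
by case: hsg => ->.
Qed.

Lemma col_convex k a b (t : R) : col k a -> col k b -> 0 <= t <= 1 ->
  col k (a + t%:C * (b - a)).
Proof.
move=> [a1 a2] [b1 b2] /andP[t0 t1]; split=> p hp; rewrite !CE.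
  have := a1 p hp; have := b1 p hp; rewrite mul0r subr0.
  by case: (lerP (ReC a) (ReC b)) => h h1 h2; nra.
have := a2 p hp; have := b2 p hp; rewrite mul0r subr0.
by case: (lerP (ReC a) (ReC b)) => h h1 h2; nra.
Qed.

Lemma const_on_col (F1 F2 g1 g2 : R[i] -> R[i]) (k : R[i]) j :
  (forall s, D 'i s -> derC F1 s (g1 s)) -> (forall s, D (- 'i) s -> derC F2 s (g2 s)) ->
  (forall s, col j s -> g1 s = k * g2 s) ->
  exists kap, forall s, col j s -> F1 s = kap + k * F2 s.
Proof.
move=> h1 h2 h.
have [[s0 hs0]|ns] := pselect (exists s, col j s); last by exists 0 => s hs; case: ns; exists s.
exists (F1 s0 - k * F2 s0) => s hs.
rewrite -(@segment_constant R F1 g1 g2 k F2 s0 s); first by rewrite subrK.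
move=> t ht; have hc := col_convex hs0 hs ht.
split; first by apply: h1; apply: col_Dom hc; left.
by split; [apply: h2; apply: col_Dom hc; right|exact: h].
Qed.

(** Indices start at 0, so [m] is the number of poles to the left of [z m]: its left neighbours are
    in column [m], its right ones in column [m + 1]. *)
Lemma near_col m : (\forall t \near 0^'+, col m (z m + - 1 * t%:C)) /\
  (\forall t \near 0^'+, col m.+1 (z m + 1 * t%:C)).
Proof.
have [d [d0 _ [_ h]]] := near_ok_exists hzim hzre m ltr01.
have lt_ p : (p < m)%N -> ReC (z p) <= ReC (z m) - d.
  move=> hp; have := h p _; rewrite -(inj_eq val_inj) neq_ltn hp => /(_ isT).
  by rewrite ltr0_norm ?subr_lt0 ?hzre //; lra.
have gt_ p : (m < p)%N -> ReC (z m) + d <= ReC (z p).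
  move=> hp; have := h p _; rewrite -(inj_eq val_inj) neq_ltn hp orbT => /(_ isT).
  by rewrite gtr0_norm ?subr_gt0 ?hzre //; lra.
have eq_ p : (p == m :> nat) -> ReC (z p) = ReC (z m) by move=> /eqP /val_inj ->.
have small : \forall t \near (0 : R)^'+, 0 < t < d.
  near=> t; apply/andP; split; first by near: t; exact: nbhs_right_gt.
  by near: t; exact: nbhs_right_lt.
split; apply: filterS small => t /andP[t0 td]; split=> p hp; rewrite !CE.
- by have := lt_ p hp; lra.
- move: hp; rewrite leq_eqVlt eq_sym => /orP[/eq_ ->|/gt_]; lra.
- move: hp; rewrite ltnS leq_eqVlt => /orP[/eq_ ->|/lt_]; lra.
- by have := gt_ p hp; lra.
Unshelve. all: by end_near. Qed.

(** The limits at the pole do not depend on the approach, so the relation valid in an adjacent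
    column can be read at the pole, along a horizontal segment inside that column. *)
Lemma col_pole_value (F1 F2 : R[i] -> R[i]) (l1 l2 kap k e : R[i]) m j (a : R) : 0 < a ->
  pole_bound z 'i m (fun s => F1 s - l1) a -> pole_bound z (- 'i) m (fun s => F2 s - l2) a ->
  absC e = 1 -> (\forall t \near 0^'+, col j (z m + e * t%:C)) ->
  (forall s, col j s -> F1 s = kap + k * F2 s) -> l1 = kap + k * l2.
Proof.
move=> a0 h1 h2 e1 hc h; have hg := clim_ray e1 (@inC_ctn R (z m)).
have /(_ _ _) c1 := lim_at_pole rot_i a0 h1 hg (filterS (fun t => col_Dom rot_i) hc).
have /(_ _ _) c2 := lim_at_pole rot_Ni a0 h2 hg (filterS (fun t => col_Dom rot_Ni) hc).
apply: (clim_unique c1); apply: clim_near (climD (clim_cst kap) (climM (clim_cst k) c2)).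
by apply: filterS hc => t /h.
Qed.

Section Cauchy.
Variables (H1 H1' H2 H2' : R[i] -> R[i]) (K : R).
Hypotheses (dH1 : forall s, D 'i s -> derC H1 s (H1' s)) (cH1 : forall s, D 'i s -> ctC H1' s).
Hypotheses (dH2 : forall s, D (- 'i) s -> derC H2 s (H2' s)) (cH2 : forall s, D (- 'i) s -> ctC H2' s).
Hypothesis agree : forall s, (forall p, ReC s != ReC (z p)) -> H1 s = H2 s.
Hypothesis pb1 : forall m, pole_bound z 'i m H1 (- (1 / 2)).
Hypothesis pb2 : forall m, pole_bound z (- 'i) m H2 (- (1 / 2)).
Variable far : R.
Hypothesis decay : forall s, D (- 'i) s -> far <= mu s -> absC (H2 s) <= K / mu s ^+ 2.

(** On each column [Q1 - Q2] is constant. A singularity of order [-1/2] leaves both primitives with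
    limits at [z m], common to the columns on either side of it, and this forces the two constants
    to be equal. *)
Let jump0 (Q1 Q2 : R[i] -> R[i]) : (forall s, D 'i s -> derC Q1 s (H1 s)) ->
  (forall s, D (- 'i) s -> derC Q2 s (H2 s)) -> exists kap, forall k, (k <= P)%N ->
  forall s, col k s -> Q1 s = kap + 1 * Q2 s.
Proof.
move=> dQ1 dQ2.
have cc j : exists kap, forall s, col j s -> Q1 s = kap + 1 * Q2 s.
  apply: (const_on_col dQ1 dQ2) => x hx; rewrite mul1r.
  by apply: agree => p; exact: col_Re hx.
have [kap hkap] := choice cc; exists (kap 0%N) => k hk s hs; rewrite (hkap k s hs); congr (_ + _).
elim: k hk {s hs} => // k IH hk; rewrite -(IH (ltnW hk)).
pose m : 'I_P := Ordinal hk.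
have e : - (1 / 2) + 1 = 1 / 2 :> R by field.
have h2 : 0 < 1 / 2 :> R by rewrite divr_gt0.
have [l1 b1] := pole_limit hzim hzre rot_i dQ1 e h2 (pb1 m).
have [l2 b2] := pole_limit hzim hzre rot_Ni dQ2 e h2 (pb2 m).
have [n1 n2] := near_col m.
have q1 : l1 = kap k + 1 * l2.
  by apply: (col_pole_value h2 b1 b2 _ n1 (hkap k)); rewrite absCN absC1.
have q2 := col_pole_value h2 b1 b2 (absC1 R) n2 (hkap k.+1).
by apply: (addIr (1 * l2)); rewrite -q1 -q2.
Qed.

Lemma cauchy_half_plane : clim +oo (fun A : R => integralC `[- A, A] (fun x => H1 x%:C)) 0.
Proof.
have [Q1 dQ1] := primitive_Dom hzim hrad rot_i dH1 cH1.
have [Q2 dQ2] := primitive_Dom hzim hrad rot_Ni dH2 cH2.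
have rez p : `|ReC (z p)| < rad by exact: le_lt_trans (ReC_le _) (hrad p).
have low (A : R) (y : R) : rad <= A -> col 0 (pnt (- A) y) /\ col P (pnt A y).
  move=> hA; split; split=> p hp; rewrite ?ReC_pnt.
  - by rewrite ltn0 in hp.
  - by have := rez p; rewrite ltr_norml; lra.
  - by have := rez p; rewrite ltr_norml; lra.
  - by rewrite leqNgt ltn_ord in hp.
(* The detour through the upper half-plane has two vertical sides of length [A] and a top of length
   [2 * A], and [H2] is at most [K / A ^+ 2] on it. *)
apply: (@clim_norm0 R _ _ _ _ _ (fun A => 4 * K * A^-1)).
  near=> A; rewrite subr0.
  have hA : rad <= A by near: A; apply: nbhs_pinfty_ge; rewrite num_real.
  have hA' : far <= A by near: A; apply: nbhs_pinfty_ge; rewrite num_real.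
  have A0 : 0 < A by exact: lt_le_trans rad0 hA.
  rewrite (@integralC_FTC R (fun x => Q1 x%:C)); last 3 first.
  - by lra.
  - move=> t _; have h := der_comp1 (dQ1 _ (real_Dom hzim t)) (der_id (@inR R) t).
    by apply: der_eq h; rewrite mulr1.
  - by move=> t _; apply: (ctn_comp (derC_ctC (dH1 (real_Dom hzim t)))); exact: inR_ctn.
  have r0 x : x%:C = pnt x 0 by rewrite /pnt mulr0 addr0.
  have [c0 cP] := low A 0 hA.
  (* The points [- A] and [A] lie in the extreme columns [0] and [P], where the constant is the
     same. Passing to the second sheet is necessary because the top of the rectangle crosses the
     upward cuts. *)
  have -> : Q1 A%:C - Q1 (- A)%:C = Q2 A%:C - Q2 (- A)%:C.
    have [kap h] := jump0 dQ1 dQ2.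
    by rewrite !r0 (h 0%N (leq0n P) _ c0) (h P (leqnn P) _ cP); ring.
  have B s : D (- 'i) s -> A <= mu s -> absC (H2 s) <= K / A ^+ 2.
    move=> hD hm; have h := decay hD (le_trans hA' hm).
    have m0 : 0 < mu s by exact: lt_le_trans A0 hm.
    have K0 : 0 <= K.
      have := le_trans (absC_ge0 _) h; rewrite pmulr_lge0 // invr_gt0 exprn_gt0 //.
    rewrite (le_trans h) // ler_wpM2l // lef_pV2 ?posrE ?exprn_gt0 //.
    by rewrite ler_sqr ?nnegrE ?(ltW A0) ?(ltW m0).
  have side (a : R) : `|a| = A -> (forall y, D (- 'i) (pnt a y)) ->
      absC (Q2 (pnt a A) - Q2 (pnt a 0)) <= K / A ^+ 2 * A.
    move=> ha hD; have := @mean_value_cst R (fun y => Q2 (pnt a y)) (fun y => H2 (pnt a y) * 'i) (K / A ^+ 2) 0 A (ltW A0).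
    rewrite subr0; apply=> y hy; first exact: (der_comp1 (dQ2 _ (hD y)) (derR_ver a y)).
    by rewrite absCM absCi mulr1; apply: B => //; rewrite /mu ReC_pnt le_max ha lexx.
  have s1 := side A ltac:(by rewrite gtr0_norm) (fun y => col_Dom rot_Ni (low A y hA).2).
  have s2 := side (- A) ltac:(by rewrite normrN gtr0_norm) (fun y => col_Dom rot_Ni (low A y hA).1).
  have s3 : absC (Q2 (pnt A A) - Q2 (pnt (- A) A)) <= K / A ^+ 2 * (A - (- A)).
    have hD x : D (- 'i) (pnt x A) by exact: (Dom_Ni_high hzim hrad).
    apply: (@mean_value_cst R (fun x => Q2 (pnt x A)) (fun x => H2 (pnt x A) * 1)) => [|x _|x _]; first lra.
      by apply: der_comp1 (derR_hor A x); exact: dQ2.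
    by rewrite mulr1; apply: B => //; rewrite /mu ImC_pnt le_max lexx orbT.
  rewrite !r0.
  have -> : Q2 (pnt A 0) - Q2 (pnt (- A) 0) = (Q2 (pnt A A) - Q2 (pnt (- A) A)) +
     ((Q2 (pnt (- A) A) - Q2 (pnt (- A) 0)) - (Q2 (pnt A A) - Q2 (pnt A 0))) by ring.
  rewrite (le_trans (absCD _ _)) // (le_trans (lerD (lexx _) (absCB _ _))) //.
  rewrite (le_trans (lerD s3 (lerD s2 s1))) //.
  by rewrite [leLHS](_ : _ = 4 * K * A^-1) //; field; rewrite gt_eqF.
rewrite -(mulr0 (4 * K)); apply: cvgM; first exact: cvg_cst.
by apply/gtr0_cvgV0; [near=> A; near: A; apply: nbhs_pinfty_gt; rewrite num_real|exact: cvg_id].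
Unshelve. all: by end_near. Qed.

End Cauchy.

End Columns.

(** * The solution on the two sheets *)

Section Sheets.
Variables (R : realType) (P : nat) (eps lambda rad : R) (c z : 'I_P -> R[i]).
Hypotheses (heps : 0 < eps) (hlambda : lambda < 0) (rad0 : 0 < rad).
Hypotheses (hzim : forall p, 0 < ImC (z p)) (hrad : forall p, absC (z p) < rad).
Hypothesis hzre : forall p q : 'I_P, (p < q)%N -> ReC (z p) < ReC (z q).
Implicit Types (s : R[i]) (p m : 'I_P) (k : nat) (ph : 'I_P -> R[i]).

Local Notation D := (Dom z).
Local Notation E := (EE eps lambda c z).
Local Notation itg ph := (integrand eps lambda c z ph).
Local Notation al := (alp eps c).

Lemma cos_2pi_eq1 (a : R) : 0 < a -> cos (2 * pi * a) = 1 -> exists n : nat, a = n.+1%:R.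
Proof.
move=> a0 h; have /truncn_itv := ltW a0; set n := Num.truncn a => /andP[n1 n2].
pose t := a - n%:R.
have e : 2 * pi * a = (pi * t) *+ 2 + (pi *+ 2) *+ n.
  by rewrite /t mulr2n -[_ *+ n]mulr_natr mulr2n; ring.
have := periodicn (@cosD2pi R) n ((pi * t) *+ 2); rewrite -e h => h1.
have t0 : t = 0.
  apply/eqP; apply: contraTT isT => tn.
  have tp : 0 < t by rewrite lt_def tn /t subr_ge0.
  have t1 : t < 1 by rewrite /t ltrBlDr addrC natr1.
  have : 0 < sin (pi * t).
    by apply: sin_gt0_pi; rewrite mulr_gt0 ?pi_gt0 // -[ltRHS]mulr1 ltr_pM2l ?pi_gt0.
  have := sin2cos2 (pi * t); have := cos_mulr2n (pi * t); rewrite -h1 !mulr2n => e1 e2.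
  have : sin (pi * t) ^+ 2 = 0 by lra.
  by move/eqP; rewrite sqrf_eq0 => /eqP ->; rewrite ltxx.
have an : a = n%:R by apply/eqP; rewrite -subr_eq0 -/t t0.
by case: n {n1 n2 e t0 h1} t an => [|n] _ an; [rewrite an ltxx in a0|exists n].
Qed.

(** The quotient of the two determinations of [E] in column [k]: turning the cut of [z p] changes
    its logarithm by [pi i] to the right of the pole and by [- pi i] to the left. *)
Definition Dk k : R[i] := expC (- ('i / eps%:C) *
  \sum_p (c p * (if (p < k)%N then pi *i else - (pi *i)))).

Lemma Dk_neq0 k : Dk k != 0. Proof. exact: expC_neq0. Qed.

Lemma EE_col k s : col z k s -> E 'i s = Dk k * E (- 'i) s.
Proof.
move=> [h1 h2]; rewrite /EE /Dk -expCD -mulrDr; congr (expC (_ * _)).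
rewrite /expo [RHS]addrC -addrA; congr (_ + _).
rewrite -big_split /=; apply: eq_bigr => p _.
rewrite -addrA [_ + c p * _]addrC addrA -mulrDr; congr (c p * _ + _).
have [hp|hp] := ltnP p k.
  have h : 0 < ImC ('i * (s - z p)) by rewrite !CE; have := h1 p hp; lra.
  by rewrite [- 'i * _]mulNr (LogC_opp h); ring.
have h : 0 < ImC (- 'i * (s - z p)) by rewrite !CE; have := h2 p hp; lra.
have -> : 'i * (s - z p) = - (- 'i * (s - z p)) by rewrite mulNr opprK.
by rewrite (LogC_opp h) addrC.
Qed.

Lemma jump m : Dk m.+1 = Dk m * expC ((2 * pi)%:C * (c m / eps%:C)).
Proof.
have e0 : eps%:C != 0 by rewrite real_neq0 gt_eqF.
rewrite /Dk -expCD; congr expC.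
rewrite (bigD1 m) //= [in RHS](bigD1 m) //= ltnSn ltnn.
have -> : \sum_(p | p != m) c p * (if (p < m.+1)%N then pi *i else - (pi *i)) =
  \sum_(p | p != m) c p * (if (p < m)%N then pi *i else - (pi *i)).
  by apply: eq_bigr => p pm; rewrite ltnS leq_eqVlt (inj_eq val_inj) (negPf pm).
have pe : pi *i = pi%:C * 'i :> R[i] by apply: complex_eq; rewrite !CE /=; ring.
have i2 := mulii R; rewrite rmorphM /= pe.
set S := \sum_(_ | _) _.
apply/eqP; rewrite -subr_eq0; apply/eqP.
transitivity (- (2 * pi%:C * (c m / eps%:C)) * ('i * 'i + 1)); first by field.
by rewrite i2 addNr mulr0.
Qed.

Lemma exceptional_alp m : exceptional eps c m -> 0 < al m /\ Dk m.+1 = Dk m.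
Proof.
move=> [n hn]; have e : c m / eps%:C = 'i * n.+1%:R.
  have -> : c m / eps%:C = - 'i * ('i * c m / eps%:C) by rewrite !mulrA mulNr mulii opprK mul1r.
  by rewrite hn mulrNN.
have ea : al m = n.+1%:R.
  rewrite /alp -ImC_div e -(rmorph_nat (real_complex R)) !CE; ring.
split; first by rewrite ea ltr0n.
rewrite jump e; have -> : expC ((2 * pi : R)%:C * ('i * n.+1%:R)) = 1; last by rewrite mulr1.
have -> : (2 * pi : R)%:C * ('i * n.+1%:R) = 0 +i* ((pi *+ 2) *+ n.+1) :> R[i].
  rewrite -(rmorph_nat (real_complex R)) -[pi *+ 2 *+ _]mulr_natr.
  by move: (n.+1%:R : R) => r; apply: complex_eq; rewrite !CE /= ?mulr2n; ring.
rewrite /expC /= expR0 mul1r.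
have := periodicn (@cosD2pi R) n.+1 0; rewrite add0r cos0 => ->.
by have := periodicn (@sinD2pi R) n.+1 0; rewrite add0r sin0 => ->.
Qed.

(** The jump is [exp (2 pi c_m / eps)]. If it equals 1, its modulus makes [c_m / eps] purely
    imaginary and its argument makes the imaginary part an integer, positive by hypothesis. With
    [exceptional_alp], this characterizes the exceptional poles among those with [alp m > 0]. *)
Lemma jump_exceptional m : 0 < al m -> Dk m.+1 = Dk m -> exceptional eps c m.
Proof.
move=> a0; rewrite jump -[RHS]mulr1 => /(mulfI (Dk_neq0 m)) h.
set w := c m / eps%:C in h.
have hw : (2 * pi)%:C * w = (2 * pi * ReC w) +i* (2 * pi * ImC w).
  by apply: complex_eq; rewrite !CE /=; ring.
have iw : ImC w = al m by rewrite /w ImC_div.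
have r0 : ReC w = 0.
  have := congr1 (@absC R) h; rewrite absC1 absC_expC hw /= => /(congr1 (@ln R)).
  rewrite expRK ln1 => /eqP; rewrite !mulf_eq0 pnatr_eq0 /= gt_eqF ?pi_gt0 //=.
  by move/eqP.
have : cos (2 * pi * al m) = 1.
  have := congr1 (@ReC R) h; rewrite hw /expC r0 mulr0 iw !CE /= expR0; lra.
move/(cos_2pi_eq1 a0) => [n hn]; exists n.
rewrite -mulrA -/w [w]complexRI r0 add0r iw hn mulrA mulii mulN1r.
by rewrite rmorph_nat.
Qed.

(* A primitive of the integrand on each of the two sheets, normalized on the
   second one by its decay at [i oo]; [kap k] is then the limit of the first
   one at [i oo] in the column [k]. *)
Definition sheet ph F Fh (kap : nat -> R[i]) (K : R) :=
  [/\ 0 < K, forall s, D 'i s -> derC F s (itg ph 'i s),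
      forall s, D (- 'i) s -> derC Fh s (itg ph (- 'i) s),
      forall s, D (- 'i) s -> 4 * rad <= mu s ->
        absC (Fh s) <= K / mu s * expR (lambda * ImC s / eps) &
      forall k s, col z k s -> F s = kap k + Dk k * Fh s].

Lemma sheet_exists ph : exists F Fh kap K, sheet ph F Fh kap K.
Proof.
have [Fh [K [K0 dFh hb]]] := normalized_primitive c ph heps hlambda rad0 hzim hrad.
have [F dF] := primitive_Dom hzim hrad rot_i
  (fun s hs => derC_integrand eps lambda c ph rot_i hs)
  (fun s hs => ctC_dintegrand eps lambda c ph rot_i hs).
have H k : exists kap, forall s, col z k s -> F s = kap + Dk k * Fh s.
  apply: (const_on_col hzim dF dFh) => s hs.
  by rewrite /integrand (EE_col hs) mulrA.
have [kap hkap] := choice H.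
by exists F, Fh, kap, K.
Qed.

Section OneSheet.
Variables (ph : 'I_P -> R[i]) (F Fh : R[i] -> R[i]) (kap : nat -> R[i]) (K : R).
Hypothesis sh : sheet ph F Fh kap K.

(** As [lambda < 0], the bound on [Fh] deteriorates exponentially downwards, so the imaginary part
    has to stay bounded below. With this proviso the ends at [i oo] and the end at the left of the
    real axis are treated alike, and both kinds of starting points in column 0 give [kap 0]. *)
Lemma sheet_lim (T : Type) (Fi : set_system T) {FF : Filter Fi} (gam : T -> R[i]) k :
  (\forall t \near Fi, col z k (gam t)) -> mu (gam t) @[t --> Fi] --> +oo ->
  (exists M : R, \forall t \near Fi, - M <= ImC (gam t)) ->
  clim Fi (fun t => F (gam t)) (kap k).
Proof.
have [K0 dF dFh hb rel] := sh => hc hmu [M hM].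
have h0 : clim Fi (fun t => Fh (gam t)) 0.
  apply: (@clim_norm0 R _ _ _ _ _ (fun t => K * expR (- lambda * M / eps) * (mu (gam t))^-1)).
    near=> t; rewrite subr0.
    have h1 : col z k (gam t) by near: t.
    have h2 : 4 * rad <= mu (gam t) by near: t; move/cvgryPge: hmu; apply.
    have h3 : - M <= ImC (gam t) by near: t.
    have m0 := far_pos rad0 h2.
    rewrite (le_trans (hb _ (col_Dom hzim rot_Ni h1) h2)) //.
    rewrite mulrAC ler_pM2r ?invr_gt0 // ler_pM2l // ler_expR ler_pM2r ?invr_gt0 //.
    by rewrite mulNr -mulrN ler_nM2l.
  rewrite -(mulr0 (K * expR (- lambda * M / eps))); apply: cvgM; first exact: cvg_cst.
  by apply/gtr0_cvgV0 => //; near=> t; near: t; move/cvgryPgt: hmu; apply.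
have h : clim Fi (fun t => kap k + Dk k * Fh (gam t)) (kap k + Dk k * 0).
  by apply: climD; [exact: clim_cst|apply: climM => //; exact: clim_cst].
rewrite mulr0 addr0 in h; apply: clim_near h.
by apply: filterS hc => t /rel.
Unshelve. all: by end_near. Qed.

Lemma cvg_mu_Im (T : Type) (Fi : set_system T) {FF : Filter Fi} (gam : T -> R[i]) :
  ImC (gam t) @[t --> Fi] --> +oo -> mu (gam t) @[t --> Fi] --> +oo.
Proof.
move=> /cvgryPge h; apply/cvgryPge => A; apply: filterS (h A) => t ht.
by rewrite /mu le_max ht orbT.
Qed.

Lemma sheet_start gam : starts_at_iinfty_in (Gsub z rad 0) gam ->
  clim -oo (fun t => F (gam t)) (kap 0).
Proof.
move=> [h1 h2]; apply: sheet_lim.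
- by apply: filterS h2 => t; rewrite inE; case.
- exact: cvg_mu_Im.
- exists 0; move/cvgryPge: h1 => /(_ 0); apply: filterS => t; by rewrite oppr0.
Qed.

Lemma sheet_end k gam : ends_at_iinfty_in (Gsub z rad k) gam ->
  clim +oo (fun t => F (gam t)) (kap k).
Proof.
move=> [h1 h2]; apply: sheet_lim.
- by apply: filterS h2 => t; rewrite inE; case.
- exact: cvg_mu_Im.
- exists 0; move/cvgryPge: h1 => /(_ 0); apply: filterS => t; by rewrite oppr0.
Qed.

Lemma sheet_start_minfty gam : starts_at_minfty gam ->
  clim -oo (fun t => F (gam t)) (kap 0).
Proof.
move=> [h1 [M h2]]; apply: sheet_lim.
- move/cvgrNyPle: h1 => /(_ (- rad)); apply: filterS => t ht; split=> p // _.
  have := ReC_le (z p); have := hrad p; rewrite ler_norml; lra.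
- move/cvgrNyPle: h1 => h1; apply/cvgryPge => A; apply: filterS (h1 (- A)) => t ht.
  rewrite /mu le_max; apply/orP; left.
  by rewrite -normrN (le_trans _ (ler_norm _)) //; lra.
- by exists M; apply: filterS h2 => t; rewrite ler_norml => /andP[].
Qed.

(** When [E] vanishes at [z m], both primitives have values there, and the two adjacent columns give
    two linear relations between them. These connection formulas are all that is used to pass a
    pole. *)
Lemma pole_values m : 0 < al m -> exists l l' : R[i],
  [/\ l = kap m + Dk m * l', l = kap m.+1 + Dk m.+1 * l',
    pole_bound z 'i m (fun s => F s - l) (al m) & pole_bound z (- 'i) m (fun s => Fh s - l') (al m)].
Proof.
have [K0 dF dFh hb rel] := sh => a0.
have bi sg (h : rot sg) := pole_bound_integrand eps lambda c ph hzim hzre m h.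
have [l b1] := pole_limit hzim hzre rot_i dF (subrK _ _) a0 (bi _ rot_i).
have [l' b2] := pole_limit hzim hzre rot_Ni dFh (subrK _ _) a0 (bi _ rot_Ni).
have [n1 n2] := near_col hzim hzre m.
exists l, l'; split=> //.
- by apply: (col_pole_value hzim a0 b1 b2 _ n1 (rel m)); rewrite absCN absC1.
- exact: (col_pole_value hzim a0 b1 b2 (absC1 R) n2 (rel m.+1)).
Qed.

Lemma contour_end_at_pole m l gam : 0 < al m -> pole_bound z 'i m (fun s => F s - l) (al m) ->
  contour_in (G z) gam -> ends_at gam (z m) -> clim +oo (fun t => F (gam t)) l.
Proof.
move=> a0 h [hG _ _ _] he; apply: (lim_at_pole rot_i a0 h); first by rewrite climE.
by apply: nearW => t; apply/(G_Dom z); have := hG t; rewrite inE.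
Qed.

Lemma ctn_along (H : R[i] -> R[i]) (T : Type) (Fi : set_system T) {FF : Filter Fi}
  (gam : T -> R[i]) s0 : clim Fi gam s0 -> ctC H s0 -> clim Fi (fun t => H (gam t)) (H s0).
Proof. by rewrite /ctC /ctn !climE => h1 h2 A hA; exact: (h1 _ (h2 _ hA)). Qed.

End OneSheet.

(** Linearity of an improper integral needs the convergence of each term, here supplied by
    primitives with limits at both ends. *)
Lemma contour_integral_sum D0 gam (g F : 'I_P -> R[i] -> R[i]) (l0 l1 a : 'I_P -> R[i]) :
  contour_in D0 gam -> (forall p s, D0 s -> derC (F p) s (g p s)) ->
  (forall p s, D0 s -> ctC (g p) s) ->
  (forall p, clim -oo (fun t => F p (gam t)) (l0 p)) ->
  (forall p, clim +oo (fun t => F p (gam t)) (l1 p)) ->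
  contour_integral gam (fun s => \sum_p a p * g p s) = \sum_p a p * contour_integral gam (g p).
Proof.
move=> hg dF cg h0 h1.
rewrite (@contour_integralE R D0 gam _ (fun s => \sum_p a p * F p s) (\sum_p a p * l0 p) (\sum_p a p * l1 p)) //.
- rewrite -sumrB; apply: eq_bigr => p _.
  by rewrite (@contour_integralE R D0 gam (g p) (F p) (l0 p) (l1 p)) //; [ring|exact: dF|exact: cg].
- by move=> s hs; apply: derC_sum => p; apply: derZ; exact: dF.
- by move=> s hs; apply: ctn_sum => p; apply: ctnZ; exact: cg.
- by apply: clim_sum => p; exact: climZ.
- by apply: clim_sum => p; exact: climZ.
Qed.

End Sheets.

(** * Consequences of the null vector *)

Section Package.
Variables (R : realType) (P : nat) (eps : R) (c z : 'I_P -> R[i])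
    (rad lambda : R) (C : 'I_P -> R -> R[i]) (L : R -> R -> R[i]) (phi : 'cV[R[i]]_P).
Hypotheses (heps : 0 < eps) (hlambda : lambda < 0) (rad0 : 0 < rad).
Hypotheses (hzim : forall p, 0 < ImC (z p)) (hrad : forall p, absC (z p) < rad).
Hypothesis hzre : forall p q : 'I_P, (p < q)%N -> ReC (z p) < ReC (z q).
Hypothesis hC : forall m, Ccontour eps c z rad m (C m).
Hypothesis hL : forall x : R, Phi_contour z rad x (L x).
Hypothesis hphi : Amatrix eps c z C lambda *m phi = 0.
Implicit Types (s : R[i]) (p m : 'I_P) (k : nat).

Local Notation D := (Dom z).
Local Notation E := (EE eps lambda c z).
Local Notation itg ph := (integrand eps lambda c z ph).
Local Notation al := (alp eps c).
Local Notation ph := (fun p => phi p 0).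

(** The exponential of the constants [+- pi i / 2] in [f]. It multiplies the entries of [A] without
    affecting the null vectors, and cancels between the two exponentials of [Phi]. *)
Definition branch_factor : R[i] := expC (- ('i / eps%:C) *
  \sum_p (c p * ((pi / 2)%:C * 'i) - (c p)^*%R * ((pi / 2)%:C * 'i))).
Local Notation k0 := branch_factor.

Lemma exp_h s : expC (- 'i * h c z lambda s / eps%:C) = k0 * E 'i s.
Proof.
rewrite /branch_factor /EE -expCD -mulrDr; congr expC.
have -> : - 'i * h c z lambda s / eps%:C = - ('i / eps%:C) * h c z lambda s by ring.
congr (_ * _).
rewrite /h /f /expo [RHS]addrC -addrA; congr (_ + _).
rewrite -big_split /=; apply: eq_bigr => p _; ring.
Qed.

Lemma exp_hV s : expC ('i * h c z lambda s / eps%:C) = (k0 * E 'i s)^-1.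
Proof. by rewrite -exp_h -expCN; congr expC; rewrite !mulNr opprK. Qed.

Lemma k0_neq0 : k0 != 0. Proof. exact: expC_neq0. Qed.

Lemma C_ok m : contour_in (G z) (C m) /\ starts_at_iinfty_in (Gsub z rad 0) (C m).
Proof.
have [h1 h2] := hC m; have [ex|nex] := pselect (exceptional eps c m).
  by have [] := h1 ex.
by have [] := h2 nex.
Qed.

Lemma G_D s : G z s -> D 'i s. Proof. by move/G_Dom. Qed.

Section WithSheet.
Variables (F Fh : R[i] -> R[i]) (kap : nat -> R[i]) (K : R).
Hypothesis sh : sheet eps lambda rad c z ph F Fh kap K.

Lemma end_limit (ph' : 'I_P -> R[i]) F' Fh' kap' K' m :
  sheet eps lambda rad c z ph' F' Fh' kap' K' -> exists l, clim +oo (fun t => F' (C m t)) l.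
Proof.
move=> sh'; have [h1 h2] := hC m; have [ex|nex] := pselect (exceptional eps c m).
  have [a0 _] := exceptional_alp heps ex.
  have [l [_ [_ _ hl _]]] := pole_values hzim hzre sh' a0.
  by have [i1 _ i3] := h1 ex; exists l; exact: (contour_end_at_pole a0 hl i1 i3).
by have [_ _ i3] := h2 nex; exists (kap' m.+1); exact: (sheet_end heps hlambda rad0 hzim sh' i3).
Qed.

(* The row of index [m] of the system [A phi = 0]. *)
Lemma null_end m l : clim +oo (fun t => F (C m t)) l -> l = kap 0.
Proof.
move=> hl; have [hG hs] := C_ok m.
(* An entry of [A] is the integral for a unit vector of coefficients; the sheet of that vector
   provides its convergence, after which the row can be summed. *)
pose delta p : 'I_P -> R[i] := fun q => if q == p then 1 else 0.
have [Fs hF] := choice (fun p => sheet_exists c heps hlambda rad0 hzim hrad (delta p)).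
pose g p s := expC (- 'i * h c z lambda s / eps%:C) / (s - z p).
have gE p s : g p s = k0 * itg (delta p) 'i s.
  rewrite /g exp_h /integrand -mulrA; congr (_ * (_ * _)).
  rewrite /SS (bigD1 p) //= big1 ?addr0; first by rewrite /delta eqxx mul1r.
  by move=> q /negPf qp; rewrite /delta qp mul0r.
have gD p s : G z s -> derC (fun s => k0 * Fs p s) s (g p s).
  move=> /G_D hD; rewrite gE; apply: derZ.
  by have [Fh' [kap' [K' [_ dF' _ _ _]]]] := hF p; exact: dF'.
have gc p s : G z s -> ctC (g p) s.
  move=> /G_D hD; rewrite (_ : g p = fun s => k0 * itg (delta p) 'i s); last exact/funext/gE.
  apply: ctnZ.
  exact: derC_ctC (derC_integrand eps lambda c (delta p) rot_i hD).
have h0 p : exists l, clim -oo (fun t => k0 * Fs p (C m t)) l.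
  have [Fh' [kap' [K' sh']]] := hF p; exists (k0 * kap' 0%N).
  apply: climZ.
  exact: (sheet_start heps hlambda rad0 hzim sh' hs).
have h1 p : exists l, clim +oo (fun t => k0 * Fs p (C m t)) l.
  have [Fh' [kap' [K' sh']]] := hF p; have [l' hl'] := end_limit m sh'; exists (k0 * l').
  by apply: climZ.
have [l0 hl0] := choice h0; have [l1 hl1] := choice h1.
have e1 := @contour_integral_sum R P (G z) (C m) g (fun p s => k0 * Fs p s) l0 l1 ph hG gD gc hl0 hl1.
have : contour_integral (C m) (fun s => \sum_p phi p 0 * g p s) = k0 * l - k0 * kap 0.
  have gS s : \sum_p phi p 0 * g p s = k0 * itg ph 'i s.
    rewrite /integrand mulrA -exp_h /SS mulr_sumr; apply: eq_bigr => p _.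
    by rewrite /g mulrCA.
  apply: (@contour_integralE R (G z) (C m) _ (fun s => k0 * F s)) => //.
  - move=> s /G_D hD; rewrite gS; apply: derZ.
    by have [_ dF _ _ _] := sh; exact: dF.
  - by move=> s hs'; apply: ctn_sum => p; apply: ctnZ; exact: gc.
  - apply: climZ.
    exact: (sheet_start heps hlambda rad0 hzim sh hs).
  - by apply: climZ.
rewrite e1 => e2.
have e3 : \sum_p phi p 0 * contour_integral (C m) (g p) = 0.
  have := congr1 (fun M : 'cV[R[i]]_P => M m 0) hphi; rewrite !mxE => e3.
  by rewrite -[RHS]e3; apply: eq_bigr => p _; rewrite mxE mulrC.
move: e2; rewrite e3 -mulrBr => /esym/eqP; rewrite mulf_eq0 (negPf k0_neq0) /= subr_eq0.
by move/eqP.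
Qed.

(** At a non-exceptional pole, the row of [A] states that the limit at [i oo] just right of the pole
    is [kap 0]. At an exceptional one the factor [Dk] does not jump, and the two relations of
    [pole_values] give equality of neighbours by themselves. *)
Lemma kap_const k : (k <= P)%N -> kap k = kap 0.
Proof.
elim: k => // k IH hk; pose m : 'I_P := Ordinal hk.
have [h1 h2] := hC m; have [ex|nex] := pselect (exceptional eps c m).
  have [a0 eD] := exceptional_alp heps ex.
  have [l [l' [e1 e2 _ _]]] := pole_values hzim hzre sh a0.
  rewrite -(IH (ltnW hk)); apply: (addIr (Dk eps c m * l')).
  by rewrite -e1 e2 eD.
have [_ _ i3] := h2 nex; apply: null_end (sheet_end heps hlambda rad0 hzim sh i3).
Qed.

(** At an exceptional pole the row of [A] says that [l] is [kap 0]. Elsewhere subtracting the two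
    relations of [pole_values] leaves a nonzero jump times [l'], so that [l'] vanishes. Either way
    the remaining value follows from one relation. *)
Lemma pole_bounds m : 0 < al m ->
  pole_bound z 'i m (fun s => F s - kap 0) (al m) /\ pole_bound z (- 'i) m (fun s => Fh s - 0) (al m).
Proof.
move=> a0; have [l [l' [e1 e2 b1 b2]]] := pole_values hzim hzre sh a0.
have D0 := Dk_neq0 eps c m.
rewrite (kap_const (ltnW (ltn_ord m))) in e1; rewrite (kap_const (ltn_ord m)) in e2.
have l0 : l = kap 0.
  have [ex|nex] := pselect (exceptional eps c m).
    have [h1 _] := hC m; have [i1 _ i3] := h1 ex.
    exact: null_end (contour_end_at_pole a0 b1 i1 i3).
  have /eqP : (Dk eps c m.+1 - Dk eps c m) * l' = 0.
    rewrite mulrBl; apply/eqP; rewrite subr_eq0; apply/eqP.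
    by apply: (addrI (kap 0)); rewrite -e1 -e2.
  rewrite mulf_eq0 subr_eq0 => /orP[/eqP /(jump_exceptional heps a0)//|/eqP l'0].
  by rewrite e1 l'0 mulr0 addr0.
have l'0 : l' = 0.
  have /eqP := e1; rewrite l0 -[X in X == _]addr0 => /eqP /addrI /esym /eqP.
  by rewrite mulf_eq0 (negPf D0) /= => /eqP.
by rewrite -l0; split=> //; rewrite -l'0.
Qed.

Lemma PhiE x : Phi eps c z L lambda phi x = sol eps lambda c z 'i F (kap 0) x%:C.
Proof.
have [_ dF _ _ _] := sh; have [hG hst hend] := hL x.
have hx := real_Dom hzim x.
rewrite /Phi exp_hV.
rewrite (@contour_integralE R (G z) (L x) _ (fun s => k0 * F s) (k0 * kap 0) (k0 * F x%:C)) //.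
- rewrite /sol; have := k0_neq0; have E0 : E 'i x%:C != 0 by exact: expC_neq0.
  have e0 : eps%:C != 0 by rewrite real_neq0 gt_eqF.
  by move=> k00; field; rewrite k00 E0 e0.
- move=> s /G_D hD; rewrite exp_h -mulrA; apply: derZ.
  exact: dF.
- move=> s /G_D hD; rewrite (_ : (fun s => _) = fun s => k0 * itg ph 'i s).
    apply: ctnZ.
    exact: derC_ctC (derC_integrand eps lambda c ph rot_i hD).
  by apply/funext => s'; rewrite exp_h -mulrA.
- apply: climZ.
  case: hst => hst; first exact: (sheet_start_minfty heps hlambda rad0 hzim hrad sh hst).
  exact: (sheet_start heps hlambda rad0 hzim sh hst).
- apply: climZ.
  apply: ctn_along (derC_ctC (dF _ hx)).
  by rewrite climE.
Qed.

End WithSheet.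

Lemma in_some_col s : (forall p, ReC s != ReC (z p)) -> exists2 k, (k <= P)%N & col z k s.
Proof.
move=> hs; pose Q k := [forall q : 'I_P, (k <= q)%N ==> (ReC s < ReC (z q))].
have exQ : exists k, Q k.
  by exists P; apply/forallP => q; apply/implyP; rewrite leqNgt ltn_ord.
have [k hk mink] := ex_minnP exQ.
exists k; first by apply: mink; apply/forallP => q; apply/implyP; rewrite leqNgt ltn_ord.
split=> p hp; last by have /forallP /(_ p) /implyP := hk; apply.
have : ~~ Q p by apply/negP => /mink; rewrite leqNgt hp.
rewrite negb_forall => /existsP[q]; rewrite negb_imply -leNgt => /andP[pq hq].
have hq' : ReC (z q) < ReC s by rewrite lt_neqAle eq_sym hs.
move: pq; rewrite leq_eqVlt => /orP[/eqP /val_inj ->//|/hzre h].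
exact: lt_trans h hq'.
Qed.

Lemma solution_package : exists Phi1 Phi2 : R[i] -> R[i], exists K : R,
  [/\ forall s, D 'i s ->
        derC Phi1 s ('i / eps%:C * ((lambda%:C + u0 c z s) * Phi1 s - SS z ph s)) /\
        ctC Phi1 s,
      forall s, D (- 'i) s ->
        derC Phi2 s ('i / eps%:C * ((lambda%:C + u0 c z s) * Phi2 s - SS z ph s)) /\
        (4 * rad <= mu s -> absC (Phi2 s) <= K / mu s),
      forall s, (forall p, ReC s != ReC (z p)) -> Phi1 s = Phi2 s,
      forall m, pole_bound z 'i m Phi1 (- (1 / 2)) /\ pole_bound z (- 'i) m Phi2 (- (1 / 2)) &
      forall x : R, Phi eps c z L lambda phi x = Phi1 x%:C].
Proof.
have [F [Fh [kap [K sh]]]] := sheet_exists c heps hlambda rad0 hzim hrad ph.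
have [K0 dF dFh hb rel] := sh.
have [K1 K10 hE] := EE_far lambda c heps rad0 hrad rot_Ni.
have e0 : eps%:C != 0 :> R[i] by rewrite real_neq0 gt_eqF.
have ab : absC (- ('i / eps%:C) : R[i]) = eps^-1.
  by rewrite absCN absCM absCi mul1r absCV absC_re gtr0_norm.
exists (sol eps lambda c z 'i F (kap 0)), (sol eps lambda c z (- 'i) Fh 0), (eps^-1 * (K1 * K)).
split.
- move=> s hD; have h := solution_ode heps rot_i dF (kap 0) hD; split=> //.
  exact: derC_ctC h.
- move=> s hD; split; first exact: (solution_ode heps rot_Ni dFh 0 hD).
  move=> hm; have m0 := far_pos rad0 hm; rewrite /sol absCM ab -mulrA ler_pM2l ?invr_gt0 //.
  rewrite subr0 absCM absCV; have [_ h] := hE s hD hm; have h2 := hb s hD hm.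
  have E0 : 0 < absC (E (- 'i) s) by rewrite absC_gt0; exact: expC_neq0.
  rewrite ler_pdivrMl // (le_trans h2) //.
  rewrite [leRHS](_ : _ = K / mu s * (K1 * absC (E (- 'i) s))); last by ring.
  by rewrite ler_pM2l // divr_gt0.
- move=> s hs; have [k kP hk] := in_some_col hs.
  rewrite /sol (rel k s hk) (kap_const sh kP) (EE_col eps lambda c hk).
  have D0 := Dk_neq0 eps c k; have E0 : E (- 'i) s != 0 by exact: expC_neq0.
  by field; rewrite D0 E0 e0.
- move=> m; have pb := pole_bounds sh; split.
    exact: (solution_small_at_pole hzim hzre rot_i dF (fun a0 : 0 < al m => (pb m a0).1)).
  exact: (solution_small_at_pole hzim hzre rot_Ni dFh (fun a0 : 0 < al m => (pb m a0).2)).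
- by move=> x; exact: PhiE sh x.
Qed.

End Package.

(** * Lebesgue integrals over the real line *)

Section Lebesgue.
Variable R : realType.
Implicit Types (f g : R -> R[i]) (u : R -> R) (K : R).
Local Notation mu := (@lebesgue_measure R).
Local Notation q := (fun x : R => (oneDsqr x)^-1).

Lemma oneDsqr_pos (x : R) : 0 < oneDsqr x.
Proof. exact: lt_le_trans ltr01 (oneDsqr_ge1 x). Qed.

Lemma q_ge0 (x : R) : 0 <= (oneDsqr x)^-1.
Proof. by rewrite invr_ge0 ltW ?oneDsqr_pos. Qed.

Lemma integral_q : (\int[mu]_x (q x)%:E = pi%:E)%E.
Proof.
rewrite ge0_symfun_integralT.
- rewrite (_ : [set x : R | 0 <= x] = `[0, +oo[%classic); last first.
    by apply/seteqP; split => x /=; rewrite in_itv /= andbT.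
  by rewrite integral0y_oneDsqr -EFinM; congr (_ %:E); rewrite mulrC divfK.
- exact: q_ge0.
- exact: continuous_oneDsqrV.
- by move=> x /=; rewrite /oneDsqr sqrrN.
Qed.

Lemma integrable_q : mu.-integrable setT (EFin \o q).
Proof.
apply/integrableP; split.
  by apply/measurable_EFinP; apply: continuous_measurable_fun; exact: continuous_oneDsqrV.
under eq_integral => x _ do rewrite /= ger0_norm ?q_ge0 //.
by rewrite integral_q ltry.
Qed.

Lemma integrable_Kq K : mu.-integrable setT (EFin \o (fun x => K * q x)).
Proof.
have := integrableZl measurableT K integrable_q.
by congr (_.-integrable _ _); apply/funext => x /=; rewrite EFinM.
Qed.

Lemma Rintegral_q : Rintegral mu setT q = pi.
Proof. by rewrite /Rintegral integral_q. Qed.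

Lemma Rintegral_Kq K : Rintegral mu setT (fun x => K * q x) = K * pi.
Proof. by rewrite RintegralZl ?Rintegral_q //; exact: integrable_q. Qed.

(** Continuous functions dominated by a multiple of [1 / (1 + x^2)], whose integral is [pi], form
    the one class in which all integrals over the line are handled. *)
Definition domR u K := continuous u /\ forall x, `|u x| <= K * q x.

Lemma domR_integrable u K : domR u K -> mu.-integrable setT (EFin \o u).
Proof.
move=> hu; have [cu h] := hu.
apply: (@le_integrable _ _ R mu setT measurableT _ (EFin \o (fun x => K * q x))).
- by apply/measurable_EFinP; exact: continuous_measurable_fun.
- by move=> x _ /=; rewrite lee_fin (le_trans (h x)) // ler_norm.
- exact: integrable_Kq.
Qed.

Lemma domR_bound u K : domR u K -> `|Rintegral mu setT u| <= K * pi.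
Proof.
move=> hu; have iu := domR_integrable hu; rewrite -Rintegral_Kq.
rewrite (le_trans (le_normr_Rintegral measurableT iu)) //.
apply: le_Rintegral => //; last by move=> x _; exact: hu.2.
  exact: integrable_norm.
exact: integrable_Kq.
Qed.

(** This bridges the Lebesgue integral over the line and the limits over symmetric intervals, which
    are what primitives and [cauchy_half_plane] evaluate. *)
Lemma domR_lim u K : domR u K ->
  Rintegral mu `[- n%:R, n%:R] u @[n --> \oo] --> Rintegral mu setT u.
Proof.
move=> hu; have iu := domR_integrable hu; have [cu h] := hu.
have mu_ : measurable_fun setT u by exact: continuous_measurable_fun.
pose I (n : nat) := `[- (n%:R : R), n%:R]%classic.
have mI n : measurable (I n) by exact: measurable_itv.
pose un (n : nat) (x : R) : \bar R := ((u \_ (I n)) x)%:E.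
have [] := @dominated_convergence _ _ R mu setT measurableT un (EFin \o u) (EFin \o (fun x => K * q x)).
- move=> n; apply/measurable_EFinP.
  by apply/(measurable_restrictT _ (mI n)); exact: measurable_funS mu_.
- exact/measurable_EFinP.
- apply/aeW => x _; apply: cvg_near_cst; near=> n; rewrite /un patchE mem_set // /I /= in_itv /=.
  rewrite -ler_norml; near: n; exact: nbhs_infty_ger.
- exact: integrable_Kq.
- apply/aeW => x n _; rewrite /un lee_fin patchE; case: ifP => _; first exact: h.
  by rewrite normr0; exact: le_trans (h x).
move=> _ _ hl.
have e n : Rintegral mu `[- n%:R, n%:R] u = fine (\int[mu]_(x in setT) un n x)%E.
  by rewrite Rintegral_mkcond.
rewrite (_ : (fun n => _) = fun n : nat => fine (\int[mu]_(x in setT) un n x)%E); last exact/funext/e.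
apply: fine_cvg; rewrite fineK; first exact: hl.
exact: integrable_fin_num.
Unshelve. all: by end_near. Qed.

Definition domC f K := (forall x, ctR f x) /\ forall x, absC (f x) <= K * q x.

Lemma domC_Re f K : domC f K -> domR (@ReC R \o f) K.
Proof.
move=> [h1 h2]; split=> x; first by have /ctR_RI [] := h1 x.
exact: le_trans (ReC_le _) (h2 x).
Qed.

Lemma domC_Im f K : domC f K -> domR (@ImC R \o f) K.
Proof.
move=> [h1 h2]; split=> x; first by have /ctR_RI [] := h1 x.
exact: le_trans (ImC_le _) (h2 x).
Qed.

Lemma integralC_bound f K : domC f K -> absC (integralC setT f) <= 2 * K * pi.
Proof.
move=> h; rewrite (le_trans (absC_le_RI _)) //.
have h1 := domR_bound (domC_Re h); have h2 := domR_bound (domC_Im h).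
by rewrite /integralC /=; lra.
Qed.

Lemma integralC_lim f K : domC f K ->
  clim \oo (fun n : nat => integralC `[- n%:R, n%:R] f) (integralC setT f).
Proof.
move=> h; apply/climRI; split; first exact: domR_lim (domC_Re h).
exact: domR_lim (domC_Im h).
Qed.

Lemma domCD f g K K' : domC f K -> domC g K' -> domC (fun x => f x + g x) (K + K').
Proof.
move=> [h1 h2] [h3 h4]; split=> x; first exact: (ctnD (h1 x) (h3 x)).
by rewrite (le_trans (absCD _ _)) // mulrDl lerD.
Qed.

Lemma domCZ f K (a : R[i]) : domC f K -> domC (fun x => a * f x) (absC a * K).
Proof.
move=> [h1 h2]; split=> x; first exact: (ctnM (ctn_cst a x) (h1 x)).
by rewrite absCM -mulrA ler_wpM2l ?absC_ge0.
Qed.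

Lemma integralCD f g K K' : domC f K -> domC g K' ->
  integralC setT (fun x => f x + g x) = integralC setT f + integralC setT g.
Proof.
move=> h h'; apply: complex_eq; rewrite ?CE /integralC /=.
  rewrite -(RintegralD measurableT (domR_integrable (domC_Re h)) (domR_integrable (domC_Re h'))).
  by congr (Rintegral _ _ _); apply/funext => x /=; rewrite CE.
rewrite -(RintegralD measurableT (domR_integrable (domC_Im h)) (domR_integrable (domC_Im h'))).
by congr (Rintegral _ _ _); apply/funext => x /=; rewrite CE.
Qed.

Lemma integralCZ f K (a : R[i]) : domC f K ->
  integralC setT (fun x => a * f x) = a * integralC setT f.
Proof.
move=> h; have i1 := domR_integrable (domC_Re h); have i2 := domR_integrable (domC_Im h).
have Z (r : R) (u : R -> R) : mu.-integrable setT (EFin \o u) ->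
    mu.-integrable setT (EFin \o (fun x => r * u x)).
  move=> iu; have := integrableZl measurableT r iu.
  by congr (_.-integrable _ _); apply/funext => x /=; rewrite EFinM.
apply: complex_eq; rewrite !CE /integralC /=.
  rewrite -!(RintegralZl _ measurableT) // -(RintegralB measurableT (Z _ _ i1) (Z _ _ i2)).
  by congr (Rintegral _ _ _); apply/funext => x /=; rewrite !CE.
rewrite -!(RintegralZl _ measurableT) // -(RintegralD measurableT (Z _ _ i2) (Z _ _ i1)).
by congr (Rintegral _ _ _); apply/funext => x /=; rewrite !CE.
Qed.

Lemma domC0 : domC (fun=> 0) 0.
Proof. by split=> x; [exact: ctn_cst|rewrite absC0 mul0r]. Qed.

Lemma integralC0 : integralC setT (fun=> 0 : R[i]) = 0.
Proof. by have := integralCZ 0 domC0; rewrite mulr0 mul0r. Qed.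

Lemma integralC_sum (I : Type) (r : seq I) (f : I -> R -> R[i]) (K : I -> R) (a : I -> R[i]) :
  (forall p, domC (f p) (K p)) ->
  integralC setT (fun x => \sum_(p <- r) a p * f p x) = \sum_(p <- r) a p * integralC setT (f p) /\
  domC (fun x => \sum_(p <- r) a p * f p x) (\sum_(p <- r) absC (a p) * K p).
Proof.
move=> h; elim: r => [|p r [IH1 IH2]].
  rewrite !big_nil (_ : (fun _ => _) = fun=> 0); last by apply/funext => x; rewrite big_nil.
  by split; [exact: integralC0|exact: domC0].
rewrite !big_cons (_ : (fun _ => _) = fun x => a p * f p x + \sum_(q <- r) a q * f q x); last first.
  by apply/funext => x; rewrite big_cons.
have hp := domCZ (a p) (h p); split; last exact: domCD.
by rewrite (integralCD hp IH2) IH1 (integralCZ _ (h p)).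
Qed.

End Lebesgue.

(** * Cauchy integrals of functions decaying like [1 / |x|] *)

Section CauchyIntegral.
Variable R : realType.
Implicit Types (w f : R -> R[i]) (K : R) (b zeta : R[i]).
Local Notation q := (fun x : R => (oneDsqr x)^-1).

(** Decay of order [1 / |x|], squared in order to avoid a root; the product of two such functions is
    integrable by [domC]. *)
Definition decC w K := (forall x, ctR w x) /\ forall x : R, absC (w x) ^+ 2 <= K * q x.

Lemma decCM w w' K K' : decC w K -> decC w' K' -> domC (fun x => w x * w' x) (K + K').
Proof.
move=> [c1 h1] [c2 h2]; split=> x; first exact: (ctnM (c1 x) (c2 x)).
rewrite absCM mulrDl; have := h1 x; have := h2 x.
set a := absC _; set b := absC _; have := sqr_ge0 (a - b).
have := sqr_ge0 a; have := sqr_ge0 b; nra.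
Qed.

(** With [b = beta + i gamma], the bound [1 + x^2 <= 2 (x - beta)^2 + (1 + 2 beta^2)] is compared
    with a multiple of [(x - beta)^2 + gamma^2]. *)
Definition pole_const b : R := 2 + (1 + 2 * ReC b ^+ 2) / ImC b ^+ 2.

Lemma pole_lower b (x : R) : ImC b != 0 -> oneDsqr x <= pole_const b * absC (x%:C - b) ^+ 2.
Proof.
move=> b0; rewrite sqr_absC /pole_const !CE /oneDsqr.
have g0 : 0 < ImC b ^+ 2 by rewrite exprn_even_gt0.
set be := ReC b; set ga := ImC b.
have e : (0 - ga) ^+ 2 = ga ^+ 2 by rewrite sub0r sqrrN.
rewrite sub0r sqrrN; set g := ga ^+ 2 in g0 *; set y := (x + - be) ^+ 2.
have y0 : 0 <= y by exact: sqr_ge0.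
have : (1 + 2 * be ^+ 2) / g * g = 1 + 2 * be ^+ 2 by rewrite divfK // gt_eqF.
have : 0 <= (1 + 2 * be ^+ 2) / g.
  by rewrite divr_ge0 ?(ltW g0) // addr_ge0 // mulr_ge0 ?sqr_ge0.
set A := _ / g => A0 eA.
have : 0 <= A * y by exact: mulr_ge0.
have : x ^+ 2 <= 2 * y + 2 * be ^+ 2.
  rewrite /y; have := sqr_ge0 (x - 2 * be); rewrite !expr2; nra.
by move=> h1 h2; rewrite mulrDr !mulrDl eA; lra.
Qed.

Lemma real_neq_pole b (x : R) : ImC b != 0 -> x%:C - b != 0.
Proof.
move=> b0; rewrite subr_eq0; apply/eqP => e; move: b0; by rewrite -e ImCr eqxx.
Qed.

Lemma ctR_pole b (x : R) : ImC b != 0 -> ctR (fun x => (x%:C - b)^-1) x.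
Proof.
move=> b0; apply: ctnV; first exact: real_neq_pole.
by apply: ctnB; [exact: (@inR_ctn R x)|exact: ctn_cst].
Qed.

Lemma decC_pole b : ImC b != 0 -> decC (fun x => (x%:C - b)^-1) (pole_const b).
Proof.
move=> b0; split=> x; first exact: ctR_pole.
have a0 : 0 < absC (x%:C - b) by rewrite absC_gt0 real_neq_pole.
rewrite absCV exprVn ler_pdivlMr ?oneDsqr_pos // mulrC ler_pdivrMr ?exprn_gt0 //.
exact: pole_lower.
Qed.

Lemma pole_ge_Im b (x : R) : `|ImC b| <= absC (x%:C - b).
Proof. by have := ImC_le (x%:C - b); rewrite !CE sub0r normrN. Qed.

Lemma clim_nat (f : R -> R[i]) l : clim +oo f l -> clim \oo (fun n : nat => f n%:R) l.
Proof. by rewrite !climE => h A hA; exact: (cvgr_idn (h _ hA)). Qed.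

Lemma cvg_atan_affine (a k : R) : 0 < k -> atan ((x - a) / k) @[x --> +oo] --> (pi / 2 : R).
Proof.
move=> k0; apply: (@cvg_comp _ _ _ (fun x : R => (x - a) / k) atan _ (+oo)); last exact: cvgy_atan.
apply/cvgryPge => A; near=> x.
rewrite ler_pdivlMr // lerBrDr; near: x; apply: nbhs_pinfty_ge; rewrite num_real //.
Unshelve. all: by end_near. Qed.

(** The moduli at [x] and [- x] are asymptotically equal, so that only the argument contributes; [e]
    records the sense in which it turns. *)
Lemma log_turn (sg a : R[i]) (e : R) : absC sg = 1 ->
  (forall x : R, ArgC (sg * (x%:C - a)) = e * atan ((x - ReC a) / `|ImC a|)) -> ImC a != 0 ->
  clim +oo (fun x : R => LogC (sg * (x%:C - a)) - LogC (sg * ((- x)%:C - a))) ((e * pi) *i).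
Proof.
move=> hs hA a0; apply/climRI; split.
  apply: (@rcvg_near _ _ (nbhs +oo_R) _ (fun x : R => ln (absC (x%:C - a)) - ln (absC ((- x)%:C - a)))).
    by apply: nearW => x; rewrite ReCD ReCN /LogC /= !absCM hs !mul1r.
  apply/cvgrPdist_le => e0 e00; near=> x.
  have hx : absC a + 1 + 2 * absC a / e0 <= x by near: x; apply: nbhs_pinfty_ge; rewrite num_real.
  have aa := absC_ge0 a.
  have h0 : 0 <= 2 * absC a / e0 by rewrite divr_ge0 ?mulr_ge0 // ltW.
  have x0 : 0 < x by lra.
  have m1 : x - absC a <= absC (x%:C - a).
    by have := absC_lb x%:C a; rewrite absC_re gtr0_norm.
  have m2 : x - absC a <= absC ((- x)%:C - a).
    by have := absC_lb (- x)%:C a; rewrite absC_re normrN gtr0_norm.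
  rewrite sub0r normrN (le_trans (ln_diff_bound _ m1 m2)) //; first by lra.
  rewrite ler_pdivrMr; last by lra.
  have d1 : `|absC (x%:C - a) - absC ((- x)%:C - a)| <= 2 * absC a.
    have e1 : absC ((- x)%:C - a) = absC (x%:C + a).
      by rewrite rmorphN /= -opprD absCN.
    rewrite e1.
    have t1 := absCD (x%:C - a) (a + a); have t2 := absCD (x%:C + a) (- (a + a)).
    rewrite absCN in t2; have t3 := absCD a a.
    have e2 : x%:C - a + (a + a) = x%:C + a by ring.
    have e3 : x%:C + a - (a + a) = x%:C - a by ring.
    by rewrite e2 in t1; rewrite e3 in t2; rewrite ler_norml; lra.
  rewrite (le_trans d1) //.
  have : 2 * absC a / e0 * e0 = 2 * absC a by rewrite divfK // gt_eqF.
  have := ler_wpM2r (ltW e00) hx; nra.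
have k0 : 0 < `|ImC a| by rewrite normr_gt0.
apply: (@rcvg_near _ _ (nbhs +oo_R) _ (fun x : R => e * (atan ((x - ReC a) / `|ImC a|) + atan ((x - - ReC a) / `|ImC a|)))).
  apply: nearW => x; rewrite ImCD ImCN /LogC /= !hA.
  rewrite -mulrBr -atanN; congr (_ * (_ + atan _)).
  by rewrite -mulNr; congr (_ / _); ring.
rewrite /= (_ : e * pi = e * (pi / 2 + pi / 2)); last by field.
apply: cvgM; first exact: cvg_cst.
by apply: cvgD; exact: cvg_atan_affine.
Unshelve. all: by end_near. Qed.

(* The value comes from the arguments of the two logarithms, which turn by
   [- pi] and [pi] along the real axis. *)
Lemma integral_two_poles b zeta : ImC b < 0 -> 0 < ImC zeta ->
  integralC setT (fun x : R => (x%:C - b)^-1 * (x%:C - zeta)^-1) = 2 * (pi *i) / (zeta - b).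
Proof.
move=> hb hz; have b0 : ImC b != 0 by rewrite lt_eqF.
have z0 : ImC zeta != 0 by rewrite gt_eqF.
have bz : b - zeta != 0.
  by rewrite subr_eq0; apply/eqP => e; rewrite e in hb; have := lt_trans hb hz; rewrite ltxx.
pose W (x : R) : R[i] := (LogC (- 'i * (x%:C - b)) - LogC ('i * (x%:C - zeta))) / (b - zeta).
have s1 x : 0 < ReC (- 'i * (x%:C - b)) by rewrite !CE; lra.
have s2 x : 0 < ReC ('i * (x%:C - zeta)) by rewrite !CE; lra.
have dLog (sg a : R[i]) x : sg != 0 -> 0 < ReC (sg * (x%:C - a)) ->
    derR (fun x => LogC (sg * (x%:C - a))) x (x%:C - a)^-1.
  move=> sg0 hs; have hsl : slit (sg * (x%:C - a)) by left.
  have h := derZ sg (derB (der_id (@inR R) x) (der_cst (@inR R) a x)).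
  apply: der_eq; last exact: (der_comp1 (w := fun x => sg * (x%:C - a)) (derC_LogC hsl) h).
  have := slit_neq0 hsl; rewrite mulf_eq0 negb_or => /andP[_ h2].
  by rewrite /inR subr0 mulr1; field; rewrite sg0 h2.
have dW x : derR W x ((x%:C - b)^-1 * (x%:C - zeta)^-1).
  have n1 : (- 'i : R[i]) != 0 by rewrite oppr_eq0 i_neq0.
  have h := derM (@inR_ctn R) (derB (dLog _ _ _ n1 (s1 x)) (dLog _ _ _ (i_neq0 R) (s2 x)))
     (der_cst (@inR R) (b - zeta)^-1 x).
  apply: der_eq h; have h1 := real_neq_pole x b0; have h2 := real_neq_pole x z0.
  by field; rewrite h1 h2 bz.
have dom := decCM (decC_pole b0) (decC_pole z0).
have e n : integralC `[- n%:R, n%:R] (fun x : R => (x%:C - b)^-1 * (x%:C - zeta)^-1) = W n%:R - W (- n%:R).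
  rewrite (@integralC_FTC R W) // => [|t _]; last exact: dom.1.
  by rewrite -subr_ge0 opprK addr_ge0.
apply: (clim_unique (integralC_lim dom)).
rewrite (_ : (fun n : nat => _) = fun n : nat => W n%:R - W (- n%:R)); last exact/funext/e.
apply: (clim_nat (f := fun x => W x - W (- x))).
have -> : 2 * (pi *i) / (zeta - b) = (0 - 2 * (pi *i)) / (b - zeta).
  have zb : zeta - b != 0 by rewrite -opprB oppr_eq0.
  by field; rewrite zb bz.
rewrite (_ : (fun x => W x - W (- x)) = fun x : R =>
   ((LogC (- 'i * (x%:C - b)) - LogC (- 'i * ((- x)%:C - b))) -
    (LogC ('i * (x%:C - zeta)) - LogC ('i * ((- x)%:C - zeta)))) * (b - zeta)^-1); last first.
  by apply/funext => x; rewrite /W; ring.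
apply: climM; last exact: clim_cst.
have -> : 0 - 2 * (pi *i) = (- 1 * pi) *i - (1 * pi) *i :> R[i].
  by apply: complex_eq; rewrite !CE /=; ring.
apply: climD; last apply: climN; apply: log_turn; rewrite ?absCN ?absCi // => x.
  rewrite ArgC_atan // (ltr0_norm hb) mulN1r -atanN !CE; congr atan.
  by field; rewrite lt_eqF.
rewrite ArgC_atan // (gtr0_norm hz) mul1r !CE; congr atan.
by field; rewrite gt_eqF.
Qed.

Section Transform.
Variables (w : R -> R[i]) (K : R).
Hypothesis hw : decC w K.
Local Notation c2 := ((2 * (pi *i))^-1 : R[i]).

Definition FC zeta : R[i] := c2 * integralC setT (fun y : R => w y * (y%:C - zeta)^-1).
Definition dFC zeta : R[i] :=
  c2 * integralC setT (fun y : R => w y * ((y%:C - zeta)^-1 * (y%:C - zeta)^-1)).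

Lemma FC_dom b : ImC b != 0 -> domC (fun y : R => w y * (y%:C - b)^-1) (K + pole_const b).
Proof. by move=> b0; exact: decCM hw (decC_pole b0). Qed.

Lemma pole_near zeta s (x : R) : 0 < ImC zeta -> absC (s - zeta) <= ImC zeta / 2 ->
  absC (x%:C - zeta) / 2 <= absC (x%:C - s).
Proof.
move=> z0 hs; have := pole_ge_Im zeta x; rewrite gtr0_norm // => h.
have := absC_tri (s) x%:C zeta; lra.
Qed.

Lemma near_Im zeta s : 0 < ImC zeta -> absC (s - zeta) <= ImC zeta / 2 -> 0 < ImC s.
Proof.
move=> z0 hs; have := le_trans (ImC_le (s - zeta)) hs; rewrite !CE ler_norml => h; lra.
Qed.

Lemma FC_dom2 zeta s s' : 0 < ImC zeta -> absC (s - zeta) <= ImC zeta / 2 ->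
  absC (s' - zeta) <= ImC zeta / 2 ->
  domC (fun y : R => w y * ((y%:C - s)^-1 * (y%:C - s')^-1)) (4 / ImC zeta * (K + pole_const zeta)).
Proof.
move=> z0 hs hs'; have i1 := lt0r_neq0 (near_Im z0 hs); have i2 := lt0r_neq0 (near_Im z0 hs').
have [_ hd] := FC_dom (lt0r_neq0 z0); split=> x.
  by apply: ctnM; [exact: hw.1|apply: ctnM; exact: ctR_pole].
have p1 := pole_near x z0 hs; have p2 := pole_near x z0 hs'.
have p3 := pole_ge_Im zeta x; rewrite gtr0_norm // in p3.
have a0 : 0 < absC (x%:C - zeta) by exact: lt_le_trans p3.
have a1 : 0 < absC (x%:C - s) by rewrite absC_gt0 real_neq_pole.
have a2 : 0 < absC (x%:C - s') by rewrite absC_gt0 real_neq_pole.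
rewrite -[leRHS]mulrA; apply: le_trans (ler_wpM2l _ (hd x)); last by rewrite divr_ge0 // ltW.
rewrite !absCM !absCV [leRHS]mulrCA ler_wpM2l ?absC_ge0 //.
have e : 4 / ImC zeta / absC (x%:C - zeta) = (ImC zeta * absC (x%:C - zeta) / 4)^-1.
  by field; rewrite !gt_eqF.
rewrite e -invfM lef_pV2 ?posrE ?mulr_gt0 //.
have := ler_pM (divr_ge0 (ltW a0) (ler0n R 2)) (divr_ge0 (ltW a0) (ler0n R 2)) p1 p2.
have := ler_wpM2r (ltW a0) p3; lra.
Qed.

Lemma FC_diff zeta s : 0 < ImC zeta -> 0 < ImC s ->
  FC s - FC zeta = (s - zeta) * (c2 * integralC setT (fun y : R => w y * ((y%:C - s)^-1 * (y%:C - zeta)^-1))).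
Proof.
move=> z0 s0; have h1 := FC_dom (lt0r_neq0 s0); have h2 := FC_dom (lt0r_neq0 z0).
have [e|ne] := eqVneq s zeta; first by rewrite e !subrr mul0r.
have sz : s - zeta != 0 by rewrite subr_eq0.
have -> : (fun y : R => w y * ((y%:C - s)^-1 * (y%:C - zeta)^-1)) =
  (fun y : R => (s - zeta)^-1 * (w y * (y%:C - s)^-1 + (- 1) * (w y * (y%:C - zeta)^-1))).
  apply/funext => y; have p1 := real_neq_pole y (lt0r_neq0 s0).
  by have p2 := real_neq_pole y (lt0r_neq0 z0); field; rewrite p1 p2 sz.
rewrite (integralCZ _ (domCD h1 (domCZ (- 1) h2))) (integralCD h1 (domCZ (- 1) h2)) (integralCZ _ h2).
by rewrite /FC; move: ((2 * (pi *i))^-1 : R[i]) => k; field; rewrite sz.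
Qed.

(** Two applications of the resolvent identity write the error of the difference quotient as
    [s - zeta] times an integral. It is bounded uniformly as long as [s] stays within half the
    distance from [zeta] to the real axis; [M] is this bound. *)
Lemma derC_FC zeta : 0 < ImC zeta -> derC FC zeta (dFC zeta).
Proof.
move=> z0; apply: derC_bound => e e0.
have hz : absC (zeta - zeta) <= ImC zeta / 2 by rewrite subrr absC0 divr_ge0 // ltW.
pose M : R := absC c2 * (2 * (2 / ImC zeta * (4 / ImC zeta * (K + pole_const zeta))) * pi).
have M0 : 0 < `|M| + 1 by rewrite ltr_wpDl.
exists (Num.min (ImC zeta / 2) (e / (`|M| + 1))); first by rewrite lt_min !divr_gt0.
move=> s; rewrite lt_min => /andP[/ltW s1 s2].
have s0 := near_Im z0 s1.
have dom1 := FC_dom2 z0 s1 hz; have dom2 := FC_dom2 z0 hz hz.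
have dom3 : domC (fun y : R => w y * ((y%:C - s)^-1 * ((y%:C - zeta)^-1 * (y%:C - zeta)^-1)))
    (2 / ImC zeta * (4 / ImC zeta * (K + pole_const zeta))).
  split=> y.
    apply: ctnM; first exact: hw.1.
    by apply: ctnM; [|apply: ctnM]; apply: ctR_pole; exact: lt0r_neq0.
  rewrite -[leRHS]mulrA; apply: le_trans (ler_wpM2l _ (dom2.2 y)); last by rewrite divr_ge0 // ltW.
  have -> (a b d : R[i]) : a * (b * d) = b * (a * d) by rewrite mulrCA.
  rewrite absCM; apply: ler_wpM2r; first exact: absC_ge0.
  have e1 : 2 / ImC zeta = (ImC zeta / 2)^-1 by rewrite invf_div.
  rewrite absCV e1 lef_pV2 ?posrE.
  - apply: le_trans (pole_near y z0 s1); rewrite ler_pM2r ?invr_gt0 //.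
    by have := pole_ge_Im zeta y; rewrite gtr0_norm.
  - by rewrite absC_gt0 real_neq_pole // lt0r_neq0.
  - by rewrite divr_gt0.
rewrite (FC_diff z0 s0) /dFC.
have -> : (s - zeta) * (c2 * integralC setT (fun y : R => w y * ((y%:C - s)^-1 * (y%:C - zeta)^-1))) -
  c2 * integralC setT (fun y : R => w y * ((y%:C - zeta)^-1 * (y%:C - zeta)^-1)) * (s - zeta) =
  (s - zeta) * (c2 * ((s - zeta) * integralC setT (fun y : R => w y * ((y%:C - s)^-1 * ((y%:C - zeta)^-1 * (y%:C - zeta)^-1))))).
  rewrite -(integralCZ _ dom3).
  have -> : (fun x : R => (s - zeta) * (w x * ((x%:C - s)^-1 * ((x%:C - zeta)^-1 * (x%:C - zeta)^-1)))) =
    (fun x : R => w x * ((x%:C - s)^-1 * (x%:C - zeta)^-1) +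
       (- 1) * (w x * ((x%:C - zeta)^-1 * (x%:C - zeta)^-1))).
    apply/funext => y; have p1 := real_neq_pole y (lt0r_neq0 s0).
    by have p2 := real_neq_pole y (lt0r_neq0 z0); field; rewrite p1 p2.
  by rewrite (integralCD dom1 (domCZ (- 1) dom2)) (integralCZ _ dom2); ring.
rewrite !absCM mulrC ler_wpM2r ?absC_ge0 // mulrCA.
have hb : absC c2 * absC (integralC setT (fun y : R => w y * ((y%:C - s)^-1 * ((y%:C - zeta)^-1 * (y%:C - zeta)^-1)))) <= M.
  by rewrite ler_wpM2l ?absC_ge0 // integralC_bound.
rewrite (le_trans (ler_wpM2l (absC_ge0 _) hb)) //.
rewrite (le_trans (ler_wpM2l (absC_ge0 _) (ler_norm M))) //.
rewrite (le_trans (ler_wpM2r (normr_ge0 M) (ltW s2))) //.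
by rewrite mulrAC ler_pdivrMr // ler_pM2l // lerDl.
Qed.

Lemma dFC_bound zeta : 0 < ImC zeta -> exists M, forall s, absC (s - zeta) <= ImC zeta / 2 ->
  absC (dFC s) <= M.
Proof.
move=> z0; exists (absC c2 * (2 * (4 / ImC zeta * (K + pole_const zeta)) * pi)) => s hs.
by rewrite /dFC absCM ler_wpM2l ?absC_ge0 // integralC_bound //; exact: FC_dom2.
Qed.

End Transform.

End CauchyIntegral.

(** * The Cauchy transform of the solution *)

Section Decay.
Variable R : realType.

(** Below the threshold [r] one has [1 + x^2 <= 1 + r^2]; above it,
    [(1 + x^2) / m^2 <= 1 + 1 / r^2]. The sum of the two constants serves both regimes. *)
Lemma decay_bound (v x m M B r : R) : 0 < r -> 0 <= v -> `|x| <= m ->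
  (m < r -> v <= M) -> (r <= m -> v <= B / m) ->
  v ^+ 2 <= (M ^+ 2 * (1 + r ^+ 2) + B ^+ 2 * (1 + (r ^+ 2)^-1)) * (oneDsqr x)^-1.
Proof.
move=> r0 v0 xm h1 h2; rewrite ler_pdivlMr ?oneDsqr_pos // /oneDsqr.
have R2 : 0 < r ^+ 2 by rewrite exprn_gt0.
have k1 : 0 <= M ^+ 2 * (1 + r ^+ 2) by rewrite mulr_ge0 ?sqr_ge0 // addr_ge0 // ltW.
have k2 : 0 <= B ^+ 2 * (1 + (r ^+ 2)^-1) by rewrite mulr_ge0 ?sqr_ge0 // addr_ge0 // invr_ge0 ltW.
have m0 : 0 <= m by exact: le_trans xm.
have xx : x ^+ 2 <= m ^+ 2 by rewrite -real_normK ?num_real // ler_sqr ?nnegrE.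
have [mr|rm] := ltP m r.
  rewrite -[leLHS]addr0 lerD //; apply: ler_pM; rewrite ?sqr_ge0 ?addr_ge0 ?sqr_ge0 //.
    by rewrite ler_sqr ?nnegrE ?h1 // (le_trans v0) ?h1.
  by rewrite lerD2l (le_trans xx) // ler_sqr ?nnegrE ?(ltW r0) // ltW.
have m1 : 0 < m by exact: lt_le_trans rm.
have m2 : 0 < m ^+ 2 by rewrite exprn_gt0.
have v2 : v ^+ 2 <= B ^+ 2 / m ^+ 2.
  by rewrite -expr_div_n ler_sqr ?nnegrE ?h2 // (le_trans v0) ?h2.
rewrite -[leLHS]add0r lerD // (le_trans (ler_wpM2r _ v2)) ?addr_ge0 ?sqr_ge0 //.
rewrite -mulrA ler_wpM2l ?sqr_ge0 // ler_pdivrMl // mulrDr mulr1 addrC lerD //.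
by rewrite -[leLHS](mulVf (lt0r_neq0 R2)) mulrC ler_wpM2r ?invr_ge0 ?(ltW R2) // ler_sqr ?nnegrE // ltW.
Qed.

End Decay.

Section Continuation.
Variables (R : realType) (P : nat) (eps lambda rad : R) (c z ph : 'I_P -> R[i]).
Hypotheses (heps : 0 < eps) (rad0 : 0 < rad) (hP : (0 < P)%N).
Hypotheses (hzim : forall p, 0 < ImC (z p)) (hrad : forall p, absC (z p) < rad).
Hypothesis hzre : forall p q : 'I_P, (p < q)%N -> ReC (z p) < ReC (z q).
Implicit Types (s zeta : R[i]) (p m : 'I_P).

Local Notation D := (Dom z).
Local Notation S := (SS z ph).
Local Notation off s := (forall p, ReC s != ReC (z p)).

Lemma Dom_both s : D 'i s -> D (- 'i) s -> off s.
Proof.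
move=> /Dom_i h1 /(Dom_Ni hzim) h2 p; apply/eqP => e.
by have /andP[_ h] := h1 p e; have := h2 p e; rewrite ltNge ltW.
Qed.

Lemma Dom_open sg s : rot sg -> D sg s ->
  exists2 r : R, 0 < r & forall s', absC (s' - s) < r -> D sg s'.
Proof.
move=> hsg hD.
have [b hb] : exists b, tall (D sg) b.
  by case: hsg => ->; [exists 0; exact: tall_i hzim|exists rad; exact: tall_Ni hzim hrad].
have [|d d0 hd] := hb (ReC s) (ImC s); first by rewrite pntK.
exists d => // s' hs'; rewrite -(pntK s').
have h1 := ReC_le (s' - s); have h2 := ImC_le (s' - s); rewrite !CE in h1 h2.
have h3 : `|ImC s' - ImC s| <= d by exact: le_trans h2 (ltW hs').
move: h3; rewrite ler_norml => h3; apply: hd.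
- exact: le_trans h1 (ltW hs').
- by case: (lerP b (ImC s)) => ?; lra.
- by case: (lerP b (ImC s)) => ?; lra.
Qed.

Definition du0 s : R[i] := \sum_p (c p * (- (s - z p) ^- 2) + (c p)^*%R * (- (s - (z p)^*%R) ^- 2)).

Lemma derC_u0 sg s : rot sg -> D sg s -> derC (u0 c z) s (du0 s).
Proof.
move=> hsg h; apply: derC_sum => p; have [h1 h2] := Dom_neq p hsg h.
by apply: derD; apply: derZ; exact: derC_inv.
Qed.

Definition rhs (Phi : R[i] -> R[i]) s : R[i] :=
  'i / eps%:C * ((lambda%:C + u0 c z s) * Phi s - S s).

Section OneSheet.
Variables (sg : R[i]) (Phi : R[i] -> R[i]) (b A : R[i]).
Hypotheses (hsg : rot sg) (dPhi : forall s, D sg s -> derC Phi s (rhs Phi s)).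
Hypothesis hb : forall s, D sg s -> s - b != 0.

Definition ddPhi s : R[i] :=
  'i / eps%:C * (du0 s * Phi s + (lambda%:C + u0 c z s) * rhs Phi s - dSS z ph s).

Lemma derC_rhs s : D sg s -> derC (rhs Phi) s (ddPhi s).
Proof.
move=> hD; apply: derZ; apply: derB.
  have h := derM (@inC_ctn R) (derD (der_cst (@inC R) lambda%:C s) (derC_u0 hsg hD)) (dPhi hD).
  by apply: der_eq h; rewrite add0r.
by apply: derC_SS => p; have [] := Dom_neq p hsg hD.
Qed.

Definition num s := Phi s - A * (s - b)^-1.
Definition dnum s := rhs Phi s - A * (- (s - b) ^- 2).
Definition ddnum s := ddPhi s + A * ((- (s - b) ^- 2) * (s - b)^-1 + (s - b)^-1 * (- (s - b) ^- 2)).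

Lemma derC_num s : D sg s -> derC num s (dnum s).
Proof.
move=> hD; apply: (derB (dPhi hD)); apply: derZ.
exact: derC_inv (hb hD).
Qed.

Lemma derC_dnum s : D sg s -> derC dnum s (ddnum s).
Proof.
move=> hD; have h := derC_inv (hb hD).
have -> : dnum = fun s => rhs Phi s + A * ((s - b)^-1 * (s - b)^-1).
  by apply/funext => x; rewrite /dnum mulrN opprK expr2 invfM.
exact: (derD (derC_rhs hD) (derZ A (derM (@inC_ctn R) h h))).
Qed.

End OneSheet.

Variables (Phi1 Phi2 : R[i] -> R[i]) (K : R).
Hypothesis dPhi1 : forall s, D 'i s -> derC Phi1 s (rhs Phi1 s).
Hypothesis dPhi2 : forall s, D (- 'i) s -> derC Phi2 s (rhs Phi2 s).
Hypothesis agree : forall s, off s -> Phi1 s = Phi2 s.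
Hypothesis small : forall m, pole_bound z 'i m Phi1 (- (1 / 2)) /\ pole_bound z (- 'i) m Phi2 (- (1 / 2)).
Hypothesis far : forall s, D (- 'i) s -> 4 * rad <= mu s -> absC (Phi2 s) <= K / mu s.

Local Notation w := (fun x : R => Phi1 x%:C).

Lemma ctR_w x : ctR w x.
Proof. exact: (ctn_comp (derC_ctC (dPhi1 (real_Dom hzim x))) (@inR_ctn R x)). Qed.

Lemma decC_w : exists Kw, decC w Kw.
Proof.
have [M hM] : exists M, forall x y : R, - (4 * rad) <= x <= 4 * rad -> 0 <= y <= 0 ->
    absC (Phi1 (fstC (x, y))) <= M.
  have := @compact_rectangle R (fun p : R * R => Phi1 (fstC p)) (- (4 * rad)) (4 * rad) 0 0.
  apply=> x y _ _.
  exact: (ctn_comp (w := @fstC R) (t := (x, y)) (derC_ctC (dPhi1 (real_Dom hzim x))) (fstC_ctn (x, y))).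
exists (M ^+ 2 * (1 + (4 * rad) ^+ 2) + K ^+ 2 * (1 + ((4 * rad) ^+ 2)^-1)); split; first exact: ctR_w.
move=> x; apply: (@decay_bound R _ _ `|x|); rewrite ?absC_ge0 ?mulr_gt0 // => hx.
  by apply: (hM x 0); rewrite ?lexx // -ler_norml ltW.
have off_x : off x%:C.
  move=> p; rewrite ReCr; apply/eqP => e; have := ReC_le (z p); have := hrad p.
  rewrite -e; have : rad < 4 * rad by rewrite ltr_pMl // ltr1n.
  by move: hx; lra.
have mx : mu x%:C = `|x| by rewrite /mu ReCr ImCr; apply/max_idPl.
by rewrite agree // -mx; apply: far; [have [] := off_Dom hzim off_x|rewrite mx].
Qed.

(* Subtracting [A / (s - b)], with [b] in the lower half-plane, removes the
   singularity of [Phi1 / (s - zeta)] while making it integrable at infinity. *)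
Lemma cauchy_subtracted zeta (m0 : 'I_P) A (b := (z m0)^*%R) :
  ImC zeta != 0 -> (forall m, zeta != z m) ->
  (D 'i zeta -> num Phi1 b A zeta = 0) -> (D (- 'i) zeta -> num Phi2 b A zeta = 0) ->
  integralC setT (fun x : R => w x * (x%:C - zeta)^-1) =
  A * integralC setT (fun x : R => (x%:C - b)^-1 * (x%:C - zeta)^-1).
Proof.
move=> z0 zm N10 N20; have [Kw hw] := decC_w.
have hb1 s : D 'i s -> s - b != 0 by move=> h; have [] := Dom_neq m0 rot_i h.
have hb2 s : D (- 'i) s -> s - b != 0 by move=> h; have [] := Dom_neq m0 rot_Ni h.
have bi : ImC b < 0 by rewrite /b ImCJ oppr_lt0.
have d1 := derC_num A dPhi1 hb1; have dd1 := derC_dnum A rot_i dPhi1 hb1.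
have d2 := derC_num A dPhi2 hb2; have dd2 := derC_dnum A rot_Ni dPhi2 hb2.
have op1 := fun s => @Dom_open 'i s rot_i; have op2 := fun s => @Dom_open (- 'i) s rot_Ni.
have lim0 : clim \oo (fun n : nat => integralC `[- n%:R, n%:R] (fun x => quot (num Phi1 b A) (dnum Phi1 b A) zeta x%:C)) 0.
  apply: (clim_nat (f := fun X : R => integralC `[- X, X] (fun x => quot (num Phi1 b A) (dnum Phi1 b A) zeta x%:C))).
  have pole sg Phi m : rot sg -> pole_bound z sg m Phi (- (1 / 2)) ->
      pole_bound z sg m (quot (num Phi b A) (dnum Phi b A) zeta) (- (1 / 2)).
    move=> hsg h; apply: (@pole_bound_near _ _ _ _ _ (fun s => num Phi b A s * (s - zeta)^-1)).
      by apply: filterS (near_neq (_ : z m != zeta)) => [s /negPf ne|]; [rewrite /quot ne|rewrite eq_sym].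
    have h1 : pole_bound z sg m (fun s => (s - zeta)^-1) 0.
      by apply/pole_bound_ctn/ctC_inv; rewrite subr_eq0 eq_sym.
    have h2 : pole_bound z sg m (fun s => - (A * (s - b)^-1)) 0.
      apply/pole_bound_ctn/ctnN/ctnM; first exact: ctn_cst.
      by apply: ctC_inv; rewrite subr_eq0; apply/eqP => e; have := hzim m; have := hzim m0; rewrite e ImCJ; lra.
    have h3 : - (1 / 2) <= 0 :> R by rewrite oppr_le0 divr_ge0.
    by have := pole_boundM (pole_boundD h (pole_bound_le h3 h2)) h1; rewrite addr0.
  (* In the far region [|s - b|] and [|s - zeta|] are at least [mu s / 2], which bounds the quotient
     by [2 * (K + 2 * |A|) / mu s ^+ 2]; the factor 4 leaves room. *)
  apply: (@cauchy_half_plane _ _ _ _ rad0 hzim hrad hzre _ _ (quot (num Phi2 b A) (dnum Phi2 b A) zeta) _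
    (4 * (K + 2 * absC A)) (derC_quot op1 d1 dd1 N10) (ctC_dquot op1 d1 dd1 N10)
    (derC_quot op2 d2 dd2 N20) (ctC_dquot op2 d2 dd2 N20) _ _ _
    (Num.max (4 * rad) (Num.max (absC b * 2) (absC zeta * 2)))).
  - move=> s hs; rewrite /quot; case: eqP => [e|_]; last by rewrite /num (agree hs).
    by rewrite /dnum /rhs -e (agree hs).
  - by move=> m; exact: pole rot_i (small m).1.
  - by move=> m; exact: pole rot_Ni (small m).2.
  - move=> s hD; rewrite !ge_max => /andP[h1 /andP[h2 h3]]; have m0' := far_pos rad0 h1.
    have sb := far_pole h2; have sz := far_pole h3.
    have sb0 : 0 < absC (s - b) by apply: lt_le_trans sb; rewrite divr_gt0.
    have sz0 : 0 < absC (s - zeta) by apply: lt_le_trans sz; rewrite divr_gt0.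
    have nz : s == zeta = false by apply/negbTE; rewrite -subr_eq0 -absC_gt0.
    have fr := far hD h1.
    have K0 : 0 <= K by have := le_trans (absC_ge0 _) fr; rewrite pmulr_lge0 // invr_gt0.
    rewrite /quot nz absCM absCV ler_pdivrMr //.
    have n1 : absC (num Phi2 b A s) <= (K + 2 * absC A) / mu s.
      rewrite (le_trans (absCB _ _)) // mulrDl lerD // absCM absCV [2 * _]mulrC -mulrA.
      rewrite ler_wpM2l ?absC_ge0 //.
      by rewrite -[leRHS]invrK invf_div lef_pV2 ?posrE ?divr_gt0.
    have A0 := absC_ge0 A.
    rewrite (le_trans n1) //.
    have -> : (K + 2 * absC A) / mu s = 2 * (K + 2 * absC A) / mu s ^+ 2 * (mu s / 2).
      by field; rewrite gt_eqF.
    apply: ler_pM => //; rewrite ?divr_ge0 ?mulr_ge0 ?sqr_ge0 ?addr_ge0 ?mulr_ge0 ?(ltW m0') //.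
    rewrite ler_wpM2r ?invr_ge0 ?sqr_ge0 // ler_wpM2r ?addr_ge0 ?mulr_ge0 //; lra.
have dom1 := FC_dom hw z0.
have dom2 := decCM (decC_pole (ltr0_neq0 bi)) (decC_pole z0).
have dom := domCD dom1 (domCZ (- A) dom2).
have e : (fun x : R => quot (num Phi1 b A) (dnum Phi1 b A) zeta x%:C) =
   (fun x => w x * (x%:C - zeta)^-1 + (- A) * ((x%:C - b)^-1 * (x%:C - zeta)^-1)).
  apply/funext => x; rewrite /quot /num.
  have nz : x%:C == zeta = false.
    by apply/negbTE; rewrite -subr_eq0; exact: real_neq_pole z0.
  by rewrite nz; ring.
rewrite e in lim0.
have := clim_unique (integralC_lim dom) lim0.
rewrite (integralCD dom1 (domCZ (- A) dom2)) (integralCZ _ dom2).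
by move=> /(_ _)/eqP; rewrite mulNr subr_eq0 => /eqP.
Qed.

Lemma integral_conj_pole p : integralC setT (fun y : R => w y * (y%:C - (z p)^*%R)^-1) = 0.
Proof.
(* Nothing is subtracted: the point is the tip of a cut common to both planes, so the vanishing
   conditions hold vacuously. *)
have z0 := hzim p; rewrite (@cauchy_subtracted _ p 0) ?mul0r //.
- by rewrite ImCJ oppr_eq0 gt_eqF.
- by move=> m; apply/eqP => e; have := hzim m; rewrite -e ImCJ; lra.
- by move=> h; have [_] := Dom_neq p rot_i h; rewrite subrr eqxx.
- by move=> h; have [_] := Dom_neq p rot_Ni h; rewrite subrr eqxx.
Qed.

Lemma FC_Phi1 zeta : D 'i zeta -> 0 < ImC zeta -> FC w zeta = Phi1 zeta.
Proof.
move=> Dz z0; pose m0 : 'I_P := Ordinal hP; set b := (z m0)^*%R.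
have nz p := Dom_neq p rot_i Dz.
have [_ zb] := nz m0.
have bi : ImC b < 0 by rewrite /b ImCJ oppr_lt0.
(* This coefficient makes the numerator vanish at [zeta], and cancels against the denominator
   [zeta - b] of [integral_two_poles]. *)
rewrite /FC (@cauchy_subtracted _ m0 (Phi1 zeta * (zeta - b))) ?integral_two_poles ?(lt0r_neq0 z0) //.
- have : (2 * (pi *i) : R[i]) != 0.
    by rewrite mulf_neq0 ?pnatr_eq0 // -absC_gt0 /absC /= expr0n /= add0r sqrtr_sqr normr_gt0 gt_eqF ?pi_gt0.
  by move: (2 * (pi *i) : R[i]) => k k0; field; rewrite zb k0.
- by move=> p; have [] := nz p; rewrite subr_eq0.
- by rewrite /num mulfK // subrr.
by move=> h; rewrite /num -agree ?mulfK ?subrr //; exact: Dom_both.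
Qed.

Lemma near_off s : \forall t \near 0^'+, off (s + t%:C).
Proof.
apply: filter_forall => p; have [e|ne] := eqVneq (ReC s) (ReC (z p)); near=> t; rewrite !CE.
  have t0 : 0 < t by near: t; exact: nbhs_right_gt.
  by rewrite e; apply/eqP; lra.
have t0 : 0 < t by near: t; exact: nbhs_right_gt.
have : t < `|ReC (z p) - ReC s|.
  by near: t; apply: nbhs_right_lt; rewrite normr_gt0 subr_eq0 eq_sym.
by move=> h; apply/eqP => e; move: h; rewrite -e addrAC subrr add0r gtr0_norm // ltxx.
Unshelve. all: by end_near. Qed.

Lemma clim_right F s : ctC F s -> clim 0^'+ (fun t : R => F (s + t%:C)) (F s).
Proof. by move=> /(clim_ray (absC1 R)); under eq_fun do rewrite mul1r. Qed.

Lemma clim_real0 : clim 0^'+ (fun t : R => t%:C) 0.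
Proof. by have := clim_right (@inC_ctn R 0); under [fun _ => inC _]funext do rewrite /inC add0r. Qed.

(** Agreement is asked only at points slightly to the right, since these avoid the vertical lines
    through the poles whatever [s] is; continuity of the Caratheodory factors transfers it to the
    derivatives. *)
Lemma derC_unique F H s d e : derC F s d -> derC H s e ->
  F s = H s -> (\forall t \near 0^'+, F (s + t%:C) = H (s + t%:C)) -> d = e.
Proof.
move=> [Q [hF <- cQ]] [Q' [hH <- cQ']] e0 en.
have cl := clim_right cQ; apply: (clim_unique cl); apply: clim_near (clim_right cQ').
near=> t; have t0 : 0 < t by near: t; exact: nbhs_right_gt.
have : F (s + t%:C) = H (s + t%:C) by near: t.
rewrite hF (hH (s + t%:C)) e0 /inC addrAC subrr add0r => /addrI/mulIf -> //.
by rewrite real_neq0 gt_eqF.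
Unshelve. all: by end_near. Qed.

Lemma FC_off s : off s -> 0 < ImC s -> FC w s = Phi1 s.
Proof. by move=> h s0; apply: FC_Phi1 => //; have [] := off_Dom hzim h. Qed.

Lemma ctC_FC s : 0 < ImC s -> ctC (FC w) s.
Proof. by move=> s0; have [Kw hw] := decC_w; exact: derC_ctC (derC_FC hw s0). Qed.

(** A point above a pole lies on an upward cut, where [Phi1] gives no information. Both sides being
    continuous, the equality is inherited from the points to its right. *)
Lemma FC_Phi2 s : D (- 'i) s -> 0 < ImC s -> FC w s = Phi2 s.
Proof.
move=> hD s0; apply: (clim_unique (clim_right (ctC_FC s0))).
apply: clim_near (clim_right (derC_ctC (dPhi2 hD))).
near=> t; have h : off (s + t%:C) by near: t; exact: near_off.
by rewrite -agree // FC_off // !CE addr0.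
Unshelve. all: by end_near. Qed.

Lemma residue_sum (a : 'I_P -> R[i]) m :
  clim 0^'+ (fun t : R => t%:C * \sum_p (a p / (z m + t%:C - z p))) (a m).
Proof.
have ca : ctC (fun s => \sum_(p | p != m) (a p / (s - z p))) (z m).
  rewrite (_ : (fun s => _) = fun s => \sum_p (if p != m then a p / (s - z p) else 0)); last first.
    by apply/funext => s; rewrite -big_mkcond.
  apply: ctn_sum => p; have [->|pm] := eqVneq p m; first exact: ctn_cst.
  by apply: ctnZ; apply: ctC_inv; apply: (z_neq hzre); rewrite eq_sym.
have /(_ _ _ _) h := climD (clim_cst (a m)) (climM clim_real0 (clim_right ca)).
rewrite mul0r addr0 in h; apply: clim_near h; near=> t.
have t0 : 0 < t by near: t; exact: nbhs_right_gt.
rewrite [in RHS](bigD1 m) //= mulrDr; congr (_ + _).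
have -> : z m + t%:C - z m = t%:C by ring.
by field; rewrite real_neq0 gt_eqF.
Unshelve. all: by end_near. Qed.

Lemma residue m : c m * FC w (z m) = ph m.
Proof.
have [Kw hw] := decC_w; have [M hM] := dFC_bound hw (hzim m).
pose s (t : R) := z m + t%:C.
have cC := clim_right (ctC_FC (hzim m)).
have ct := clim_real0.
have cu : clim 0^'+ (fun t => t%:C * (lambda%:C + u0 c z (s t))) (c m).
  have cJ : ctC (fun s => \sum_p ((c p)^*%R / (s - (z p)^*%R))) (z m).
    apply: ctn_sum => p; apply: ctnZ.
    apply: ctC_inv; rewrite subr_eq0; apply/eqP => e.
    by have := hzim m; have := hzim p; rewrite e ImCJ; lra.
  have := climD (residue_sum c m) (climM ct (climD (clim_cst lambda%:C) (clim_right cJ))).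
  rewrite mul0r addr0 => /(_ _ _ _ _); apply: clim_near; apply: nearW => t.
  by rewrite /u0 big_split /= -mulrDr; congr (_ * _); ring.
have /(_ _ _ _) c1 := climD (climM cu cC) (climN (residue_sum ph m)).
have ie : 'i / eps%:C != 0 :> R[i] by rewrite mulf_neq0 ?i_neq0 // invr_eq0 real_neq0 gt_eqF.
apply/eqP; rewrite -subr_eq0; apply/eqP/(mulfI ie); rewrite mulr0.
apply: (clim_unique (climM (clim_cst ('i / eps%:C)) c1)).
(* By the differential equation the expression is [t] times the derivative of [FC w], which is
   bounded near [z m] since [z m] is interior to the upper half-plane. *)
apply: (@clim_norm0 R _ _ _ _ _ (fun t => M * t)); last first.
  by rewrite -[X in _ --> X](mulr0 M); apply: cvgM; [exact: cvg_cst|exact: cvg_at_right_filter].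
near=> t; have t0 : 0 < t by near: t; exact: nbhs_right_gt.
have offt : off (s t) by near: t; exact: near_off.
have st0 : 0 < ImC (s t) by rewrite !CE addr0.
have [Dt _] := off_Dom hzim offt.
have e : dFC w (s t) = rhs Phi1 (s t).
  apply: (derC_unique (derC_FC hw st0) (dPhi1 Dt)); first by rewrite FC_Phi1.
  near=> t'; apply: FC_off; last by rewrite !CE !addr0.
  by near: t'; exact: near_off.
rewrite subr0 -/(s t) (FC_Phi1 Dt) //.
have -> : 'i / eps%:C * (t%:C * (lambda%:C + u0 c z (s t)) * Phi1 (s t) - t%:C * SS z ph (s t)) =
   dFC w (s t) * t%:C by rewrite e /rhs; ring.
rewrite absCM absC_re gtr0_norm // ler_wpM2r ?(ltW t0) // hM //.
rewrite /s addrAC subrr add0r absC_re gtr0_norm //.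
by near: t; apply: nbhs_right_le; rewrite divr_gt0.
Unshelve. all: by end_near. Qed.

(** Three regions need three descriptions: near the real axis, below all poles, [FC w] is controlled
    through [Phi1], which is regular across the axis; at medium height it is continuous on a compact
    rectangle, poles included; far away it is [Phi2], which decays. *)
Lemma FC_decay : exists M, forall s, 0 < ImC s -> absC (FC w s) ^+ 2 <= M * (oneDsqr (ReC s))^-1.
Proof.
have [p|p|b b0 hb] := @fin_pos R _ (fun p d => d < ImC (z p)).
- by move=> d d' _; exact: le_lt_trans.
- by exists (ImC (z p) / 2); have := hzim p => ?; lra.
have pc q : ctn (fun p : R * R => fstC p + 'i * sndC p) q.
  by apply: ctnD; [exact: fstC_ctn|apply: ctnZ; exact: sndC_ctn].
have [M1 h1] : exists M, forall x y : R, - (4 * rad) <= x <= 4 * rad -> 0 <= y <= b ->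
    absC (Phi1 (pnt x y)) <= M.
  apply: (@compact_rectangle R (fun p : R * R => Phi1 (fstC p + 'i * sndC p))) => x y _ /andP[y0 yb].
  apply: (@ctn_comp R _ Phi1 (fun p : R * R => fstC p + 'i * sndC p) (x, y)); last exact: pc.
  apply: derC_ctC (dPhi1 _); apply/Dom_i => p _; have := hzim p; have := hb p.
  by rewrite !CE /=; lra.
have [M2 h2] : exists M, forall x y : R, - (4 * rad) <= x <= 4 * rad -> b <= y <= 4 * rad ->
    absC (FC w (pnt x y)) <= M.
  apply: (@compact_rectangle R (fun p : R * R => FC w (fstC p + 'i * sndC p))) => x y _ /andP[y0 yb].
  apply: (@ctn_comp R _ (FC w) (fun p : R * R => fstC p + 'i * sndC p) (x, y)); last exact: pc.
  by apply: ctC_FC; rewrite !CE /=; lra.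
exists (Num.max M1 M2 ^+ 2 * (1 + (4 * rad) ^+ 2) + K ^+ 2 * (1 + ((4 * rad) ^+ 2)^-1)) => s s0.
apply: (@decay_bound R _ _ (mu s)); first exact: mulr_gt0.
- exact: absC_ge0.
- by rewrite le_max lexx.
- rewrite /mu gt_max => /andP[hr hi]; have hr' : - (4 * rad) <= ReC s <= 4 * rad by rewrite -ler_norml ltW.
  have [sb|sb] := lerP (ImC s) b; last first.
    by rewrite le_max -[s in FC w s]pntK h2 ?orbT // !ltW.
  have hD : D 'i s by apply/Dom_i => p _; have := hb p; lra.
  rewrite FC_Phi1 // le_max; apply/orP; left; rewrite -[s]pntK.
  by apply: h1 => //; rewrite (ltW s0).
move=> hm; have hD : D (- 'i) s.
  apply/(Dom_Ni hzim) => p e; have := hrad p; have := ReC_le (z p); have := ImC_le (z p).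
  have := ler_norm (ImC (z p)); move: hm; rewrite /mu e le_max; have := rad0.
  by move=> ? /orP[] *; lra.
by rewrite FC_Phi2 // far.
Qed.

Local Notation c2 := ((2 * (pi *i))^-1 : R[i]).

Lemma FC_conj p : FC w (z p)^*%R = 0.
Proof. by rewrite /FC integral_conj_pole mulr0. Qed.

Lemma Im_neq0 p : ImC (z p) != 0 /\ ImC (z p)^*%R != 0.
Proof. by have := lt0r_neq0 (hzim p); rewrite ImCJ oppr_eq0. Qed.

Lemma integral_u0 :
  c2 * integralC setT (fun x : R => u0 c z x%:C * w x) = \sum_p ph p.
Proof.
have [Kw hw] := decC_w.
have [s1 d1] := integralC_sum (index_enum _) c (fun p => FC_dom hw (Im_neq0 p).1).
have [s2 d2] := integralC_sum (index_enum _) (fun p => (c p)^*%R) (fun p => FC_dom hw (Im_neq0 p).2).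
rewrite (_ : (fun x : R => _) = fun x : R => \sum_p c p * (w x * (x%:C - z p)^-1) +
    \sum_p (c p)^*%R * (w x * (x%:C - (z p)^*%R)^-1)); last first.
  by apply/funext => x; rewrite mulr_suml -big_split /=; apply: eq_bigr => p _; ring.
rewrite (integralCD d1 d2) s1 s2 mulrDr !mulr_sumr -[RHS]addr0; congr (_ + _).
  by apply: eq_bigr => p _; rewrite -residue /FC mulrCA.
by rewrite big1 // => p _; rewrite integral_conj_pole !mulr0.
Qed.

Lemma cauchy_upper_solution (x d : R) : 0 < d -> D 'i (x +i* d) ->
  cauchy_upper (fun y => u0 c z y%:C * w y) x d =
  u0 c z (x +i* d) * FC w (x +i* d) - S (x +i* d).
Proof.
set s := x +i* d => d0 hD; have [Kw hw] := decC_w.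
have nz p := Dom_neq p rot_i hD.
have s0 : ImC s != 0 by rewrite gt_eqF.
(* Partial fractions: [1 / ((y - b) (y - s))] is [1 / (s - b)] times [1 / (y - s) - 1 / (y - b)].
   After integration the values of [FC w] at the poles produce the sum [S], those at the conjugates
   vanish. *)
pose g b (y : R) := w y * (y%:C - s)^-1 + (- 1) * (w y * (y%:C - b)^-1).
have dg b : ImC b != 0 -> domC (g b) (Kw + pole_const s + absC (-1 : R[i]) * (Kw + pole_const b)).
  by move=> b0; exact: domCD (FC_dom hw s0) (domCZ (- 1) (FC_dom hw b0)).
have ig b : ImC b != 0 -> c2 * integralC setT (g b) = FC w s - FC w b.
  move=> b0; rewrite (integralCD (FC_dom hw s0) (domCZ (- 1) (FC_dom hw b0))).
  by rewrite (integralCZ _ (FC_dom hw b0)) mulN1r mulrBr.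
have [s1 d1] := integralC_sum (index_enum _) (fun p => c p / (s - z p)) (fun p => dg _ (Im_neq0 p).1).
have [s2 d2] := integralC_sum (index_enum _) (fun p => (c p)^*%R / (s - (z p)^*%R)) (fun p => dg _ (Im_neq0 p).2).
rewrite /cauchy_upper -/s.
rewrite (_ : (fun y : R => _) = fun y : R => \sum_p c p / (s - z p) * g (z p) y +
    \sum_p (c p)^*%R / (s - (z p)^*%R) * g ((z p)^*%R) y); last first.
  apply/funext => y; rewrite !mulr_suml -big_split /=; apply: eq_bigr => p _.
  have [n1 n2] := nz p; have [i1 i2] := Im_neq0 p; rewrite /g.
  have y0 := real_neq_pole y s0; have y1 := real_neq_pole y i1; have y2 := real_neq_pole y i2.
  by field; rewrite n1 n2 y0 y1 y2.
rewrite (integralCD d1 d2) s1 s2 mulrDr !mulr_sumr /u0 mulr_suml -sumrB -big_split /=.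
apply: eq_bigr => p _; have [n1 n2] := nz p; have [i1 i2] := Im_neq0 p.
rewrite !(mulrCA c2) !ig // FC_conj -residue; ring.
Qed.

Lemma clim_up F (x : R) : ctC F x%:C -> clim 0^'+ (fun d : R => F (x +i* d)) (F x%:C).
Proof. by move=> /(clim_ray (absCi R)); under eq_fun do rewrite -/(pnt _ _) -pntE. Qed.

Lemma near_up (x : R) : \forall d \near 0^'+, D 'i (x +i* d).
Proof.
have [r r0 hr] := @Dom_open 'i x%:C rot_i (real_Dom hzim x).
by apply: filterS (near_ray x%:C r0 (absCi R)) => d; rewrite -/(pnt _ _) -pntE; exact: hr.
Qed.

Lemma cauchy_upper_limit (x : R) :
  clim 0^'+ (cauchy_upper (fun y => u0 c z y%:C * w y) x) (u0 c z x%:C * w x - S x%:C).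
Proof.
have h : ctC (fun s => u0 c z s * Phi1 s - S s) x%:C.
  apply: ctnB; first apply: ctnM.
  - exact: ctC_u0 rot_i (real_Dom hzim x).
  - exact: derC_ctC (dPhi1 (real_Dom hzim x)).
  by apply/derC_ctC/derC_SS => p; have [] := Dom_neq p rot_i (real_Dom hzim x).
apply: clim_near (clim_up h); near=> d.
have d0 : 0 < d by near: d; exact: nbhs_right_gt.
have hD : D 'i (x +i* d) by near: d; exact: near_up.
by rewrite cauchy_upper_solution // FC_Phi1.
Unshelve. all: by end_near. Qed.

Lemma derC_derivable F s d : derC F s d -> derivable (F : R[i]^o -> R[i]^o) s 1.
Proof.
move=> [Q [hF _ cQ]]; apply/cvg_ex; exists (Q s).
have hs : (fun h : R[i]^o => h + s) h @[h --> (0 : R[i]^o)^'] --> (s : R[i]^o).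
  have : (fun h : R[i]^o => h + s) h @[h --> (0 : R[i]^o)^'] --> (0 + s : R[i]^o).
    by apply: cvgD; [exact: cvg_within|exact: cvg_cst].
  by rewrite add0r.
move: cQ; rewrite /ctn climE => cQ.
apply: cvg_trans (cvg_comp _ _ hs cQ); apply: near_eq_cvg; near=> h.
have h0 : h != 0 by near: h; exact: nbhs_dnbhs_neq.
rewrite /= (hF (h *: 1 + s)) /inC addrAC subrr add0r.
have -> : h *: (1 : R[i]^o) = h by rewrite /GRing.scale /= mulr1.
by rewrite addrK /GRing.scale /= mulrCA mulVf // mulr1.
Unshelve. all: by end_near. Qed.

Lemma L2_decC (v : R -> R[i]) B : decC v B -> L2 v.
Proof.
move=> [cv hv].
have key (pr : R[i] -> R) : (forall s, `|pr s| <= absC s) -> continuous (pr \o v) ->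
    pr \o v \in Lfun (@lebesgue_measure R) 2%:E.
  move=> hpr cp; have mp : measurable_fun setT (pr \o v) by exact: continuous_measurable_fun.
  rewrite inE; apply/andP; split; rewrite inE //= /finite_norm unlock.
  apply: poweR_lty; apply: (@le_lt_trans _ _ (\int[lebesgue_measure]_x (B * (oneDsqr x)^-1)%:E)%E).
    apply: ge0_le_integral => //.
    - by move=> x _; exact: poweR_ge0.
    - apply/measurable_EFinP/(@measurableT_comp _ _ _ _ _ _ (fun x : R => x `^ 2)%R) => //.
      exact: measurableT_comp.
    - apply/measurable_EFinP; apply: continuous_measurable_fun => y.
      by apply: cvgM; [exact: cvg_cst|exact: continuous_oneDsqrV].
    - move=> y _ /=; rewrite lee_fin powR_mulrn // (le_trans _ (hv y)) //.
      by rewrite ler_sqr ?nnegrE ?absC_ge0.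
  by have := integrable_fin_num measurableT (integrable_Kq B); rewrite fin_numE => /andP[_]; rewrite -ltey.
split; apply: key => [s|x]; rewrite ?ReC_le ?ImC_le //; by have /ctR_RI [] := cv x.
Qed.

Lemma Hardy_solution : Hardy_plus w.
Proof.
have [Kw hw] := decC_w; split; first exact: L2_decC hw.
have [M hM] := FC_decay; exists (FC w); split.
- by move=> s s0; exact: derC_derivable (derC_FC hw s0).
- exists (M * pi) => y y0.
  apply: (@le_trans _ _ (\int[lebesgue_measure]_x (M * (oneDsqr x)^-1)%:E)%E).
    apply: ge0_le_integral => //.
    - by move=> x _; rewrite lee_fin exprn_ge0 ?absC_ge0.
    - apply/measurable_EFinP; apply: measurable_funX; apply: continuous_measurable_fun => x.
      have h := derR_ctR (der_comp1 (w := fun x => pnt x y) (derC_FC hw (_ : 0 < ImC (pnt x y))) (derR_hor y x)).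
      have {}h : ctR (fun x => FC w (x +i* y)) x.
        by have := h _; rewrite !CE; under eq_fun do rewrite -pntE; apply; lra.
      exact: (clim_abs h).
    - apply/measurable_EFinP; apply: continuous_measurable_fun => x.
      by apply: cvgM; [exact: cvg_cst|exact: continuous_oneDsqrV].
    - by move=> x _; rewrite lee_fin; exact: (hM (x +i* y)).
  have := integrable_fin_num measurableT (integrable_Kq M).
  by move=> h; rewrite -(fineK h) lee_fin -Rintegral_Kq.
apply/aeW => x; rewrite -climE; apply: clim_near (clim_up (derC_ctC (dPhi1 (real_Dom hzim x)))).
near=> d; have d0 : 0 < d by near: d; exact: nbhs_right_gt.
by rewrite FC_Phi1 //; near: d; exact: near_up.
Unshelve. all: by end_near. Qed.

Lemma eigenfunction_solution : \sum_p ph p != 0 ->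
  eigenfunction eps (fun x : R => u0 c z x%:C) lambda w.
Proof.
move=> sum0; split.
- exact: Hardy_solution.
(* Nontriviality comes from the normalization: if [w] vanished almost everywhere, so would the
   integral of [u0 w], which equals the nonzero sum of the coefficients. *)
- move=> w0; move/eqP: sum0; apply; rewrite -integral_u0.
  have [Kw hw] := decC_w.
  have cu x : ctR (fun x : R => u0 c z x%:C * w x) x.
    apply: ctnM; last exact: ctR_w.
    exact: (@ctn_comp R _ (u0 c z) (@inR R) x (ctC_u0 c rot_i (real_Dom hzim x)) (@inR_ctn R x)).
  have key (pr : R[i] -> R) : pr 0 = 0 -> continuous (fun x : R => pr (u0 c z x%:C * w x)) ->
      Rintegral lebesgue_measure setT (pr \o (fun x : R => u0 c z x%:C * w x)) = 0.
    move=> pr0 cp; rewrite /Rintegral (@ae_eq_integral _ _ _ _ setT (cst 0%E)) ?integral0 //.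
      by apply/measurable_EFinP; exact: continuous_measurable_fun.
    apply: negligibleS w0 => x /=; apply: contra_not => wx _.
    by rewrite wx mulr0 pr0.
  rewrite [integralC _ _](_ : _ = 0) ?mulr0 //.
  by apply: complex_eq; rewrite /integralC /=; apply: key => // x; have /ctR_RI [] := cu x.
- by move=> x; have /derRP [h1 h2] := der_comp1 (dPhi1 (real_Dom hzim x)) (der_id (@inR R) x); split; exact: ex_derive.
- by move=> x; apply/cvg_ex; exists (u0 c z x%:C * w x - S x%:C); rewrite -climE; exact: cauchy_upper_limit.
move=> x; have -> : Cplus (fun y => u0 c z y%:C * w y) x = u0 c z x%:C * w x - S x%:C.
  by apply: (@cvg_lim R[i]^o); [exact: norm_hausdorff|rewrite -climE; exact: cauchy_upper_limit].
have -> : deriveC w x = rhs Phi1 x%:C.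
  have /derRP [h1 h2] := der_comp1 (dPhi1 (real_Dom hzim x)) (der_id (@inR R) x).
  rewrite mulr1 in h1 h2; apply: complex_eq; rewrite /deriveC /= derive1E; exact: derive_val.
rewrite /rhs; have e0 : eps%:C != 0 :> R[i] by rewrite real_neq0 gt_eqF.
rewrite mulrA (_ : 'i * eps%:C * ('i / eps%:C) = -1); first by ring.
by rewrite mulrACA divff // mulr1 mulii.
Qed.

End Continuation.

Theorem corollary3 (R : realType) (P : nat) (eps : R) (c z : 'I_P -> R[i])
    (rad lambda : R) (C : 'I_P -> R -> R[i]) (L : R -> R -> R[i])
    (phi : 'cV[R[i]]_P)
    (heps : 0 < eps)
    (hP : (1 <= P)%N)
    (hc : forall p, c p != 0)
    (hcsum : \sum_p (c p + (c p)^*) = 0)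
    (hzim : forall p, 0 < ImC (z p))
    (hzre : forall p q : 'I_P, (p < q)%N -> ReC (z p) < ReC (z q))
    (hrad : forall p, absC (z p) < rad)
    (hlambda : lambda < 0)
    (hC : forall m, Ccontour eps c z rad m (C m))
    (hL : forall x : R, Phi_contour z rad x (L x))
    (hdet : \det (Amatrix eps c z C lambda) = 0)
    (hphi0 : phi != 0)
    (hphi : Amatrix eps c z C lambda *m phi = 0)
    (hnorm : \sum_p phi p 0 = lambda%:C) :
  [/\ (2 * pi *i)^-1 *
        integralC setT (fun x : R => u0 c z x%:C * Phi eps c z L lambda phi x)
        = lambda%:C,
      Hardy_plus (Phi eps c z L lambda phi) &
      eigenfunction eps (fun x : R => u0 c z x%:C) lambda
        (Phi eps c z L lambda phi)].
Proof.
have rad0 : 0 < rad by exact: le_lt_trans (absC_ge0 _) (hrad (Ordinal hP)).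
have [Phi1 [Phi2 [K [h1 h2 agree small ePhi]]]] :=
  solution_package heps hlambda rad0 hzim hrad hzre hC hL hphi.
have d1 s (hs : Dom z 'i s) := (h1 s hs).1.
have d2 s (hs : Dom z (- 'i) s) := (h2 s hs).1.
have far s (hs : Dom z (- 'i) s) := (h2 s hs).2.
have -> : Phi eps c z L lambda phi = fun x : R => Phi1 x%:C by apply/funext.
split.
- by rewrite (integral_u0 heps rad0 hP hzim hrad hzre d1 d2 agree small far).
- exact: (Hardy_solution rad0 hP hzim hrad hzre d1 d2 agree small far).
apply: (eigenfunction_solution heps rad0 hP hzim hrad hzre d1 d2 agree small far).
by rewrite hnorm real_neq0 lt_eqF.
Qed.
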